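(* Let $(a,b,m,n)\in\mathcal Q$ with $m\le n$. Assume that $F\in R_{m,n}$, $G\in R_{bm/a,\,bn/a}$, and $[F,G]\in\mathbb C$. Let $Z$ be the innermost polynomial of $F$. Then either $Z=0$, or there exists a lattice point $(m',n')\in\mathbb Z_{>0}^2$ such that (1) $Z\in\overline R_{m',n'}$; (2) $(m',n')\in\mathfrak R:=\{(x,y)\in\mathbb R^2 : 0\le y<\frac{a-1}{a}n \text{ and } \mathfrak m\,(x-\frac{a}{a+b})+\frac{a}{a+b}\le y\le \frac nm x\}$, where $\mathfrak m=(n-\frac{a}{a+b})/(m-\frac{a}{a+b})$ is the slope of the line through $(m,n)$ and $(\frac{a}{a+b},\frac{a}{a+b})$.
   Context: $\mathcal R=\mathbb C[x,y]$ and $[f,g]=\frac{\partial f}{\partial x}\frac{\partial g}{\partial y}-\frac{\partial f}{\partial y}\frac{\partial g}{\partial x}$. For $f=\sum f_{ij}x^iy^j\in\mathcal R$, $\mathrm{supp}(f)=\{(i,j): f_{ij}\ne0\}$ and $N^0(f)$ is the convex hull of $\mathrm{supp}(f)\cup\{(0,0)\}$. $\mathrm{Rect}_{m,n}=[0,m]\times[0,n]\subset\mathbb R^2$. For positive integers $m,n$: $R_{m,n}$ is the set of $f\in\mathcal R$ with $N^0(f)=\mathrm{Rect}_{m,n}$ and the coefficient of $x^my^n$ in $f$ equal to $1$; $\overline R_{m,n}$ is the set of $f\in\mathcal R$ with $N^0(f)\subseteq\mathrm{Rect}_{m,n}$ and nonzero coefficient of $x^my^n$. $\mathcal Q=\{(a,b,m,n)\in\mathbb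 Z_{>0}^4 : a\mid m,\ a\mid n,\ \gcd(a,b)=1,\ 2\le a<b\}$. $\mathbb T\subset\mathbb C[z]$ is the set of monic polynomials $z^k+e_{k-1}z^{k-1}+\cdots+e_0$ with $k\ge1$ and $e_{k-1}=0$. For $f\in\mathcal R$, $\mathcal W(f)=\{W\in\mathcal R : f=\alpha(W)\text{ for some }\alpha\in\mathbb T\}$; $f$ is called principal if $\mathcal W(f)=\{f\}$. Given $F\in R_{m,n}$, let $\mathcal N''=[\frac{a-1}{a}m,m]\times[\frac{a-1}{a}n,n]$. The pre-generator $Q$ of $(F,a)$ is the unique polynomial with $\mathrm{supp}(Q)\subseteq\mathrm{Rect}_{m/a,n/a}$, coefficient of $x^{m/a}y^{n/a}$ equal to $1$, and $\mathrm{supp}(F-Q^a)\cap\mathcal N''=\emptyset$. The $F$-generator $W_F$ is the unique principal polynomial in $\mathcal W(Q)$ such that, writing $Q=\beta(W_F)$ with $\beta\in\mathbb T$ of degree $\delta$, the coefficient of $x^{m/(a\delta)}y^{n/(a\delta)}$ in $W_F$ is $1$. Let $e_0,\dots,e_{(a-1)\delta-1}\in\mathbb C$ be the unique constants such that $$Z:=F-Q^a-\sum_{j=0}^{(a-1)\delta-1}e_jW_F^j$$ has zero coefficient at $x^{jm/(a\delta)}y^{jn/(a\delta)}$ for every integer $0\le j\le(a-1)\delta-1$. This $Z$ is the innermost polynomial of $F$. *)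

(* Defs.v *)
From HB Require Import structures.
From mathcomp Require Import all_boot all_order all_algebra.
From mathcomp Require Import boolp classical_sets set_interval reals convex.
From mathcomp Require Import complex.
(* mpoly must be imported after the analysis files: in the other order some
   notations clash. *)
From mathcomp Require Import mpoly.

Set Implicit Arguments.
Unset Strict Implicit.
Unset Printing Implicit Defensive.

Import Order.TTheory GRing.Theory Num.Theory.

Local Open Scope classical_set_scope.
Local Open Scope ring_scope.

(* The complex numbers are R[i], for R the real numbers (R : realType). In
   C[x,y], x is the variable of index 0 and y the one of index 1. *)
Notation bipoly R := {mpoly R[i][2]}.

(* R^o makes the plane an lmodType over R, as convex_set requires. *)
Notation plane R := (R^o * R^o)%type.

Definition var_x : 'I_2 := @Ordinal 2 0 isT.
Definition var_y : 'I_2 := @Ordinal 2 1 isT.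

Definition xy (i j : nat) : 'X_{1..2} := [multinom [tuple i; j]].

Definition bracket (R : realType) (f g : bipoly R) : bipoly R :=
  f^`M(var_x) * g^`M(var_y) - f^`M(var_y) * g^`M(var_x).

Section Newton.
Variable R : realType.
Implicit Types f : bipoly R.

Definition lattice_pt (i j : nat) : plane R := (i%:R, j%:R).

Definition supp f : set (plane R) :=
  [set p | exists i j : nat, f@_(xy i j) != 0 /\ p = lattice_pt i j].

Definition convex_hull (A : set (plane R)) : set (plane R) :=
  smallest (@convex_set R (plane R)) A.

Definition N0 f : set (plane R) := convex_hull (supp f `|` [set lattice_pt 0 0]).

Definition Rect (m n : nat) : set (plane R) :=
  `[0, m%:R]%classic `*` `[0, n%:R]%classic.

Definition R_ (m n : nat) : set (bipoly R) :=
  [set f | N0 f = Rect m n /\ f@_(xy m n) = 1].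

Definition Rbar_ (m n : nat) : set (bipoly R) :=
  [set f | N0 f `<=` Rect m n /\ f@_(xy m n) != 0].

End Newton.
Arguments lattice_pt R i j : clear implicits.
Arguments Rect R m n : clear implicits.
Arguments R_ R m n : clear implicits.
Arguments Rbar_ R m n : clear implicits.

Definition inQ (a b m n : nat) : Prop :=
  [/\ [/\ (0 < a)%N, (0 < b)%N, (0 < m)%N & (0 < n)%N],
      (a %| m)%N, (a %| n)%N, coprime a b & (2 <= a < b)%N].

Section Generators.
Variable R : realType.
Implicit Types (f F Q W Z : bipoly R) (alpha beta : {poly R[i]}).

(* For degree k = (size alpha).-1, the coefficient e_(k-1) has index
   (size alpha).-2. *)
Definition TT : set {poly R[i]} :=
  [set alpha | [/\ alpha \is monic, (1 < size alpha)%N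
                 & alpha`_(size alpha).-2 = 0]].

(* horner_alg W alpha is alpha(W). *)
Definition calW f : set (bipoly R) :=
  [set W | exists2 alpha, TT alpha & f = horner_alg W alpha].

Definition principal f : Prop := calW f = [set f].

Definition Ncorner (a m n : nat) : set (plane R) :=
  `[(a%:R - 1) / a%:R * m%:R, m%:R]%classic `*`
  `[(a%:R - 1) / a%:R * n%:R, n%:R]%classic.

Definition pre_generator (a m n : nat) F Q : Prop :=
  [/\ supp Q `<=` Rect R (m %/ a) (n %/ a),
      Q@_(xy (m %/ a) (n %/ a)) = 1
    & supp (F - Q ^+ a) `&` Ncorner a m n = set0].

(* W is the F-generator attached to the pre-generator Q, and Q = beta(W). The
   division by a * delta is exact, since m / a = delta * deg_x W and likewise
   for n. *)
Definition generator (a m n : nat) Q W beta : Prop :=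
  let delta := (size beta).-1 in
  [/\ calW Q W, principal W, TT beta, Q = horner_alg W beta
    & W@_(xy (m %/ (a * delta)) (n %/ (a * delta))) = 1].

Definition innermost (a m n : nat) F Z : Prop :=
  exists Q W beta (e : nat -> R[i]),
    let delta := (size beta).-1 in
    let N := ((a - 1) * delta)%N in
    [/\ pre_generator a m n F Q, generator a m n Q W beta,
        Z = F - Q ^+ a - \sum_(j < N) e j *: W ^+ j
      & forall j : nat, (j < N)%N ->
          Z@_(xy (j * (m %/ (a * delta))) (j * (n %/ (a * delta)))) = 0].

(* The slope of the line through (m, n) and (a/(a+b), a/(a+b)). *)
Definition slope (a b m n : nat) : R :=
  let c : R := a%:R / (a%:R + b%:R) in (n%:R - c) / (m%:R - c).

Definition frakR (a b m n : nat) : set (plane R) :=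
  [set p : plane R | let: (x, y) := p in let c : R := a%:R / (a%:R + b%:R) in
    (0 <= y < (a%:R - 1) / a%:R * n%:R) /\
    (slope a b m n * (x - c) + c <= y <= n%:R / m%:R * x)].

End Generators.
Arguments frakR R a b m n : clear implicits.

(* Main.v *)
From HB Require Import structures.
Require Import Defs.
From mathcomp Require Import all_boot all_order all_algebra.
From mathcomp Require Import boolp classical_sets set_interval reals convex.
From mathcomp Require Import interval_inference.
From mathcomp Require Import complex.
From mathcomp Require Import mpoly.
From mathcomp Require Import zify ring lra.
Set Implicit Arguments.
Unset Strict Implicit.
Unset Printing Implicit Defensive.
Import Order.TTheory GRing.Theory Num.Theory.
Local Open Scope ring_scope.

(** Let (p, q) be the bidegree of the generator W. The innermost polynomial is
    Z = F - phi(W), where phi = beta^a + sum_j e_j X^j is monic of degree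
    a delta, and (m, n) = (a delta p, a delta q). Two leading monomials of Z are
    studied: the one of highest degree l in y, with coefficient zeta(x) of
    degree i, and the one of highest degree k in x, with coefficient of degree j
    in y. The theorem amounts to (i, l) = (k, j) together with two inequalities:
    then this monomial is a corner of a rectangle that contains the support.

    - One direction ([l_le], [l_strict], [zeta_degree]). Let rho be a root of
      multiplicity mu of the top coefficient w(x) of W in y, and let o be the
      order of zeta at rho. The key inequality is
        q o >= l mu + (n - l) t,
      where t <= 0 is an explicit level ([tlev]) that vanishes when mu <= q.
      Summing over rho bounds i = deg zeta from below.

    - Two directions ([two_directions]). The same argument with x and y
      exchanged bounds j from below. The two bounds describe a region of
      horizontal width less than 1, which forces the two monomials to coincide
      ([width_lt1]).

    The key inequality is local at x = rho. With s = x - rho, consider discs in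
    the y-line over the field of Puiseux series in s, each with a coordinate xi.
    On a disc a polynomial has an order in s and a leading form, which is a
    polynomial in xi. As [F,G] is constant, the leading forms f of F and g of G
    have Jacobian zero as long as F and G are large enough on the disc, whence
    a mult_x(g) = b mult_x(f) for every x ([disc_mup]); as a and b are coprime, f
    is then an a-th power h^a ([boundary_pow]).

    Suppose that the key inequality fails and that l < (a - 1) delta q. Start
    with a disc that contains all the zeros of W and Z and shrink it, always
    towards a point where Z has relatively few zeros. The failed inequality says
    that, before W reaches order t, there is a disc on which Z becomes as large
    as phi(W) while its leading form z still has degree less than
    (a - 1) deg(U), where U is the delta-th power of the leading form of W. There
    h^a = U^a + z, which is absurd: the difference of two a-th powers has degree
    at least (a - 1) deg(U) ([pow_perturb], [boundary_degree]). This is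
    [descent].

    If l >= (a - 1) delta q, then Z is too large for this argument, and W is
    replaced by an approximate a-th root of F, whose coefficients are rational
    functions of x. The coefficient zeta of Z is visible in it
    ([approx_root]), so that the key inequality becomes a bound on the poles of
    the approximate root. A violation produces, by walking towards the centre of
    the disc, either an absurd boundary disc or a starting point for [descent]
    ([walk]). It follows that l > (a - 1) delta q is impossible, because zeta
    would be divisible by w^((a-1) delta) and its top monomial would lie in the
    region where F and the a-th power of the pre-generator agree
    ([zeta_small]). *)

(** * Multiplicities of roots *)

Section Univariate.
Variable C : numClosedFieldType.
Implicit Types (p q f g h U V : {poly C}) (x : C).

Lemma mupX x p n : p != 0 -> mup x (p ^+ n) = (n * mup x p)%N.
Proof.
move=> p0; elim: n => [|n IH]; first by rewrite expr0 mupNroot // root1.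
by rewrite exprS mupM ?expf_neq0 // IH mulSn.
Qed.

Lemma mupZ x (c : C) p : c != 0 -> mup x (c *: p) = mup x p.
Proof.
by move=> c0; rewrite -mul_polyC mupMr // rootC.
Qed.

Lemma mup_prodXsubC x (s : seq C) :
  mup x (\prod_(y <- s) ('X - y%:P)) = count_mem x s.
Proof.
elim: s => [|y s IH]; first by rewrite big_nil mupNroot // root1.
rewrite big_cons mupM ?polyXsubC_eq0 ?monic_neq0 ?monic_prod_XsubC //.
rewrite IH /= -[X in mup x X]expr1 mup_XsubCX.
by rewrite eq_sym; case: (x == y).
Qed.

Lemma closed_splits p : p != 0 ->
  exists s : seq C, [/\ p = lead_coef p *: \prod_(y <- s) ('X - y%:P),
    size s = (size p).-1 & forall x, mup x p = count_mem x s].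
Proof.
move=> p0; have [s ps] := closed_field_poly_normal p.
exists s; split=> //.
  by rewrite ps size_scale ?lead_coef_eq0 // size_prod_XsubC.
by move=> x; rewrite ps mupZ ?lead_coef_eq0 // mup_prodXsubC.
Qed.

Lemma sum_count_mem (s r : seq C) : uniq s ->
  (\sum_(x <- s) count_mem x r)%N = count (mem s) r.
Proof.
move=> us; elim: r => [|y r IH]; first by rewrite big1.
rewrite /= big_split /= IH; congr (_ + _)%N.
rewrite -(count_uniq_mem y us) -sum1_count [RHS]big_mkcond /=.
by apply: eq_bigr => x _; rewrite eq_sym; case: (x == y).
Qed.

Lemma sum_mup_le p (s : seq C) : p != 0 -> uniq s ->
  (\sum_(x <- s) mup x p <= (size p).-1)%N.
Proof.
move=> p0 us; have [r [_ sr mr]] := closed_splits p0.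
by rewrite -sr (eq_bigr _ (fun x _ => mr x)) sum_count_mem // count_size.
Qed.

Lemma sum_mup_roots p : p != 0 -> exists s : seq C,
  [/\ uniq s, forall x, (x \in s) = root p x
    & \sum_(x <- s) mup x p = (size p).-1]%N.
Proof.
move=> p0; have [r [pr sr mr]] := closed_splits p0.
exists (undup r); split; first exact: undup_uniq.
  by move=> x; rewrite mem_undup pr rootZ ?lead_coef_eq0 // root_prod_XsubC.
rewrite -sr (eq_bigr _ (fun x _ => mr x)) sum_count_mem ?undup_uniq //.
by apply/eqP; rewrite -all_count; apply/allP => x xr /=; rewrite mem_undup.
Qed.

(** If every root of [p] were proportionally more often a root of [q] than
    the degrees allow, then [q] would have too many roots. *)
Lemma root_low_multiplicity p q : p != 0 -> q != 0 -> (1 < size p)%N ->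
  exists x, (0 < mup x p)%N /\
    (mup x q * (size p).-1 <= (size q).-1 * mup x p)%N.
Proof.
move=> p0 q0 sp; have [s [us sr sm]] := sum_mup_roots p0.
have [/hasP[x xs le]|/hasPn no] := boolP
   (has (fun x => (mup x q * (size p).-1 <= (size q).-1 * mup x p)%N) s).
  by exists x; split; rewrite // -XsubC_dvd // dvdp_XsubCl -sr.
have s0 : s != [::].
  by apply/eqP => s0; move: sm sp; rewrite s0 big_nil; case: (size p) => [|[]].
have: ((size q).-1 * \sum_(x <- s) mup x p
       < \sum_(x <- s) mup x q * (size p).-1)%N.
  rewrite big_distrr /=.
  case: s s0 no {us sr sm} => // x s _ no; rewrite !big_cons.
  rewrite -addSn leq_add //; first by rewrite ltnNge no ?mem_head.
  rewrite big_seq [X in (_ <= X)%N]big_seq leq_sum // => y ys.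
  by apply/ltnW; rewrite ltnNge no // inE ys orbT.
by rewrite -big_distrl /= sm ltnNge leq_mul2r sum_mup_le ?orbT.
Qed.

Lemma mup_split x p : p != 0 ->
  exists2 u : {poly C}, p = ('X - x%:P) ^+ mup x p * u & u.[x] != 0.
Proof.
move=> p0; have [m [u]] := multiplicity_XsubC p x; rewrite p0 /= => nu pu.
have -> : mup x p = m by rewrite pu mupMr // mup_XsubCX eqxx.
by exists u; rewrite // mulrC.
Qed.

(** Splitting off one root at a time: over an algebraically closed field the
    multiplicities are the only obstruction to being a power. *)
Lemma pow_of_mup a p : (0 < a)%N -> p != 0 -> (forall x, (a %| mup x p)%N) ->
  exists h, p = h ^+ a.
Proof.
move=> a0; have [n] := ubnP (size p); elim: n p => // n IH p sp p0 dv.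
have [sp1|sp1] := leqP (size p) 1.
  have [r rp] : exists r, r ^+ a = lead_coef p.
    have /closed_rootP[r] : size ('X^a - (lead_coef p)%:P) != 1%N.
      by rewrite size_XnsubC // eqSS -lt0n.
    by rewrite rootE !hornerE subr_eq0 => /eqP ?; exists r.
  exists r%:P; rewrite -polyC_exp rp [LHS](size1_polyC sp1).
  by rewrite lead_coefE; case: (size p) sp1 => [|[]].
have /closed_rootP[x /factor_theorem[q pq]] : size p != 1 by case: (size p) sp1 => [|[]].
have [u pu ux] := mup_split x p0.
have u0 : u != 0 by apply: contraNneq ux => ->; rewrite horner0.
have mx : (0 < mup x p)%N by rewrite -XsubC_dvd // pq dvdp_mull.
case: (IH u) => //.
- move: sp; rewrite {1}pu size_monicM ?size_exp_XsubC ?monicXn //; last exact: monic_exp (monicXsubC _).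
  by move: (mup x p) mx => [|k] // _; rewrite addSn /= ltnS; apply: leq_ltn_trans; rewrite leq_addl.
- move=> y; move: (dv y); rewrite {1}pu mupM ?expf_neq0 ?polyXsubC_eq0 //.
  rewrite mup_XsubCX; case: eqP => [->|_]; last by rewrite add0n.
  by rewrite dvdn_addr.
- move=> h uh; exists (('X - x%:P) ^+ (mup x p %/ a) * h).
  by rewrite exprMn -exprM divnK // -uh -pu.
Qed.

(** Compare the lowest order terms at [x] of both sides. *)
Lemma wronskian_mup (a b : nat) f g : f != 0 -> g != 0 ->
  f * g^`() *+ a = f^`() * g *+ b -> forall x, (a * mup x g = b * mup x f)%N.
Proof.
move=> f0 g0 eq x.
have [u fu ux] := mup_split x f0; have [v gv vx] := mup_split x g0.
set i := mup x f in fu *; set j := mup x g in gv *.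
have key h w k : h = ('X - x%:P) ^+ k * w ->
    h^`() * ('X - x%:P) = ('X - x%:P) ^+ k * (w *+ k + w^`() * ('X - x%:P)).
  move=> ->; have dk : (('X - x%:P) ^+ k)^`() * ('X - x%:P) = ('X - x%:P) ^+ k *+ k.
    rewrite deriv_exp derivXsubC mul1r; case: k => [|k]; first by rewrite !mulr0n mul0r.
    by rewrite mulrnAl -exprSr.
  by rewrite derivM mulrDl mulrAC dk [RHS]mulrDr mulrnAl mulrnAr mulrA.
set P := 'X - x%:P in fu gv key.
have P0 k : P ^+ k != 0 by rewrite expf_neq0 // polyXsubC_eq0.
have Px : P.[x] = 0 by rewrite hornerXsubC subrr.
clearbody P.
have E : P ^+ (i + j) * (u * (v *+ j + v^`() * P) *+ a) =
         P ^+ (i + j) * ((u *+ i + u^`() * P) * v *+ b).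
  have := congr1 (fun h => h * P) eq.
  rewrite /= !mulrnAl -mulrA (key _ _ _ gv) mulrAC (key _ _ _ fu) {1}fu {1}gv.
  have sw (s t s' t' : {poly C}) : s * t * (s' * t') = s * s' * (t * t') by ring.
  by rewrite (sw (P ^+ i) u) (sw (P ^+ i) (_ + _)) -exprD => E'; rewrite !mulrnAr E'.
have {}E := congr1 (fun h => h.[x]) (mulfI (P0 _) E).
move: E; rewrite !(hornerMn, hornerM, hornerD) Px !mulr0 !addr0.
rewrite mulrnAr mulrnAl -!mulrnA => /eqP; rewrite -[X in X == _]mulr_natr.
rewrite -[X in _ == X]mulr_natr (inj_eq (mulfI _)) ?mulf_neq0 // eqr_nat => /eqP.
by rewrite mulnC => ->; rewrite mulnC.
Qed.

(** Two [a]-th powers that are close have close roots, up to an [a]-th root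
    of unity: [h^a - U^a] is [h - U] times a factor of degree
    [(a - 1) deg U]. *)
Lemma pow_perturb a h U V : (0 < a)%N -> U != 0 -> V != 0 ->
  ((size V).-1 < a * (size U).-1)%N -> h ^+ a = U ^+ a + V ->
  exists d, [/\ d != 0, (U + d) ^+ a = U ^+ a + V
    & ((size V).-1 = (size d).-1 + a.-1 * (size U).-1)%N].
Proof.
move=> a0 U0 V0 sV hUV.
have sUa : size (U ^+ a) = (a * (size U).-1).+1.
  by rewrite -[LHS]prednK ?size_poly_gt0 ?expf_neq0 // size_exp mulnC.
have sVU : (size V < size (U ^+ a))%N by rewrite sUa; case: (size V) sV.
have sh : size (h ^+ a) = size (U ^+ a) by rewrite hUV size_polyDl.
have h0 : h != 0.
  by apply/eqP => h0; move: sh; rewrite h0 expr0n gtn_eqF //= sUa size_poly0.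
have lh : lead_coef h ^+ a = lead_coef U ^+ a.
  by rewrite -!lead_coef_exp hUV lead_coefDl.
pose z := lead_coef U / lead_coef h.
have lh0 : lead_coef h != 0 by rewrite lead_coef_eq0.
have lU0 : lead_coef U != 0 by rewrite lead_coef_eq0.
have z0 : z != 0 by rewrite mulf_neq0 ?invr_eq0.
have za : z ^+ a = 1 by rewrite expr_div_n lh divff // expf_neq0.
pose f := z *: h.
have fa : f ^+ a = U ^+ a + V by rewrite exprZn za scale1r.
have lf : lead_coef f = lead_coef U by rewrite lead_coefZ divfK.
have sf : size f = size U.
  rewrite size_scale //.
  have := congr1 predn sh; rewrite !size_exp => /eqP; rewrite eqn_pmul2r // => /eqP e.
  by rewrite -(prednK (_ : 0 < size h)%N) ?e ?prednK ?size_poly_gt0.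
exists (f - U); set d := f - U.
have dE : (U + d) ^+ a = U ^+ a + V by rewrite addrC subrK.
have VE : V = d * \sum_(i < a) f ^+ (a.-1 - i) * U ^+ i.
  by rewrite -[LHS](addKr (U ^+ a)) addrC -fa subrXX.
have d0 : d != 0 by apply: contraNneq V0 => d0; rewrite VE d0 mul0r.
split=> //.
set S := \sum_(i < a) _ in VE.
have S0 : S != 0 by apply: contraNneq V0 => S0; rewrite VE S0 mulr0.
suff sS : (size S).-1 = (a.-1 * (size U).-1)%N.
  rewrite VE size_mul // -sS.
  by move: d0 S0; rewrite -!size_poly_gt0; case: (size d) => // k; case: (size S) => // l; rewrite addnS.
have term (i : 'I_a) : size (f ^+ (a.-1 - i) * U ^+ i) = (a.-1 * (size U).-1).+1
   /\ lead_coef (f ^+ (a.-1 - i) * U ^+ i) = lead_coef U ^+ a.-1.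
  have ia : (i <= a.-1)%N by rewrite -ltnS prednK.
  have f0 : f != 0 by rewrite -lead_coef_eq0 lf.
  split; last by rewrite lead_coefM !lead_coef_exp lf -exprD subnK.
  rewrite size_mul ?expf_neq0 //.
  have s1 : size (f ^+ (a.-1 - i)) = ((a.-1 - i) * (size U).-1).+1.
    by rewrite -[LHS]prednK ?size_poly_gt0 ?expf_neq0 // size_exp sf mulnC.
  have s2 : size (U ^+ i) = (i * (size U).-1).+1.
    by rewrite -[LHS]prednK ?size_poly_gt0 ?expf_neq0 // size_exp mulnC.
  by rewrite s1 s2 addnS /= addSn -mulnDl subnK.
have Sc : S`_(a.-1 * (size U).-1) = lead_coef U ^+ a.-1 *+ a.
  rewrite coef_sum (eq_bigr (fun=> lead_coef U ^+ a.-1)).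
    by rewrite sumr_const card_ord.
  by move=> i _; case: (term i) => si <-; rewrite lead_coefE si.
have Sc0 : S`_(a.-1 * (size U).-1) != 0.
  by rewrite Sc mulrn_eq0 negb_or -lt0n a0 expf_neq0.
have Sle : (size S <= (a.-1 * (size U).-1).+1)%N.
  apply: (leq_trans (size_sum _ _ _)); apply/bigmax_leqP => i _.
  by case: (term i) => ->.
apply/eqP; rewrite eqn_leq -ltnS prednK ?size_poly_gt0 // Sle /=.
rewrite -ltnS prednK ?size_poly_gt0 // ltnNge; apply: contra Sc0 => le.
by rewrite nth_default.
Qed.

End Univariate.

Section MoreUnivariate.
Variable C : numClosedFieldType.
Implicit Types (p q : {poly C}) (x : C).

Lemma mup0P p n : p`_n != 0 -> (forall j, (j < n)%N -> p`_j = 0) -> mup 0 p = n.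
Proof.
move=> pn lo.
have pE : p = 'X^n * drop_poly n p.
  rewrite -[LHS](poly_take_drop n) [take_poly n p](_ : _ = 0) ?add0r 1?mulrC //.
  by apply/polyP => i; rewrite coef_take_poly coef0; case: ltnP => // /lo.
rewrite pE mupMl; last by rewrite rootE horner_coef0 coef_drop_poly.
by rewrite (_ : 'X^n = ('X - 0%:P) ^+ n) ?mup_XsubCX ?eqxx // polyC0 subr0.
Qed.

Lemma mup0_coef p : p != 0 -> p`_(mup 0 p) != 0 /\
  (forall j, (j < mup 0 p)%N -> p`_j = 0).
Proof.
move=> p0; have [u pu ux] := mup_split 0 p0.
move: (mup 0 p) pu => n; rewrite subr0 => ->; split.
  by rewrite coefXnM ltnn subnn -horner_coef0.
by move=> j jn; rewrite coefXnM jn.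
Qed.

Lemma mup_shift p x : p != 0 -> mup 0 (p \Po ('X + x%:P)) = mup x p.
Proof.
move=> p0; have [u pu ux] := mup_split x p0.
rewrite {1}pu rmorphM rmorphXn /= comp_polyB comp_polyX comp_polyC addrK.
rewrite mupMl; last by rewrite rootE horner_comp !hornerE.
by rewrite (_ : 'X^_ = ('X - 0%:P) ^+ mup x p) ?mup_XsubCX ?eqxx // polyC0 subr0.
Qed.

Lemma mup_full p x n : size p = n.+1 -> mup x p = n ->
  p = lead_coef p *: ('X - x%:P) ^+ n.
Proof.
move=> sp mx; have p0 : p != 0 by rewrite -size_poly_eq0 sp.
have [u pu ux] := mup_split x p0; rewrite mx in pu.
have u0 : u != 0 by apply: contraNneq ux => ->; rewrite horner0.
have su : (size u <= 1)%N.
  move: sp; rewrite pu size_monicM ?monic_exp ?monicXsubC // size_exp_XsubC addSn /=.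
  by rewrite -[RHS]addn1 => /addnI ->.
rewrite {1}pu (size1_polyC su) mulrC mul_polyC; congr (_ *: _).
rewrite pu lead_coefM (monicP (monic_exp _ (monicXsubC _))) mul1r.
by rewrite lead_coefE; case: (size u) su u0 => [|[]].
Qed.

End MoreUnivariate.

(** * Orders, leading forms and vertices *)

Section Bivariate.
Variable C : numClosedFieldType.
Notation BP := {poly {poly C}}.
Implicit Types (P Q F G : BP) (o n k p : nat).

(** The elements of [{poly {poly C}}] are read as polynomials in an outer
    variable [xi] over [C[s]]: the coefficient of [s^i xi^j] is [P`_j`_i]. The
    order is the one in [s], the Gauss valuation of the disc with coordinate
    [xi]. *)
Definition ordge P o := forall j i, (i < o)%N -> P`_j`_i = 0.
(** The leading form, when [o] is the order of [P]. *)
Definition lf o P : {poly C} := map_poly (coefp o) P.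

Lemma lfE o P j : (lf o P)`_j = P`_j`_o.
Proof. by rewrite /lf coef_map. Qed.

Lemma ordge_factor P o : ordge P o ->
  exists2 P1, P = ('X^o)%:P * P1 & lf o P = lf 0 P1.
Proof.
move=> oP; exists (map_poly (drop_poly o) P).
  apply/polyP => j; rewrite coefCM coef_map_id0 ?drop_poly0r //.
  rewrite -[LHS](poly_take_drop o) mulrC [take_poly _ _](_ : _ = 0) ?add0r //.
  by apply/polyP => i; rewrite coef_take_poly coef0; case: ltnP => // /oP.
apply/polyP => j; rewrite !lfE coef_map_id0 ?drop_poly0r //.
by rewrite coef_drop_poly add0n.
Qed.

Lemma factor_ordge P1 o : ordge (('X^o)%:P * P1) o.
Proof. by move=> j i io; rewrite coefCM coefXnM io. Qed.

Lemma lf_factor P1 o : lf o (('X^o)%:P * P1) = lf 0 P1.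
Proof. by apply/polyP => j; rewrite !lfE coefCM coefXnM ltnn subnn. Qed.

Lemma ordgeM P Q o o' : ordge P o -> ordge Q o' -> ordge (P * Q) (o + o').
Proof.
move=> /ordge_factor[P1 -> _] /ordge_factor[Q1 -> _].
by rewrite mulrACA -rmorphM -exprD; apply: factor_ordge.
Qed.

Lemma lfM P Q o o' : ordge P o -> ordge Q o' ->
  lf (o + o') (P * Q) = lf o P * lf o' Q.
Proof.
move=> /ordge_factor[P1 -> _] /ordge_factor[Q1 -> _].
by rewrite mulrACA -rmorphM -exprD !lf_factor /lf rmorphM.
Qed.

Lemma ordge0 P : ordge P 0. Proof. by []. Qed.

Lemma ordgeX P o n : ordge P o -> ordge (P ^+ n) (n * o).
Proof.
move=> oP; elim: n => [|n IH]; first exact: ordge0.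
by rewrite exprS mulSn; apply: ordgeM.
Qed.

Lemma lfX P o n : ordge P o -> lf (n * o) (P ^+ n) = lf o P ^+ n.
Proof.
move=> oP; elim: n => [|n IH]; first by rewrite !expr0 mul0n /lf rmorph1.
by rewrite !exprS mulSn lfM ?IH //; apply: ordgeX.
Qed.

Lemma ordgeW P o o' : (o' <= o)%N -> ordge P o -> ordge P o'.
Proof. by move=> le oP j i io; apply: oP; apply: leq_trans le. Qed.

Lemma ordgeD P Q o : ordge P o -> ordge Q o -> ordge (P + Q) o.
Proof. by move=> oP oQ j i io; rewrite !coefD oP ?oQ ?addr0. Qed.

Lemma ordge_sum (I : Type) (r : seq I) (S : pred I) (E : I -> BP) o :
  (forall i, S i -> ordge (E i) o) -> ordge (\sum_(i <- r | S i) E i) o.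
Proof.
move=> H; elim/big_rec: _ => [|i x Si]; last by apply: ordgeD; apply: H.
by move=> j i _; rewrite !coef0.
Qed.

Lemma lfD P Q o : lf o (P + Q) = lf o P + lf o Q.
Proof. by apply/polyP => j; rewrite coefD !lfE !coefD. Qed.

Lemma lf_lt P o o' : ordge P o' -> (o < o')%N -> lf o P = 0.
Proof. by move=> oP lt; apply/polyP => j; rewrite lfE coef0 oP. Qed.

Lemma lfCM (c : {poly C}) P o : c != 0 -> c`_0 != 0 -> ordge P o ->
  ordge (c%:P * P) o /\ lf o (c%:P * P) = c`_0 *: lf o P.
Proof.
move=> c0 c00 oP; have oc : ordge c%:P 0 by [].
split; first by rewrite -[o]add0n; apply: ordgeM.
by rewrite -{1}[o]add0n lfM // /lf map_polyC mul_polyC.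
Qed.

Lemma exists_ord P : P != 0 -> exists2 o, ordge P o & lf o P != 0.
Proof.
move=> P0.
pose S o := [exists j : 'I_(size P), P`_j`_o != 0].
have exS : exists o, S o.
  exists (size (lead_coef P)).-1; apply/existsP.
  have sP : ((size P).-1 < size P)%N by rewrite prednK ?size_poly_gt0.
  by exists (Ordinal sP); rewrite -!lead_coefE !lead_coef_eq0.
exists (ex_minn exS); case: ex_minnP => o /existsP[j Pj] min.
  move=> j' i io; apply/eqP; apply: contraTT io => ne; rewrite -leqNgt; apply: min.
  apply/existsP; have [lt|le] := ltnP j' (size P); first by exists (Ordinal lt).
  by move: ne; rewrite (nth_default 0 le) coef0 eqxx.
by apply: contraNneq Pj => lf0; rewrite -lfE lf0 coef0.
Qed.

Lemma ord_uniq P o o' : ordge P o -> lf o P != 0 -> ordge P o' -> lf o' P != 0 ->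
  o = o'.
Proof.
move=> h1 n1 h2 n2; case: (ltngtP o o') => // lt.
  by rewrite (lf_lt h2 lt) eqxx in n1.
by rewrite (lf_lt h1 lt) eqxx in n2.
Qed.

(** The lexicographically smallest exponent [(i, j)] of a monomial
    [s^i xi^j] of [P] is [(o, n)]: the order is [o], and [n] zeros of [P] reduce
    to [xi = 0]. On slightly smaller discs around [xi = 0] the monomial
    [s^o xi^n] alone is dominant. *)
Definition vtx P o n := P`_n`_o != 0 /\
  forall j i, P`_j`_i != 0 -> (o <= i)%N /\ (i = o -> (n <= j)%N).

Lemma vtx_ordge P o n : vtx P o n -> ordge P o.
Proof.
move=> [_ H] j i io; apply/eqP; apply: contraTT io => ne.
by rewrite -leqNgt; case: (H _ _ ne).
Qed.

Lemma vtx_lf P o n : vtx P o n -> lf o P != 0.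
Proof. by move=> [H _]; apply: contraNneq H => lf0; rewrite -lfE lf0 coef0. Qed.

Lemma vtx_mup P o n : vtx P o n -> mup 0 (lf o P) = n.
Proof.
move=> [Pn H]; apply: mup0P; first by rewrite lfE.
move=> j jn; rewrite lfE; apply/eqP; apply: contraTT jn => ne.
by rewrite -leqNgt; apply: (H _ _ ne).2.
Qed.

Lemma mup_vtx P o : ordge P o -> lf o P != 0 -> vtx P o (mup 0 (lf o P)).
Proof.
move=> oP l0; have [h1 h2] := mup0_coef l0; split; first by rewrite -lfE.
move=> j i ne; split; first by rewrite leqNgt; apply: contra ne => io; rewrite oP.
move=> io; rewrite leqNgt; apply: contra ne => jn.
by rewrite io -lfE h2.
Qed.

(** * Two substitutions *)

(** The coordinate change [s := s^k], [xi := s^p xi] zooms in on the disc of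
    radius [p/k] around [xi = 0]; radii are measured by orders in [s], so that
    small discs have large radii. *)
Definition rescale k p P : BP := (map_poly (comp_poly 'X^k) P) \Po ('X^p *: 'X).
Definition translate (x : C) P : BP := P \Po ('X + (x%:P)%:P).

Lemma coef_comp_scaleX P (c : {poly C}) j : (P \Po (c *: 'X))`_j = P`_j * c ^+ j.
Proof.
rewrite comp_polyE coef_sum.
have [lt|le] := ltnP j (size P); last first.
  rewrite nth_default // mul0r big1 // => i _.
  rewrite exprZn coefZ coefZ coefXn gtn_eqF ?mulr0 //.
  by apply: leq_trans le.
rewrite (bigD1 (Ordinal lt)) //= big1 ?addr0.
  by rewrite exprZn !coefZ coefXn eqxx mulr1.
move=> i ne; rewrite exprZn !coefZ coefXn eq_sym.
rewrite [(i : nat) == j](_ : _ = false) ?mulr0 //.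
by apply: contraNF ne => /eqP ij; apply/eqP/val_inj.
Qed.

Lemma coef_rescale k p P j : (rescale k p P)`_j = (P`_j \Po 'X^k) * 'X^(p * j).
Proof. by rewrite coef_comp_scaleX coef_map exprM. Qed.

Lemma rescale_coef k p P j i : (0 < k)%N -> (rescale k p P)`_j`_(k * i + p * j) = P`_j`_i.
Proof.
move=> k0; rewrite coef_rescale coefMXn ltnNge leq_addl addnK /=.
by rewrite coef_comp_poly_Xn // dvdn_mulr // mulKn.
Qed.

Lemma rescale_supp k p P j i : (0 < k)%N -> (rescale k p P)`_j`_i != 0 ->
  exists2 i', i = (k * i' + p * j)%N & P`_j`_i' != 0.
Proof.
move=> k0; rewrite coef_rescale coefMXn; case: ltnP => [|le]; first by rewrite eqxx.
rewrite coef_comp_poly_Xn //; case: ifP => [/dvdnP[q iq]|]; last by rewrite eqxx.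
rewrite iq mulnK // => ne; exists q => //; lia.
Qed.

Lemma rescaleM k p P Q : rescale k p (P * Q) = rescale k p P * rescale k p Q.
Proof. by rewrite /rescale !rmorphM. Qed.
Lemma rescaleD k p P Q : rescale k p (P + Q) = rescale k p P + rescale k p Q.
Proof. by rewrite /rescale !rmorphD. Qed.
Lemma rescaleN k p P : rescale k p (- P) = - rescale k p P.
Proof. by rewrite /rescale !rmorphN. Qed.
Lemma rescaleX k p P n : rescale k p (P ^+ n) = rescale k p P ^+ n.
Proof. by rewrite /rescale !rmorphXn. Qed.
Lemma rescaleMn k p P n : rescale k p (P *+ n) = rescale k p P *+ n.
Proof. by rewrite /rescale !rmorphMn. Qed.
Lemma rescale_sum k p (I : Type) (r : seq I) (S : pred I) (E : I -> BP) :
  rescale k p (\sum_(i <- r | S i) E i) = \sum_(i <- r | S i) rescale k p (E i).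
Proof. by rewrite /rescale !rmorph_sum. Qed.
Lemma rescaleC k p (c : {poly C}) : rescale k p c%:P = (c \Po 'X^k)%:P.
Proof. by rewrite /rescale map_polyC comp_polyC. Qed.

Lemma rescale_inj k p P : (0 < k)%N -> rescale k p P = 0 -> P = 0.
Proof.
move=> k0 m0; apply/polyP => j; apply/polyP => i.
by rewrite -(rescale_coef p _ _ _ k0) m0 !coef0.
Qed.

Lemma size_rescale k p P : (0 < k)%N -> size (rescale k p P) = size P.
Proof.
move=> k0; apply/eqP; rewrite eqn_leq; apply/andP; split.
  by apply/leq_sizeP => j sj; rewrite coef_rescale nth_default // comp_poly0 mul0r.
apply/leq_sizeP => j sj; apply/polyP => i; rewrite -(rescale_coef p _ _ _ k0).
by rewrite (nth_default _ sj) !coef0.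
Qed.

Lemma translateM x P Q : translate x (P * Q) = translate x P * translate x Q.
Proof. by rewrite /translate rmorphM. Qed.
Lemma translateD x P Q : translate x (P + Q) = translate x P + translate x Q.
Proof. by rewrite /translate rmorphD. Qed.
Lemma translateN x P : translate x (- P) = - translate x P.
Proof. by rewrite /translate rmorphN. Qed.
Lemma translateX x P n : translate x (P ^+ n) = translate x P ^+ n.
Proof. by rewrite /translate rmorphXn. Qed.
Lemma translateMn x P n : translate x (P *+ n) = translate x P *+ n.
Proof. by rewrite /translate rmorphMn. Qed.
Lemma translate_sum x (I : Type) (r : seq I) (S : pred I) (E : I -> BP) :
  translate x (\sum_(i <- r | S i) E i) = \sum_(i <- r | S i) translate x (E i).
Proof. by rewrite /translate rmorph_sum. Qed.
Lemma translateC x (c : {poly C}) : translate x c%:P = c%:P.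
Proof. by rewrite /translate comp_polyC. Qed.

Lemma size_translate x P : size (translate x P) = size P.
Proof. by rewrite /translate size_comp_poly2 // size_XaddC. Qed.

Lemma lead_translate x P : lead_coef (translate x P) = lead_coef P.
Proof.
by rewrite /translate lead_coef_comp ?size_XaddC // lead_coefXaddC expr1n mulr1.
Qed.

Lemma translate_ordge x P o : ordge P o -> ordge (translate x P) o.
Proof.
move=> /ordge_factor[P1 -> _]; rewrite translateM translateC; exact: factor_ordge.
Qed.

Lemma lf_translate x P o : ordge P o -> lf o (translate x P) = lf o P \Po ('X + x%:P).
Proof.
move=> /ordge_factor[P1 -> _]; rewrite translateM translateC !lf_factor /lf /translate.
rewrite map_comp_poly; congr (_ \Po _).
by apply/polyP => j; rewrite coef_map !coefD !coefX !coefC; case: j => [|[|j]];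
  rewrite /= /coefp ?coefD ?coefC ?coef0 ?coef1 ?addr0 ?add0r.
Qed.

Lemma translate_vtx x P o : ordge P o -> lf o P != 0 -> vtx (translate x P) o (mup x (lf o P)).
Proof.
move=> oP l0; rewrite -mup_shift // -lf_translate //; apply: mup_vtx; first exact: translate_ordge.
by rewrite lf_translate // comp_poly2_eq0 ?size_XaddC.
Qed.

(** * The logarithmic Jacobian *)

(** The Euler operator [s d/ds]. *)
Definition sd P : BP := map_poly (fun c => 'X * c^`()) P.

Lemma coef_sd P j : (sd P)`_j = 'X * (P`_j)^`().
Proof. by rewrite coef_map_id0 // deriv0 mulr0. Qed.

Lemma sdM P Q : sd (P * Q) = sd P * Q + P * sd Q.
Proof.
apply/polyP => j; rewrite coefD coef_sd !coefM raddf_sum /= mulr_sumr -big_split /=.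
by apply: eq_bigr => i _; rewrite derivM !coef_sd mulrDr mulrA mulrCA.
Qed.

(** The Jacobian of [s^(-f0) F] and [s^(-g0) G] with respect to [log s] and
    [xi], multiplied by [s^(f0 + g0)]: the shifts [f0] and [g0] avoid negative
    powers of [s]. *)
Definition Jf (f0 g0 : nat) F G : BP :=
  (sd F - F *+ f0) * G^`() - F^`() * (sd G - G *+ g0).

Lemma ordge_deriv P o : ordge P o -> ordge P^`() o.
Proof. by move=> oP j i io; rewrite coef_deriv coefMn oP ?mul0rn. Qed.

Lemma lf_deriv P o : lf o P^`() = (lf o P)^`().
Proof. by apply/polyP => j; rewrite !(lfE, coef_deriv) coefMn. Qed.

Lemma ordge_sd P f0 o : ordge P o -> ordge (sd P - P *+ f0) o.
Proof.
move=> oP j i io; rewrite coefB coef_sd coefMn coefB coefXM coefMn coef_deriv.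
by case: i io => [|i] io /=; rewrite !oP // !mul0rn subrr.
Qed.

Lemma lf_sd P f0 o : lf o (sd P - P *+ f0) = (o%:R - f0%:R) *: lf o P.
Proof.
apply/polyP => j; rewrite coefZ !lfE coefB coef_sd coefMn coefB coefXM coefMn coef_deriv.
by case: o => [|o] /=; rewrite mulrBl !mulr_natl ?mulr0n.
Qed.

(** The coefficient of [s^(oF + oG)] in the Jacobian only involves the
    leading forms, and it vanishes when the Jacobian has higher order. *)
Lemma Jf_lead f0 g0 F G oF oG T (c : C) : ordge F oF -> ordge G oG ->
  Jf f0 g0 F G = (c *: 'X^T)%:P -> (oF + oG < T)%N ->
  (oF%:R - f0%:R) *: (lf oF F * (lf oG G)^`()) =
  (oG%:R - g0%:R) *: ((lf oF F)^`() * lf oG G).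
Proof.
move=> hF hG EJ lt; apply/eqP; rewrite -subr_eq0.
have -> : (oF%:R - f0%:R) *: (lf oF F * (lf oG G)^`()) -
  (oG%:R - g0%:R) *: ((lf oF F)^`() * lf oG G) = lf (oF + oG) (Jf f0 g0 F G).
  rewrite /Jf lfD -scaleN1r -[in RHS](scaleN1r (_ * _)).
  have -> : lf (oF + oG) (-1 *: (F^`() * (sd G - G *+ g0))) =
     -1 *: lf (oF + oG) (F^`() * (sd G - G *+ g0)).
    by apply/polyP => j; rewrite coefZ !lfE coefZ !mulN1r coefN.
  rewrite !lfM ?lf_deriv ?lf_sd; try exact: ordge_sd; try exact: ordge_deriv; try by [].
  by rewrite scalerAl -scalerAr.
rewrite EJ; apply/eqP/polyP => j; rewrite lfE coefC coef0; case: eqP => _; last by rewrite coef0.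
by rewrite coefZ coefXn ltn_eqF ?mulr0.
Qed.

Lemma translate_deriv x P : (translate x P)^`() = translate x P^`().
Proof. by rewrite /translate deriv_comp derivD derivX derivC addr0 mulr1. Qed.

(** Moving the centre by a constant does not interfere with [s d/ds]. *)
Lemma translate_sd x P : sd (translate x P) = translate x (sd P).
Proof.
have sdC (c : {poly C}) : sd c%:P = ('X * c^`())%:P.
  by apply/polyP => j; rewrite coef_sd !coefC; case: eqP => // _; rewrite deriv0 mulr0.
elim/poly_ind: P => [|P c IH].
  by rewrite /translate comp_poly0 -polyC0 sdC deriv0 mulr0 comp_poly0.
have sdD Q R : sd (Q + R) = sd Q + sd R.
  by apply/polyP => j; rewrite !(coefD, coef_sd) derivD mulrDr.
have sdX : sd 'X = 0.
  apply/polyP => j; rewrite coef_sd coefX coef0.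
  by case: eqP => _; rewrite ?derivC ?mulr0 // -polyC1 derivC mulr0.
have sdtX : sd (translate x 'X) = 0.
  rewrite /translate comp_polyX sdD sdX sdC derivC mulr0 add0r; exact: polyC0.
by rewrite translateD translateM translateC !sdD !sdM IH sdX sdtX !mulr0 !addr0 translateD translateM sdC translateC.
Qed.

Lemma Jf_translate x f0 g0 F G : Jf f0 g0 (translate x F) (translate x G) = translate x (Jf f0 g0 F G).
Proof.
by rewrite /Jf !translate_deriv !translate_sd translateD translateN !translateM !translateD !translateN !translateMn.
Qed.

Lemma rescale_deriv k p P : (rescale k p P)^`() = ('X^p)%:P * rescale k p P^`().
Proof.
apply/polyP => j; rewrite coef_deriv coefCM !coef_rescale coef_deriv.
rewrite [(P`_j.+1 *+ _) \Po _]rmorphMn /= mulnS exprD mulrnAl mulrnAr.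
by congr (_ *+ _); ring.
Qed.

Lemma rescale_sd k p P : (0 < k)%N ->
  sd (rescale k p P) = rescale k p (sd P) *+ k + 'X * (rescale k p P)^`() *+ p.
Proof.
move=> k0; apply/polyP => j; rewrite coefD !coefMn coef_sd !coef_rescale coef_sd coefXM.
rewrite derivM deriv_comp derivXn comp_polyM comp_polyX derivXn mulrDr; congr (_ + _).
  rewrite mulrnAr mulrnAl mulrnAr; congr (_ *+ _).
  by rewrite -[in 'X^k](prednK k0) exprS; ring.
case: j => [|j]; first by rewrite /= muln0 mulr0n !mulr0 mul0rn.
rewrite /= coef_deriv coef_rescale.
case: p => [|p]; first by rewrite mul0n mulr0n !mulr0 mulr0n.
rewrite !mulrnAr -mulrnA [(j.+1 * _)%N]mulnC; congr (_ *+ _).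
have -> : 'X^(p.+1 * j.+1) = 'X * 'X^((p.+1 * j.+1).-1) :> {poly C} by rewrite -exprS.
ring.
Qed.

Lemma Jf_rescale k p f0 g0 F G : (0 < k)%N ->
  Jf (k * f0) (k * g0) (rescale k p F) (rescale k p G) =
  ('X^p)%:P * rescale k p (Jf f0 g0 F G) *+ k.
Proof.
move=> k0; rewrite /Jf !rescale_sd // !(rescaleD, rescaleN, rescaleM, rescaleMn) !rescale_deriv.
by rewrite !mulrnA; ring.
Qed.

End Bivariate.

(** * Breaks of the Newton polygon *)

Section Events.
Variable C : numClosedFieldType.
Notation BP := {poly {poly C}}.
Implicit Types (P : BP) (o n k p : nat) (x y : rat).

(** The supporting line of slope [p/k] at the vertex [(o, n)] bounds the
    Newton polygon of [P]: on the disc of radius [p/k] the monomial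
    [s^o xi^n] is still dominant. *)
Definition nsl P o n k p := forall j i, P`_j`_i != 0 ->
  (k * o + p * n <= k * i + p * j)%N.

(** The candidate slopes at the vertex [(o, n)]; the smallest one is the
    radius at which the Newton polygon breaks. *)
Definition evs P o n : seq rat :=
  [seq (ji.2%:R - o%:R) / (n%:R - ji.1%:R) |
    ji <- [seq (j, i) | j <- iota 0 n, i <- iota 0 (size P`_j)] & P`_(ji.1)`_(ji.2) != 0].

Lemma evsP P o n x : reflect
  (exists j i, [/\ (j < n)%N, P`_j`_i != 0 & x = (i%:R - o%:R) / (n%:R - j%:R)])
  (x \in evs P o n).
Proof.
apply: (iffP mapP) => [[[j i]]|[j [i [jn ne ->]]]].
  rewrite mem_filter => /andP[/= ne /allpairsPdep[j' [i' [h1 h2 [ej ei]]]]] ->.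
  by exists j, i; split=> //; move: h1; rewrite mem_iota ej.
exists (j, i) => //; rewrite mem_filter /= ne; apply/allpairsPdep; exists j, i.
split=> //; rewrite mem_iota //= add0n ltnNge; apply: contra ne => le.
by rewrite nth_default.
Qed.

Lemma nat_slope (o n i j k p : nat) x : (j < n)%N -> (0 < k)%N -> x * k%:R = p%:R ->
  (x <= (i%:R - o%:R) / (n%:R - j%:R)) = (k * o + p * n <= k * i + p * j)%N.
Proof.
move=> jn k0 xk; have nj : 0 < (n%:R - j%:R : rat) by rewrite subr_gt0 ltr_nat.
have k0' : 0 < k%:R :> rat by rewrite ltr0n.
rewrite ler_pdivlMr // -(ler_pM2r k0') mulrAC xk -(ler_nat rat) !natrD !natrM.
by rewrite mulrBr mulrBl lerBrDr addrAC lerBlDr ![_ * k%:R]mulrC [k%:R * o%:R + _]addrC.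
Qed.

Lemma evs_nsl P o n k p x : vtx P o n -> (0 < k)%N -> x * k%:R = p%:R ->
  (forall y, y \in evs P o n -> x <= y) -> nsl P o n k p.
Proof.
move=> [_ H] k0 xk xmin j i ne; have [oi _] := H _ _ ne.
have [jn|nj] := ltnP j n; last by rewrite leq_add // leq_mul2l ?oi ?nj orbT.
by rewrite -(nat_slope o i jn k0 xk); apply/xmin/evsP; exists j, i.
Qed.

Lemma evs_gt0 P o n x : vtx P o n -> x \in evs P o n -> 0 < x.
Proof.
move=> [_ H] /evsP[j [i [jn ne ->]]]; have [oi oin] := H _ _ ne.
rewrite divr_gt0 // subr_gt0 ltr_nat // ltn_neqAle oi andbT.
by apply: contraTneq jn => e; rewrite -leqNgt oin.
Qed.

Lemma slope_tie (o n i j k p : nat) x : (j < n)%N -> x * k%:R = p%:R ->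
  x = (i%:R - o%:R) / (n%:R - j%:R) -> (k * o + p * n = k * i + p * j)%N.
Proof.
move=> jn xk xe; have nj : (n%:R - j%:R : rat) != 0 by rewrite gt_eqF // subr_gt0 ltr_nat.
have {}xe : x * (n%:R - j%:R) = i%:R - o%:R by rewrite xe divfK.
apply/eqP; rewrite -(eqr_nat rat) !natrD !natrM -xk; apply/eqP.
have -> : i%:R = x * (n%:R - j%:R) + o%:R :> rat by rewrite xe subrK.
by ring.
Qed.

Lemma evs_tie P o n k p x : x * k%:R = p%:R -> x \in evs P o n ->
  exists j i, [/\ (j < n)%N, P`_j`_i != 0 & (k * o + p * n = k * i + p * j)%N].
Proof.
move=> xk /evsP[j [i [jn ne xe]]]; exists j, i; split=> //.
exact: slope_tie xk xe.
Qed.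

Lemma seq_min (s : seq rat) : s != [::] -> exists2 x, x \in s &
  forall y, y \in s -> x <= y.
Proof.
elim: s => // x [_ _|z s IH _]; first by exists x; rewrite ?mem_head // => y /[!inE] /eqP ->.
have [//|m ms mmin] := IH; have [le|/ltW le] := leP x m.
  exists x; rewrite ?mem_head // => y; rewrite inE => /orP[/eqP -> //|/mmin].
  exact: le_trans.
exists m; first by rewrite inE ms orbT.
by move=> y; rewrite inE => /orP[/eqP -> //|/mmin].
Qed.

Lemma rat_pk x : 0 < x -> exists k p,
  [/\ (0 < k)%N, (0 < p)%N, coprime k p & x * k%:R = p%:R].
Proof.
move=> x0; exists `|denq x|%N, `|numq x|%N.
have nx : 0 < numq x by rewrite numq_gt0.
split; rewrite ?absz_gt0 ?denq_neq0 ?gt_eqF //.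
  by rewrite coprime_sym coprime_num_den.
rewrite !natr_absz !gtr0_norm ?denq_gt0 //.
by rewrite -[X in X * _]divq_num_den divfK // intr_eq0 denq_neq0.
Qed.

Lemma rescale_ordge P o n k p : (0 < k)%N -> nsl P o n k p -> ordge (rescale k p P) (k * o + p * n).
Proof.
move=> k0 H j i; apply: contraTeq => /(rescale_supp k0)[i' -> ne].
by rewrite -leqNgt H.
Qed.

Lemma rescale_lf_coef P o n k p j i : (0 < k)%N -> (k * o + p * n = k * i + p * j)%N ->
  (lf (k * o + p * n) (rescale k p P))`_j = P`_j`_i.
Proof. by move=> k0 e; rewrite lfE e rescale_coef. Qed.

Lemma rescale_lf_supp P o n k p j : (0 < k)%N -> (lf (k * o + p * n) (rescale k p P))`_j != 0 ->
  exists2 i, (k * o + p * n = k * i + p * j)%N & P`_j`_i != 0.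
Proof. by move=> k0; rewrite lfE => /(rescale_supp k0). Qed.

Lemma rescale_lf_top P o n k p : vtx P o n -> (0 < k)%N -> (0 < p)%N ->
  [/\ (lf (k * o + p * n) (rescale k p P))`_n = P`_n`_o,
      size (lf (k * o + p * n) (rescale k p P)) = n.+1
    & lf (k * o + p * n) (rescale k p P) != 0].
Proof.
move=> [Pn H] k0 p0; set h := lf _ _.
have hn : h`_n = P`_n`_o by apply: rescale_lf_coef.
have hn0 : h`_n != 0 by rewrite hn.
have h0 : h != 0 by apply: contraNneq hn0 => ->; rewrite coef0.
split=> //; apply/eqP; rewrite eqn_leq; apply/andP; split; last first.
  by rewrite ltnNge; apply: contra hn0 => le; rewrite nth_default.
apply/leq_sizeP => j nj; apply/eqP; apply: contraTT nj => /(rescale_lf_supp k0)[i e ne].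
have [oi _] := H _ _ ne; rewrite -leqNgt.
have : (k * o <= k * i)%N by rewrite leq_mul2l oi orbT.
move=> le; have : (p * j <= p * n)%N by lia.
by rewrite leq_pmul2l.
Qed.

End Events.

(** * Discs *)

Section Discs.
Variable C : numClosedFieldType.
Notation BP := {poly {poly C}}.
Variables (a b delta : nat) (phi : {poly C}).
Hypotheses (a_gt1 : (1 < a)%N) (b_gt0 : (0 < b)%N) (cop : coprime a b)
  (delta_gt0 : (0 < delta)%N).
Notation A := (a * delta)%N.
Notation B := (b * delta)%N.
Notation D := ((a + b) * delta)%N.
Hypotheses (phi_lead : phi`_A = 1).

(** [phi(W)] for [W] divided by [s^w0], with the denominator [s^(w0 A)]
    cleared. *)
Definition homog_ev w0 (W : BP) : BP :=
  \sum_(j < A.+1) (phi`_j *: 'X^(w0 * (A - j)))%:P * W ^+ j.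

(** The data of a disc: polynomials [dW], [dZ], [dF], [dG] in [xi] over
    [C[s]] that represent [W], [Z], [F], [G] up to the factors [s^w0],
    [s^(w0 A)], [s^f0] and [s^g0]; a power [s^de] and a unit [dg] of [C[[s]]]
    that relate these normalizations; the order [dT] of the Jacobian; and the
    orders [oW], [oZ], [oG] of [dW], [dZ] (a lower bound) and [dG]. *)
Record disc := Disc { dW : BP; dZ : BP; dF : BP; dG : BP; dg : {poly C};
  w0 : nat; f0 : nat; g0 : nat; de : nat; dT : nat;
  oW : nat; oZ : nat; oG : nat }.

(** On a valid disc [Z] is at most as large as [phi(W)] ([vd_le]), [W] has
    a pole ([vd_neg]), so that the top term of [phi(W)] dominates, and the
    Jacobian of [F] and [G] is smaller than their leading forms allow
    ([vd_jac]). The field [vd_ratio] says that [G] has the size of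
    [F^(b/a)]. *)
Record valid_disc (X : disc) : Prop := {
  vd_rel : ('X^(de X) * dg X)%:P * dF X = homog_ev (w0 X) (dW X) + dZ X;
  vd_g : (dg X)`_0 != 0;
  vd_e : (de X + f0 X = A * w0 X)%N;
  vd_J : exists c, Jf (f0 X) (g0 X) (dF X) (dG X) = (c *: 'X^(dT X))%:P;
  vd_W : ordge (dW X) (oW X); vd_W0 : lf (oW X) (dW X) != 0;
  vd_Z : ordge (dZ X) (oZ X);
  vd_G : ordge (dG X) (oG X); vd_G0 : lf (oG X) (dG X) != 0;
  vd_ratio : (oG X + B * w0 X = g0 X + B * oW X)%N;
  vd_le : (A * oW X <= oZ X)%N;
  vd_neg : (oW X < w0 X)%N;
  vd_jac : (D * oW X + f0 X + g0 X < dT X + D * w0 X)%N }.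

Lemma homog_ev_lead o w (W : BP) : ordge W o -> (o < w)%N ->
  ordge (homog_ev w W) (A * o) /\ lf (A * o) (homog_ev w W) = lf o W ^+ A.
Proof.
move=> oW ow; rewrite /homog_ev big_ord_recr /= phi_lead subnn muln0 expr0 alg_polyC polyC1 mul1r.
have S_ord : ordge (\sum_(j < A) (phi`_j *: 'X^(w * (A - j)))%:P * W ^+ j) (A * o).+1.
  apply: ordge_sum => j _.
  have oc : ordge (phi`_j *: 'X^(w * (A - j)))%:P (w * (A - j)).
    move=> i l lt; rewrite coefC; case: eqP => _; last by rewrite coef0.
    by rewrite coefZ coefXn ltn_eqF ?mulr0.
  apply: ordgeW (ordgeM oc (ordgeX (n := j) oW)).
  have jA := ltn_ord j; move: (nat_of_ord j) jA => {oc}j jA.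
  have -> : (A * o = (A - j) * o + j * o)%N by rewrite -mulnDl subnK // ltnW.
  rewrite ltn_add2r mulnC ltn_mul2r subn_gt0 jA; exact: ow.
split.
  by apply: ordgeD; [apply: ordgeW S_ord|apply: ordgeX].
by rewrite lfD (lf_lt S_ord) // add0r lfX.
Qed.

(** The leading form of [F], up to a constant, provided that it is nonzero. *)
Definition leadF (X : disc) := lf (oW X) (dW X) ^+ A + lf (A * oW X) (dZ X).

Lemma disc_leadF X : valid_disc X -> leadF X != 0 ->
  exists oF, [/\ (de X + oF = A * oW X)%N, ordge (dF X) oF &
    (dg X)`_0 *: lf oF (dF X) = leadF X].
Proof.
move=> vd h0.
have [H1 H2] := homog_ev_lead (vd_W vd) (vd_neg vd).
have oR : ordge (homog_ev (w0 X) (dW X) + dZ X) (A * oW X).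
  by apply: ordgeD => //; apply: ordgeW (vd_Z vd); apply: vd_le.
have lR : lf (A * oW X) (homog_ev (w0 X) (dW X) + dZ X) = leadF X by rewrite lfD H2.
have rel := vd_rel vd.
have F0 : dF X != 0.
  by apply: contraNneq h0 => F0; rewrite -lR -rel F0 mulr0 /lf raddf0.
have [oF hF lF0] := exists_ord F0.
have g00 := vd_g vd.
have gn0 : dg X != 0 by apply: contraNneq g00 => ->; rewrite coef0.
have [hgF lgF] := lfCM gn0 g00 hF.
have EL : ('X^(de X) * dg X)%:P * dF X = ('X^(de X))%:P * ((dg X)%:P * dF X).
  by rewrite polyCM mulrA.
have oX : ordge (('X^(de X))%:P : {poly {poly C}}) (de X).
  by move: (@factor_ordge C 1 (de X)); rewrite mulr1.
have oL : ordge (('X^(de X) * dg X)%:P * dF X) (de X + oF).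
  by rewrite EL; apply: ordgeM.
have lL : lf (de X + oF) (('X^(de X) * dg X)%:P * dF X) = (dg X)`_0 *: lf oF (dF X).
  rewrite EL lfM // lgF; have := @lf_factor C 1 (de X); rewrite mulr1 => ->.
  by rewrite (_ : lf 0 1 = 1) ?mul1r // /lf rmorph1.
rewrite rel in oL lL.
have lL0 : lf (de X + oF) (homog_ev (w0 X) (dW X) + dZ X) != 0.
  by rewrite lL scaler_eq0 negb_or g00.
have e := ord_uniq oL lL0 oR _; rewrite lR in e.
exists oF; split=> //; first exact: e.
by rewrite -lL e.
Qed.

(** Along a disc on which [F] is large, the leading forms of [F] and [G] have
    vanishing Jacobian, hence proportional multiplicities everywhere. *)
Lemma disc_mup X : valid_disc X -> leadF X != 0 ->
  forall x, (a * mup x (lf (oG X) (dG X)) = b * mup x (leadF X))%N.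
Proof.
move=> vd h0; have [oF [eF hF lF]] := disc_leadF vd h0.
have [c EJ] := vd_J vd.
have lF0 : lf oF (dF X) != 0.
  by apply: contraNneq h0 => l0; rewrite -lF l0 scaler0.
have eA : (D = A + B)%N by rewrite mulnDl.
have lt : (oF + oG X < dT X)%N.
  move: (vd_jac vd) (vd_ratio vd) (vd_e vd); rewrite eA !mulnDl; lia.
have := Jf_lead hF (vd_G vd) EJ lt.
set v : C := (oW X)%:R - (w0 X)%:R.
have v0 : v != 0 by rewrite subr_eq0 eqr_nat ltn_eqF // (vd_neg vd).
have -> : oF%:R - (f0 X)%:R = delta%:R * v * a%:R :> C.
  have := congr1 (fun n => n%:R : C) eF; have := congr1 (fun n => n%:R : C) (vd_e vd).
  rewrite /= !natrD !natrM /v => e1 e2.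
  have -> : oF%:R = a%:R * delta%:R * (oW X)%:R - (de X)%:R :> C by rewrite -e2 addrC addKr.
  have -> : (f0 X)%:R = a%:R * delta%:R * (w0 X)%:R - (de X)%:R :> C by rewrite -e1 addrC addKr.
  by ring.
have -> : (oG X)%:R - (g0 X)%:R = delta%:R * v * b%:R :> C.
  have := congr1 (fun n => n%:R : C) (vd_ratio vd); rewrite /= !natrD !natrM /v => e1.
  have -> : (oG X)%:R = (g0 X)%:R + b%:R * delta%:R * (oW X)%:R - b%:R * delta%:R * (w0 X)%:R :> C by rewrite -e1 addrK.
  by ring.
move=> E x.
have K0 : delta%:R * v != 0 by rewrite mulf_neq0 // pnatr_eq0 -lt0n.
rewrite -lF mupZ; last exact: vd_g.
apply: wronskian_mup => //; first exact: vd_G0.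
by apply: (scalerI K0); rewrite -!scaler_nat !scalerA.
Qed.

End Discs.

(** * Moving from one disc to another *)

Section Moves.
Variable C : numClosedFieldType.
Notation BP := {poly {poly C}}.
Variables (a b delta : nat) (phi : {poly C}).
Hypotheses (a_gt1 : (1 < a)%N) (b_gt0 : (0 < b)%N) (cop : coprime a b)
  (delta_gt0 : (0 < delta)%N).
Notation A := (a * delta)%N.
Notation B := (b * delta)%N.
Notation D := ((a + b) * delta)%N.
Hypotheses (phi_lead : phi`_A = 1).
Notation valid := (valid_disc a b delta phi).
Notation hom_ev := (homog_ev a delta phi).
Implicit Types X : disc C.

Definition rescale_disc k p n d X := Disc (rescale k p (dW X)) (rescale k p (dZ X)) (rescale k p (dF X))
  (rescale k p (dG X)) (dg X \Po 'X^k) (k * w0 X) (k * f0 X) (k * g0 X) (k * de X)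
  (k * dT X + p) (k * oW X + p * n) (k * oZ X + p * d) (k * oG X + p * (B * n)).

Definition translate_disc (x : C) X := Disc (translate x (dW X)) (translate x (dZ X)) (translate x (dF X))
  (translate x (dG X)) (dg X) (w0 X) (f0 X) (g0 X) (de X) (dT X) (oW X) (oZ X) (oG X).

Lemma homog_ev_rescale k p w (W : BP) : (0 < k)%N -> rescale k p (hom_ev w W) = hom_ev (k * w) (rescale k p W).
Proof.
move=> k0; rewrite /homog_ev rescale_sum; apply: eq_bigr => j _.
rewrite rescaleM rescaleC rescaleX; congr (_%:P * _).
by rewrite comp_polyZ rmorphXn /= comp_polyX -exprM mulnA.
Qed.

Lemma homog_ev_translate x w (W : BP) : translate x (hom_ev w W) = hom_ev w (translate x W).
Proof.
by rewrite /homog_ev translate_sum; apply: eq_bigr => j _; rewrite translateM translateC translateX.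
Qed.

Lemma translate_disc_valid x X : valid X -> valid (translate_disc x X).
Proof.
have lft (P : BP) o : ordge P o -> lf o P != 0 -> lf o (translate x P) != 0.
  by move=> oP l0; rewrite lf_translate // comp_poly2_eq0 ?size_XaddC.
case=> h1 h2 h3 [c h4] h5 h6 h7 h8 h9 h10 h11 h12 h13; split=> //=.
- by rewrite -(translateC x ('X^_ * _)) -translateM h1 translateD homog_ev_translate.
- by exists c; rewrite Jf_translate h4 translateC.
- exact: translate_ordge.
- exact: lft.
- exact: translate_ordge.
- exact: translate_ordge.
- exact: lft.
Qed.

Lemma rescale_disc_rel k p n d X : (0 < k)%N -> valid X ->
  [/\ ('X^(de (rescale_disc k p n d X)) * dg (rescale_disc k p n d X))%:P * dF (rescale_disc k p n d X) =
      hom_ev (w0 (rescale_disc k p n d X)) (dW (rescale_disc k p n d X)) + dZ (rescale_disc k p n d X),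
      (dg (rescale_disc k p n d X))`_0 != 0,
      (de (rescale_disc k p n d X) + f0 (rescale_disc k p n d X) = A * w0 (rescale_disc k p n d X))%N
    & exists c, Jf (f0 (rescale_disc k p n d X)) (g0 (rescale_disc k p n d X)) (dF (rescale_disc k p n d X))
       (dG (rescale_disc k p n d X)) = (c *: 'X^(dT (rescale_disc k p n d X)))%:P].
Proof.
move=> k0 [h1 h2 h3 [c h4] _ _ _ _ _ _ _ _ _] /=; split.
- rewrite -homog_ev_rescale // -rescaleD -h1 rescaleM rescaleC; congr (_%:P * _).
  by rewrite rmorphM /= rmorphXn /= comp_polyX -exprM.
- by rewrite coef_comp_poly_Xn // dvdn0 div0n.
- by rewrite -mulnDr h3; lia.
- exists (c *+ k); rewrite Jf_rescale // h4 rescaleC -polyCM -polyCMn; congr _%:P.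
  rewrite comp_polyZ rmorphXn /= comp_polyX -exprM -scalerAr -exprD scalerMnl.
  by rewrite addnC.
Qed.

(** Discs on which [Z] is strictly smaller than [phi(W)]; [n] and [d] count
    the zeros of [W] and [Z] near the centre. *)
Definition good n d X := [/\ valid X, vtx (dW X) (oW X) n, vtx (dZ X) (oZ X) d,
  (A * oW X < oZ X)%N & (0 < n)%N].

Lemma good_leadF n d X : good n d X -> leadF a delta X = lf (oW X) (dW X) ^+ A.
Proof. by case=> vd _ vZ lt _; rewrite /leadF (lf_lt (vtx_ordge vZ) lt) addr0. Qed.

Lemma good_G n d X : good n d X -> vtx (dG X) (oG X) (B * n).
Proof.
move=> gd; have [vd vW _ _ _] := gd.
have h0 : leadF a delta X != 0 by rewrite (good_leadF gd) expf_neq0 // (vd_W0 vd).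
have := disc_mup a_gt1 b_gt0 cop delta_gt0 phi_lead vd h0 0.
rewrite (good_leadF gd) mupX ?(vd_W0 vd) // (vtx_mup vW) => e.
have -> : (B * n = mup 0 (lf (oG X) (dG X)))%N.
  apply/eqP; rewrite -(eqn_pmul2l (ltnW a_gt1)) e; apply/eqP; lia.
apply: mup_vtx; [exact: (vd_G vd)|exact: (vd_G0 vd)].
Qed.

Lemma rescale_disc_valid_gen n d X k p : good n d X -> (0 < k)%N -> (0 < p)%N ->
  nsl (dW X) (oW X) n k p -> nsl (dZ X) (oZ X) d k p ->
  nsl (dG X) (oG X) (B * n) k p ->
  (A * (k * oW X + p * n) <= k * oZ X + p * d)%N ->
  (k * oW X + p * n < k * w0 X)%N ->
  (D * (k * oW X + p * n) + k * f0 X + k * g0 X < k * dT X + p + D * (k * w0 X))%N ->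
  valid (rescale_disc k p n d X).
Proof.
move=> gd k0 p0 nW nZ nG le neg jac; have [vd vW vZ lt n0] := gd.
have [r1 r2 r3 r4] := rescale_disc_rel p n d k0 vd.
have vG := good_G gd.
split=> //=.
- exact: rescale_ordge.
- by have [] := rescale_lf_top vW k0 p0.
- exact: rescale_ordge.
- exact: rescale_ordge.
- by have [] := rescale_lf_top vG k0 p0.
- have := vd_ratio vd; move: (oG X) (w0 X) (g0 X) (oW X) => u v w z e.
  have : (k * (u + B * v) = k * (w + B * z))%N by rewrite e.
  by nia.
Qed.

(** While [W] stays a monomial in [xi] so does [F], hence so does [G]: the
    Newton polygon of [G] cannot break before those of [W] and [Z]. *)
Lemma nsl_G n d X k p : good n d X -> (0 < k)%N -> (0 < p)%N ->
  nsl (dW X) (oW X) n k p -> nsl (dZ X) (oZ X) d k p ->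
  (A * (k * oW X + p * n) <= k * oZ X + p * d)%N ->
  (k * oW X + p * n < k * w0 X)%N ->
  (D * (k * oW X + p * n) + k * f0 X + k * g0 X < k * dT X + p + D * (k * w0 X))%N ->
  nsl (dG X) (oG X) (B * n) k p.
Proof.
move=> gd k0 p0 nW nZ le neg jac; have [vd vW vZ lt n0] := gd.
have vG := good_G gd.
have k0q : (0 : rat) < k%:R by rewrite ltr0n.
pose th : rat := p%:R / k%:R.
have thk : th * k%:R = p%:R by rewrite divfK // gt_eqF.
case: (boolP (all (fun x => th <= x) (evs (dG X) (oG X) (B * n)))) => [/allP H|/allPn[x xG]].
  exact: evs_nsl thk H.
rewrite -ltNge => xth.
have [|th' th'G th'min] := @seq_min (evs (dG X) (oG X) (B * n)).
  by apply/eqP => e; rewrite e in xG.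
have th'th : th' < th := le_lt_trans (th'min _ xG) xth.
have th'0 : (0 : rat) < th' := evs_gt0 vG th'G.
have [k' [p' [k'0 p'0 _ thk']]] := rat_pk th'0.
have k'0q : (0 : rat) < k'%:R by rewrite ltr0n.
have cross : (p' * k < p * k')%N.
  have : 0 < (th - th') * (k%:R * k'%:R) by rewrite mulr_gt0 ?subr_gt0 ?mulr_gt0.
  rewrite -(ltr_nat rat) !natrM -thk -thk' -subr_gt0; congr (_ < _); by ring.
have strictW j i : (j < n)%N -> (dW X)`_j`_i != 0 ->
    (k' * oW X + p' * n < k' * i + p' * j)%N.
  move=> jn /nW h.
  have h1 : (k' * (k * oW X + p * n) <= k' * (k * i + p * j))%N by rewrite leq_mul2l h orbT.
  have h2 : (p' * k * (n - j) < p * k' * (n - j))%N by rewrite ltn_mul2r subn_gt0 jn.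
  have := subnK (ltnW jn); move: (n - j)%N h2 => r h2 en.
  rewrite -(ltn_pmul2l k0); rewrite -en in h1 *.
  by nia.
have nW' : nsl (dW X) (oW X) n k' p'.
  move=> j i ne; have [jn|nj] := ltnP j n; first by rewrite ltnW // strictW.
  by rewrite leq_add // leq_mul2l ?nj ?orbT // (vW.2 _ _ ne).1 orbT.
have nZ' : nsl (dZ X) (oZ X) d k' p'.
  move=> j i ne; have [oi _] := vZ.2 _ _ ne; have [jd|dj] := ltnP j d.
    have h := nZ _ _ ne; have := subnK (ltnW jd); move: (d - j)%N => r er.
    rewrite -er in h *; rewrite -(leq_pmul2l k0).
    have h1 : (k' * (k * oZ X + p * (r + j)) <= k' * (k * i + p * j))%N by rewrite leq_mul2l h orbT.
    have h2 : (p' * k * r <= p * k' * r)%N by rewrite leq_mul2r ltnW ?orbT.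
    by nia.
  by rewrite leq_add // leq_mul2l ?oi ?dj orbT.
have nG' : nsl (dG X) (oG X) (B * n) k' p' by apply: evs_nsl thk' th'min.
have lt' : (A * (k' * oW X + p' * n) < k' * oZ X + p' * d)%N.
  have [ad|ad] := leqP (A * n) d.
    have : (p' * (A * n) <= p' * d)%N by rewrite leq_mul2l ad orbT.
    have : (k' * (A * oW X) < k' * oZ X)%N by rewrite ltn_pmul2l.
    by move: (A * n)%N (A * oW X)%N => u v; nia.
  have := subnK (ltnW ad); have : (0 < A * n - d)%N by rewrite subn_gt0.
  move: (A * n - d)%N => r r0 er.
  have le2 : (k * (A * oW X) + p * (r + d) <= k * oZ X + p * d)%N.
    by rewrite er; move: le; rewrite mulnDr !mulnA [(A * k)%N]mulnC [(A * p)%N]mulnC -!mulnA.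
  have h2 : (p' * k * r < p * k' * r)%N by rewrite ltn_mul2r r0.
  rewrite mulnDr [(A * (k' * _))%N]mulnCA [(A * (p' * _))%N]mulnCA -er -(ltn_pmul2l k0).
  move: (A * oW X)%N le2 => u le2.
  have h3 : (k' * (k * u + p * (r + d)) <= k' * (k * oZ X + p * d))%N by rewrite leq_mul2l le2 orbT.
  by nia.
have neg' : (k' * oW X + p' * n < k' * w0 X)%N.
  rewrite -(ltn_pmul2l k0).
  have h3 : (k' * (k * oW X + p * n) < k' * (k * w0 X))%N by rewrite ltn_pmul2l.
  have h2 : (p' * k * n <= p * k' * n)%N by rewrite leq_mul2r ltnW ?orbT.
  by nia.
have jac' : (D * (k' * oW X + p' * n) + k' * f0 X + k' * g0 X
     < k' * dT X + p' + D * (k' * w0 X))%N.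
  have D1 : (1 <= D * n)%N by rewrite !muln_gt0 n0 delta_gt0 addn_gt0 b_gt0 orbT.
  rewrite -(ltn_pmul2l k0).
  have h3 : (k' * (D * (k * oW X + p * n) + k * f0 X + k * g0 X) <
    k' * (k * dT X + p + D * (k * w0 X)))%N by rewrite ltn_pmul2l.
  have := subnK D1; move: (D * n - 1)%N => r er.
  have h2 : (p' * k * r <= p * k' * r)%N by rewrite leq_mul2r ltnW ?orbT.
  move: h3; rewrite !mulnDr ![(D * (_ * n))%N]mulnCA -er => h3.
  move: (D * oW X)%N (D * w0 X)%N h3 => u v h3.
  rewrite [(D * (k' * oW X))%N]mulnCA.
  move: h3; rewrite ?[(D * (k * _))%N]mulnCA ?[(D * (k' * _))%N]mulnCA.
  by nia.
have vd' := rescale_disc_valid_gen gd k'0 p'0 nW' nZ' nG' (ltnW lt') neg' jac'.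
set Y := rescale_disc k' p' n d X in vd'.
have [t1 t2 t3] := rescale_lf_top vW k'0 p'0.
have lW : lf (oW Y) (dW Y) = (dW X)`_n`_(oW X) *: 'X^n.
  apply/polyP => j; rewrite coefZ coefXn; case: (ltngtP j n) => jn.
  - rewrite mulr0; apply/eqP; apply: contraTT isT => /(rescale_lf_supp k'0)[i e ne].
    by have := strictW _ _ jn ne; rewrite e ltnn.
  - by rewrite nth_default ?mulr0 // t2.
  - by rewrite mulr1 jn t1.
have Wn : (dW X)`_n`_(oW X) != 0 by case: vW.
have hE : leadF a delta Y = lf (oW Y) (dW Y) ^+ A.
  by rewrite /leadF (lf_lt (vd_Z vd') lt') addr0.
have h0 : leadF a delta Y != 0 by rewrite hE expf_neq0 // (vd_W0 vd').
have := disc_mup a_gt1 b_gt0 cop delta_gt0 phi_lead vd' h0 0.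
rewrite hE mupX ?(vd_W0 vd') // lW mupZ // (@mup0P _ 'X^n n); last 2 first.
- by rewrite coefXn eqxx oner_eq0.
- by move=> j jn; rewrite coefXn ltn_eqF.
move=> e.
have {e} mG : mup 0 (lf (oG Y) (dG Y)) = (B * n)%N.
  apply/eqP; rewrite -(eqn_pmul2l (ltnW a_gt1)) e; apply/eqP; lia.
have [j [i [jn ne tie]]] := evs_tie thk' th'G.
have := (mup0_coef (vd_G0 vd')).2 j; rewrite mG => /(_ jn) /eqP.
by rewrite (rescale_lf_coef _ k'0 tie) (negPf ne).
Qed.

Lemma rescale_disc_valid n d X k p : good n d X -> (0 < k)%N -> (0 < p)%N ->
  nsl (dW X) (oW X) n k p -> nsl (dZ X) (oZ X) d k p ->
  (A * (k * oW X + p * n) <= k * oZ X + p * d)%N ->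
  (k * oW X + p * n < k * w0 X)%N ->
  (D * (k * oW X + p * n) + k * f0 X + k * g0 X < k * dT X + p + D * (k * w0 X))%N ->
  valid (rescale_disc k p n d X).
Proof.
move=> gd k0 p0 nW nZ le neg jac.
exact: rescale_disc_valid_gen (nsl_G gd k0 p0 nW nZ le neg jac) _ _ _.
Qed.

(** As [a] and [b] are coprime, [disc_mup] makes [a] divide the
    multiplicities of the leading form of [F]. *)
Lemma boundary_pow X : valid X -> leadF a delta X != 0 ->
  exists h, leadF a delta X = h ^+ a.
Proof.
move=> vd h0; apply: pow_of_mup => //; first exact: ltnW.
move=> x; have e := disc_mup a_gt1 b_gt0 cop delta_gt0 phi_lead vd h0 x.
by rewrite -(Gauss_dvdr _ cop) -e dvdn_mulr.
Qed.

End Moves.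

(** * Descending through the discs *)

Section Direction.
Variable C : numClosedFieldType.
Notation BP := {poly {poly C}}.
Variables (a b delta : nat) (phi : {poly C}).
Hypotheses (a_gt1 : (1 < a)%N) (b_gt0 : (0 < b)%N) (cop : coprime a b)
  (delta_gt0 : (0 < delta)%N).
Notation A := (a * delta)%N.
Notation B := (b * delta)%N.
Notation D := ((a + b) * delta)%N.
Hypotheses (phi_lead : phi`_A = 1).
Notation valid := (valid_disc a b delta phi).
Notation good := (good a b delta phi).
Implicit Types X : disc C.

(** The radius of the next event: the first break of a Newton polygon,
    unless some cap comes first. *)
Lemma next_event (P Q : BP) oP oQ n d (caps : seq rat) :
  vtx P oP n -> vtx Q oQ d -> caps != [::] -> (forall y, y \in caps -> 0 < y) ->
  exists x k p, [/\ [/\ (0 < k)%N, (0 < p)%N, coprime k p & x * k%:R = p%:R],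
    nsl P oP n k p, nsl Q oQ d k p, (forall y, y \in caps -> x <= y)
    & x \in evs P oP n ++ evs Q oQ d ++ caps].
Proof.
move=> vP vQ caps0 cpos.
have [|x xin xmin] := @seq_min (evs P oP n ++ evs Q oQ d ++ caps).
  by case: (caps) caps0 => // y s _; case: (evs P oP n) => //; case: (evs Q oQ d).
have x0 : 0 < x.
  move: xin; rewrite !mem_cat => /or3P[/(evs_gt0 vP)|/(evs_gt0 vQ)|/cpos] //.
have [k [p [k0 p0 ckp xk]]] := rat_pk x0.
exists x, k, p; split=> //.
- by apply: (evs_nsl vP k0 xk) => y yP; apply: xmin; rewrite mem_cat yP.
- by apply: (evs_nsl vQ k0 xk) => y yQ; apply: xmin; rewrite !mem_cat yQ orbT.
- by move=> y yc; apply: xmin; rewrite !mem_cat yc !orbT.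
Qed.

Lemma coef_XsubC_subtop (x : C) n : (('X - x%:P) ^+ n.+1)`_n = - x *+ n.+1.
Proof.
elim: n => [|n IH]; first by rewrite expr1 coefB coefX coefC sub0r.
rewrite exprS mulrBl coefB coefXM coefCM /= IH.
have := lead_coef_exp ('X - x%:P) n.+1.
rewrite lead_coefXsubC expr1n lead_coefE size_exp_XsubC /= => ->.
by rewrite mulr1 [RHS]mulrSr.
Qed.

(** The polynomial [(xi - x)^n] has a nonzero coefficient of degree [n - 1],
    so that two consecutive exponents lie on the edge of slope [p/k]. *)
Lemma full_slope (P : BP) o n k p x : vtx P o n -> (0 < k)%N -> (0 < p)%N ->
  coprime k p -> (0 < n)%N -> x != 0 ->
  mup x (lf (k * o + p * n) (rescale k p P)) = n -> k = 1%N.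
Proof.
move=> vP k0 p0 ckp n0 x0 mx; have [_ sz _] := rescale_lf_top vP k0 p0.
have E := mup_full sz mx; set h := lf _ _ in sz mx E.
have h0 : lead_coef h != 0.
  by rewrite lead_coef_eq0; apply/eqP => h0; rewrite h0 size_poly0 in sz.
have ne : h`_(n.-1) != 0.
  rewrite E coefZ mulf_neq0 //.
  by rewrite -(prednK n0) coef_XsubC_subtop mulrn_eq0 negb_or /= oppr_eq0.
have [i e _] := rescale_lf_supp k0 ne.
apply/eqP; rewrite -dvdn1 -(eqP ckp) dvdn_gcd dvdnn /=.
have e' : (k * o + p = k * i)%N by rewrite -(prednK n0) in e; lia.
by rewrite -(dvdn_addr _ (dvdn_mulr o (dvdnn k))) e' dvdn_mulr.
Qed.

(** The order of [W] itself; likewise for [vZ] and, for the Jacobian, [tau]. *)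
Definition vW X : rat := (oW X)%:R - (w0 X)%:R.
Definition vZ X : rat := (oZ X)%:R - (A * w0 X)%:R.
Definition tau X : rat := (dT X)%:R - (f0 X)%:R - (g0 X)%:R.

(** Whatever disc is reached from the current one, by rescaling with [(k, p)]
    and translating: if [W] has order [w] on it, the Jacobian condition of a
    valid disc holds while [w] is below the level [t]. The pair [(N, lam)] is the
    top term of [W], which bounds its order on each disc from above. *)
Definition jac_until (t lam : rat) (N : nat) (ta : rat) := forall k p (w : rat), (0 < k)%N ->
  w < k%:R * t -> w <= k%:R * lam + p%:R * N%:R -> D%:R * w < k%:R * ta + p%:R.

Lemma jac_until_rescale t lam N ta k p : (0 < k)%N -> jac_until t lam N ta ->
  jac_until (k%:R * t) (k%:R * lam + p%:R * N%:R) N (k%:R * ta + p%:R).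
Proof.
move=> k0 H k' p' w k'0 h1 h2.
have := H (k' * k)%N (k' * p + p')%N w; rewrite muln_gt0 k0 k'0 natrD !natrM => /(_ isT).
have -> : k'%:R * k%:R * t = k'%:R * (k%:R * t) by ring.
have -> : k'%:R * k%:R * lam + (k'%:R * p%:R + p'%:R) * N%:R =
  k'%:R * (k%:R * lam + p%:R * N%:R) + p'%:R * N%:R by ring.
have -> : k'%:R * k%:R * ta + (k'%:R * p%:R + p'%:R) = k'%:R * (k%:R * ta + p%:R) + p'%:R by ring.
exact.
Qed.

Lemma jac_until_now t lam N ta w : jac_until t lam N ta ->
  w < t -> w <= lam -> D%:R * w < ta.
Proof.
move=> H h1 h2; have := H 1%N 0%N w isT.
by rewrite !mul1r mulr0n mul0r !addr0; apply.
Qed.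

Lemma vW_rescale_disc k p n d X : vW (rescale_disc b delta k p n d X) = k%:R * vW X + p%:R * n%:R.
Proof. by rewrite /vW /= natrD !natrM; ring. Qed.

Lemma vZ_rescale_disc k p n d X : vZ (rescale_disc b delta k p n d X) = k%:R * vZ X + p%:R * d%:R.
Proof. by rewrite /vZ /= natrD !natrM; ring. Qed.

Lemma tau_rescale_disc k p n d X : tau (rescale_disc b delta k p n d X) = k%:R * tau X + p%:R.
Proof. by rewrite /tau /= natrD !natrM; ring. Qed.

Lemma rescale_disc_admissible k p n d X : good n d X -> (0 < k)%N -> (0 < p)%N ->
  nsl (dW X) (oW X) n k p -> nsl (dZ X) (oZ X) d k p ->
  (A * (k * oW X + p * n) <= k * oZ X + p * d)%N ->
  k%:R * vW X + p%:R * n%:R < 0 ->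
  D%:R * (k%:R * vW X + p%:R * n%:R) < k%:R * tau X + p%:R ->
  valid (rescale_disc b delta k p n d X).
Proof.
move=> gd k0 p0 nW nZ le; rewrite -(vW_rescale_disc k p n d) -(tau_rescale_disc k p n d) => neg jac.
apply: rescale_disc_valid => //; rewrite -(ltr_nat rat).
  by move: neg; rewrite /vW subr_lt0.
move: jac; rewrite /vW /tau /= !(natrD, natrM); lra.
Qed.

Lemma nsl_vW k p n X N lam : nsl (dW X) (oW X) n k p -> (dW X)`_N`_lam != 0 ->
  k%:R * vW X + p%:R * n%:R <= k%:R * (lam%:R - (w0 X)%:R) + p%:R * N%:R.
Proof.
move=> nW ne; have := nW _ _ ne; rewrite -(ler_nat rat) /vW !natrD !natrM; lra.
Qed.

Lemma boundary_ok k p n d X t lam N : good n d X -> (0 < k)%N -> (0 < p)%N ->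
  nsl (dW X) (oW X) n k p -> nsl (dZ X) (oZ X) d k p ->
  (A * (k * oW X + p * n) <= k * oZ X + p * d)%N ->
  (dW X)`_N`_lam != 0 -> t <= 0 -> k%:R * vW X + p%:R * n%:R < k%:R * t ->
  jac_until t (lam%:R - (w0 X)%:R) N (tau X) ->
  valid (rescale_disc b delta k p n d X).
Proof.
move=> gd k0 p0 nW nZ le ne t0 lt H.
apply: rescale_disc_admissible => //; last by apply: H => //; apply: nsl_vW.
by apply: lt_le_trans lt _; rewrite pmulr_rle0 // ltr0n.
Qed.

Lemma translate_good x Y : valid Y -> (A * oW Y < oZ Y)%N -> lf (oZ Y) (dZ Y) != 0 ->
  (0 < mup x (lf (oW Y) (dW Y)))%N ->
  good (mup x (lf (oW Y) (dW Y))) (mup x (lf (oZ Y) (dZ Y))) (translate_disc x Y).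
Proof.
move=> vd lt Z0 n0; split=> //; first exact: translate_disc_valid.
  by apply: translate_vtx; [apply: vd_W vd|apply: vd_W0 vd].
by apply: translate_vtx; [apply: vd_Z vd|].
Qed.

(** On the disc where [Z] catches up with [phi(W)], the leading form of [F] is
    an [a]-th power by [boundary_pow], and [pow_perturb] applies to its
    expression as [(W^delta)^a + Z]. *)
Lemma boundary_degree n d X k p : good n d X -> (0 < k)%N -> (0 < p)%N ->
  valid (rescale_disc b delta k p n d X) ->
  (A * (k * oW X + p * n) = k * oZ X + p * d)%N -> (d < A * n)%N ->
  leadF a delta (rescale_disc b delta k p n d X) != 0 /\ exists h : {poly C}, [/\ h != 0,
    leadF a delta (rescale_disc b delta k p n d X) =
      (lf (k * oW X + p * n) (rescale k p (dW X)) ^+ delta + h) ^+ a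
    & d = ((size h).-1 + a.-1 * (delta * n))%N].
Proof.
move=> gd k0 p0 vd e dn; have [_ vW vZ _ n0] := gd.
have [_ sW W0] := rescale_lf_top vW k0 p0.
have [_ sZ Z0] := rescale_lf_top vZ k0 p0.
have LE : leadF a delta (rescale_disc b delta k p n d X) =
    (lf (k * oW X + p * n) (rescale k p (dW X)) ^+ delta) ^+ a +
    lf (k * oZ X + p * d) (rescale k p (dZ X)).
  by rewrite /leadF /= -e -exprM [(delta * a)%N]mulnC.
set w := lf _ _ in sW W0 LE; set z := lf _ _ in sZ Z0 LE.
have sWd : (size (w ^+ delta)).-1 = (delta * n)%N.
  by rewrite size_exp sW mulnC.
have L0 : leadF a delta (rescale_disc b delta k p n d X) != 0.
  rewrite LE; apply/eqP => e0.
  have s0 : (0 < size ((w ^+ delta) ^+ a))%N by rewrite size_poly_gt0; apply/expf_neq0/expf_neq0.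
  have lt : (size z < size ((w ^+ delta) ^+ a))%N.
    by rewrite sZ -(prednK s0) size_exp sWd ltnS [(_ * a)%N]mulnC mulnA.
  by have := size_polyDl lt; rewrite e0 size_poly0 => e1; rewrite -e1 in s0.
split=> //; have [h hE] := boundary_pow a_gt1 b_gt0 cop delta_gt0 phi_lead vd L0.
have := @pow_perturb C a h (w ^+ delta) z (ltnW a_gt1) (expf_neq0 _ W0) Z0.
move=> /(_ _ (etrans (esym hE) LE))[|d' [d'0 e1]]; first by rewrite sZ sWd /= mulnA.
by rewrite sZ sWd /= => e'; exists d'; rewrite LE.
Qed.

(** The hypothesis of [descent] passes from a disc to the smaller disc around
    a root where [Z] has proportionally at most as many zeros. *)
Lemma low_transfer (n n2 d d2 r T u v : rat) : 0 < n -> 0 < n2 -> d2 * n <= d * n2 ->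
  u < T -> n * v - d * u < (r * n - d) * T -> n2 * v - d2 * u < (r * n2 - d2) * T.
Proof.
move=> n0 n20 le uT lt; rewrite -(ltr_pM2l n0) -subr_gt0.
have h1 : 0 < n2 * ((r * n - d) * T - (n * v - d * u)) by rewrite mulr_gt0 ?subr_gt0.
have h2 : 0 <= (d * n2 - d2 * n) * (T - u) by rewrite mulr_ge0 ?subr_ge0 // ltW.
have -> : n * ((r * n2 - d2) * T) - n * (n2 * v - d2 * u) =
  n2 * ((r * n - d) * T - (n * v - d * u)) + (d * n2 - d2 * n) * (T - u) by ring.
exact: ltr_wpDr.
Qed.

Lemma addn_eq_parts (n n2 d d2 : nat) : (n2 <= n)%N -> (d2 <= d)%N ->
  (n + d <= n2 + d2)%N -> n2 = n /\ d2 = d.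
Proof. by lia. Qed.

Lemma gap_decr (o r p d q g : nat) : (0 < p)%N -> (d < q)%N -> (r < o)%N ->
  (o - r <= g.+1)%N -> (o + p * d - (r + p * q) <= g)%N.
Proof.
move=> p0 dq ro og; have : (p * d < p * q)%N by rewrite ltn_pmul2l.
by lia.
Qed.

Lemma above_level (n d r T u v : rat) : 0 < n -> 0 < r * n - d -> r * u <= v ->
  n * v - d * u < (r * n - d) * T -> u < T.
Proof.
move=> n0 P uv lt; rewrite -(ltr_pM2l P); apply: le_lt_trans lt.
by rewrite mulrBl lerB // -mulrA mulrCA ler_pM2l.
Qed.

(** By the last hypothesis, [Z] catches up with [phi(W)] before the order of
    [W] reaches the level [t]. The Jacobian condition therefore holds all the
    way, and the last disc violates [boundary_degree]. The induction is on the
    number of zeros in the disc and, while all of them stay together, on the gap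
    between the orders of [Z] and [phi(W)]. *)
Lemma descent (s g : nat) n d X t lam N :
  (n + d <= s)%N -> (oZ X - A * oW X <= g)%N -> good n d X ->
  (d < a.-1 * delta * n)%N -> size (dW X) = N.+1 -> (dW X)`_N`_lam != 0 ->
  t <= 0 -> jac_until t (lam%:R - (w0 X)%:R) N (tau X) ->
  n%:R * vZ X - d%:R * vW X < ((A * n)%:R - d%:R) * t -> False.
Proof.
elim: s g n d X t lam N => [|s IHs] g; first by move=> n d X t lam N; case: n => [|n] // _ _ [_ _ _ _].
elim: g => [|g IHg] n d X t lam N snd sg gd dn szW ne t0 H lt.
  by case: gd => _ _ _; rewrite ltn_neqAle => /andP[]; lia.
have [vd vtW vtZ gap n0] := gd.
have dA : (d < A * n)%N.
  apply: leq_trans dn _; rewrite leq_mul2r leq_mul2r leq_pred !orbT //.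
(* the radius at which [Z] catches up with [phi(W)] *)
pose cap : rat := ((oZ X)%:R - (A * oW X)%:R) / ((A * n)%:R - d%:R).
have capP : 0 < cap by rewrite divr_gt0 // subr_gt0 ltr_nat.
have [|x [k [p [[k0 p0 ckp xk] nW nZ xcap xin]]]] := @next_event _ _ _ _ _ _ [:: cap] vtW vtZ isT.
  by move=> y; rewrite inE => /eqP ->.
have {xcap} le : (A * (k * oW X + p * n) <= k * oZ X + p * d)%N.
  have := xcap cap (mem_head _ _); rewrite (nat_slope _ _ dA k0 xk) => h.
  by rewrite mulnDr [(A * (k * _))%N]mulnCA [(A * (p * _))%N]mulnCA.
have k0q : (0 : rat) < k%:R by rewrite ltr0n.
have n0q : (0 : rat) < n%:R by rewrite ltr0n.
have dAq : (d%:R : rat) < (A * n)%:R by rewrite ltr_nat.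
pose u := k%:R * vW X + p%:R * n%:R.
pose v := k%:R * vZ X + p%:R * d%:R.
have uv : A%:R * u <= v.
  rewrite /u /v /vW /vZ; move: le; rewrite -(ler_nat rat) !(natrD, natrM); lra.
have ltk : n%:R * v - d%:R * u < ((A * n)%:R - d%:R) * (k%:R * t).
  have : k%:R * (n%:R * vZ X - d%:R * vW X) < k%:R * (((A * n)%:R - d%:R) * t) by rewrite ltr_pM2l.
  rewrite /u /v; lra.
have ut : u < k%:R * t.
  by rewrite natrM in ltk dAq; apply: above_level n0q _ uv ltk; rewrite subr_gt0.
have vd' := boundary_ok gd k0 p0 nW nZ le ne t0 ut H.
set Y := rescale_disc b delta k p n d X in vd'.
(* the cap is reached: [Z] is as large as [phi(W)] *)
have [e|neq] := eqVneq (A * (k * oW X + p * n))%N (k * oZ X + p * d)%N.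
  have [_ [h [_ _ eh]]] := boundary_degree gd k0 p0 vd' e dA.
  have : (a.-1 * (delta * n) <= d)%N by rewrite [X in (_ <= X)%N]eh leq_addl.
  by rewrite leqNgt mulnA dn.
have gap' : (A * oW Y < oZ Y)%N by rewrite ltn_neqAle neq.
have [_ sW W0] := rescale_lf_top vtW k0 p0.
have [_ sZ Z0] := rescale_lf_top vtZ k0 p0.
(* continue towards a root where [Z] has few zeros *)
have [|y []] := root_low_multiplicity W0 Z0; first by rewrite sW.
rewrite sW sZ /=.
set n2 := mup y _; set d2 := mup y _ => n20 dlow.
have gd2 : good n2 d2 (translate_disc y Y) by apply: translate_good.
have n2n : (n2 <= n)%N by have := sum_mup_le W0 (isT : uniq [:: y]); rewrite big_seq1 sW.
have d2d : (d2 <= d)%N by have := sum_mup_le Z0 (isT : uniq [:: y]); rewrite big_seq1 sZ.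
have dn2 : (d2 < a.-1 * delta * n2)%N.
  rewrite -(ltn_pmul2r n0); apply: leq_ltn_trans dlow _.
  by rewrite mulnAC ltn_pmul2r.
have szY : size (dW (translate_disc y Y)) = N.+1 by rewrite /= size_translate size_rescale.
have neY : (dW (translate_disc y Y))`_N`_(k * lam + p * N) != 0.
  have : lead_coef (translate y (rescale k p (dW X))) = lead_coef (rescale k p (dW X)) by apply: lead_translate.
  by rewrite !lead_coefE size_translate size_rescale // szW /= => ->; rewrite rescale_coef.
have tY : k%:R * t <= 0 by rewrite pmulr_rle0.
have HY : jac_until (k%:R * t) ((k * lam + p * N)%:R - (w0 (translate_disc y Y))%:R) N (tau (translate_disc y Y)).
  have := jac_until_rescale (p := p) k0 H.
  have -> : (k * lam + p * N)%:R - (w0 (translate_disc y Y))%:R = k%:R * (lam%:R - (w0 X)%:R) + p%:R * N%:R :> rat.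
    by rewrite /= natrD !natrM; ring.
  by have -> : tau (translate_disc y Y) = k%:R * tau X + p%:R by exact: tau_rescale_disc.
have Eu : vW (translate_disc y Y) = u by exact: vW_rescale_disc.
have Ev : vZ (translate_disc y Y) = v by exact: vZ_rescale_disc.
have lt2 : n2%:R * vZ (translate_disc y Y) - d2%:R * vW (translate_disc y Y) < ((A * n2)%:R - d2%:R) * (k%:R * t).
  rewrite Eu Ev natrM; rewrite natrM in ltk.
  apply: low_transfer n0q _ _ ut ltk; first by rewrite ltr0n.
  by rewrite -!natrM ler_nat.
have [lts|] := ltnP (n2 + d2) (n + d).
  exact: (IHs _ n2 d2 (translate_disc y Y) (k%:R * t) (k * lam + p * N)%N N (leq_trans lts snd) (leqnn _) gd2 dn2 szY neY tY HY lt2).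
(* all zeros of [W] and [Z] stay together at [y]; as this was an event,
[y != 0], the slope is integral and the gap decreases *)
move=> /(addn_eq_parts n2n d2d)[en ed].
have y0 : y != 0.
  apply/eqP => y0.
  have [jW|] := boolP (x \in evs (dW X) (oW X) n).
    have [j [i [jn nz tie]]] := evs_tie xk jW.
    have m0 : mup 0 (lf (k * oW X + p * n) (rescale k p (dW X))) = n by move: en; rewrite /n2 y0.
    have := (mup0_coef W0).2 j; rewrite m0 => /(_ jn) /eqP.
    by rewrite (rescale_lf_coef _ k0 tie) (negPf nz).
  move: xin; rewrite !mem_cat => /or3P[-> //|xZ _|]; last first.
    rewrite inE => /eqP xcap; case/eqP: neq.
    have := slope_tie dA xk xcap.
    by rewrite mulnDr [(A * (k * _))%N]mulnCA [(A * (p * _))%N]mulnCA.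
  have [j [i [jn nz tie]]] := evs_tie xk xZ.
  have m0 : mup 0 (lf (k * oZ X + p * d) (rescale k p (dZ X))) = d by move: ed; rewrite /d2 y0.
  have := (mup0_coef Z0).2 j; rewrite m0 => /(_ jn) /eqP.
  by rewrite (rescale_lf_coef _ k0 tie) (negPf nz).
have k1 := full_slope vtW k0 p0 ckp n0 y0 en.
have sg' : (oZ (translate_disc y Y) - A * oW (translate_disc y Y) <= g)%N.
  rewrite /= k1 !mul1n mulnDr [(A * (p * _))%N]mulnCA.
  exact: gap_decr.
apply: (IHg n2 d2 (translate_disc y Y) (k%:R * t) (k * lam + p * N)%N N _ sg' gd2 dn2 szY neY tY HY lt2).
by rewrite en ed.
Qed.

End Direction.

(** * Walking towards the centre of a disc *)

Section Walk.
Variable C : numClosedFieldType.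
Notation BP := {poly {poly C}}.
Variables (a b : nat).
Hypotheses (a_gt1 : (1 < a)%N) (b_gt0 : (0 < b)%N) (cop : coprime a b).
Notation phi := ('X^a : {poly C}).
Notation valid := (valid_disc a b 1 phi).
Notation good := (good a b 1 phi).
Notation vZ := (vZ a 1).
Implicit Types X : disc C.

Lemma phi_lead1 : phi`_(a * 1) = 1.
Proof. by rewrite muln1 coefXn eqxx. Qed.

(** Discarding the zeros at the centre leaves the deficit of [q] to the other
    roots of [p]. *)
Lemma nonzero_root (e : nat) (p q : {poly C}) : p != 0 -> q != 0 ->
  ((size q).-1 + e * mup 0 p < e * (size p).-1 + mup 0 q)%N ->
  exists2 x, x != 0 & (mup x q < e * mup x p)%N.
Proof.
move=> p0 q0 lt; have [s [us sr sm]] := sum_mup_roots p0.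
pose s' := [seq x <- s | x != 0].
have us' : uniq (0 :: s') by rewrite /= filter_uniq // andbT mem_filter eqxx.
have [/hasP[x xs le]|/hasPn no] := boolP (has (fun x => mup x q < e * mup x p)%N s').
  by exists x => //; move: xs; rewrite mem_filter => /andP[].
have h1 := sum_mup_le q0 us'; rewrite big_cons in h1.
have h2 : (e * (size p).-1 = e * mup 0 p + \sum_(x <- s') e * mup x p)%N.
  rewrite -big_distrr -mulnDr -sm /= big_filter; congr (e * _)%N.
  rewrite (bigID (fun x => x == 0)) /=; congr (_ + _)%N.
  have [s0|s0] := boolP (0 \in s).
    rewrite -big_filter (_ : [seq i <- s | i == 0] = [:: 0]) ?big_seq1 //.
    exact: filter_pred1_uniq.
  rewrite big_seq_cond big1 ?mupNroot // -?sr // => x /andP[xs /eqP x0].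
  by rewrite -x0 xs in s0.
have : (\sum_(x <- s') e * mup x p <= \sum_(x <- s') mup x q)%N.
  rewrite big_seq [X in (_ <= X)%N]big_seq; apply: leq_sum => x /no.
  by rewrite -leqNgt.
move: lt h1; rewrite h2; set S1 := (\sum_(x <- s') _)%N; set S2 := (\sum_(x <- s') mup x q)%N.
move=> lt h1 le; have : (mup 0 q + S2 < mup 0 q + S1)%N; last by lia.
by apply: leq_ltn_trans h1 _; lia.
Qed.

(** A coefficient of [F] without pole does not contribute to a leading form
    of negative order. *)
Lemma leadF_coef0 X j : valid X -> leadF a 1 X != 0 ->
  (forall h, (h < f0 X)%N -> (dF X)`_j`_h = 0) -> (leadF a 1 X)`_j = 0.
Proof.
move=> vd h0 H; have [oF [eF _ <-]] := disc_leadF phi_lead1 vd h0.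
rewrite coefZ lfE H ?mulr0 //.
have : (a * oW X < a * w0 X)%N by rewrite ltn_pmul2l ?(vd_neg vd) // ltnW.
by move: (vd_e vd) eF; rewrite !muln1; lia.
Qed.

(** The version of [jac_until] for discs around the centre: [M] is the radius
    that remains until the original coordinate [y] is integral, and for [k0 = 1]
    the level is lowered by it. *)
Definition jac_walk (k0 : nat) (T lam : rat) N ta (M : nat) := forall k p,
  (0 < k)%N -> (p <= k * M)%N ->
  jac_until a b 1 (k%:R * T - k0%:R * (k * M - p)%:R) (k%:R * lam + p%:R * N%:R) N
    (k%:R * ta + p%:R).

Lemma jac_walk_rescale k0 T lam N ta M k p : (0 < k)%N -> (p <= k * M)%N ->
  jac_walk k0 T lam N ta M ->
  jac_walk k0 (k%:R * T) (k%:R * lam + p%:R * N%:R) N (k%:R * ta + p%:R) (k * M - p).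
Proof.
move=> k1 pM H k' p' k'0 p'M.
have := H (k' * k)%N (k' * p + p')%N.
have -> : (k' * k * M - (k' * p + p') = k' * (k * M - p) - p')%N.
  by rewrite mulnBr mulnA subnDA.
rewrite muln_gt0 k1 k'0 natrD !natrM => /(_ isT) h.
have {h} := h _; rewrite -mulnA -leq_subRL ?leq_mul2l ?pM ?orbT // -mulnBr => /(_ p'M).
have -> : k'%:R * k%:R * T = k'%:R * (k%:R * T) :> rat by ring.
have -> : k'%:R * k%:R * lam + (k'%:R * p%:R + p'%:R) * N%:R =
  k'%:R * (k%:R * lam + p%:R * N%:R) + p'%:R * N%:R :> rat by ring.
by have -> : k'%:R * k%:R * ta + (k'%:R * p%:R + p'%:R) = k'%:R * (k%:R * ta + p%:R) + p'%:R
  :> rat by ring.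
Qed.

(** The order of [Z / W^(a-1)], which is the order of the correction that the
    exact [a]-th root of [F] receives. *)
Definition vr X : rat := vZ X - a.-1%:R * vW X.

Lemma mup0_le (p : {poly C}) n : size p = n.+1 -> (mup 0 p <= n)%N.
Proof.
move=> sp; have p0 : p != 0 by apply/eqP => e; rewrite e size_poly0 in sp.
by have := sum_mup_le p0 (isT : uniq [:: 0]); rewrite big_seq1 sp.
Qed.

Lemma mup0_lt (p : {poly C}) n j : size p = n.+1 -> (j < n)%N -> p`_j != 0 -> (mup 0 p < n)%N.
Proof.
move=> sp jn nz; have p0 : p != 0 by apply/eqP => e; rewrite e size_poly0 in sp.
apply: leq_ltn_trans jn; rewrite leqNgt; apply: contra nz => lt.
by rewrite (mup0_coef p0).2.
Qed.

Lemma ltn_shift (d r c d1 r1 : nat) : (d < r + c)%N -> (r1 + c <= d1)%N -> (d + r1 < r + d1)%N.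
Proof. by lia. Qed.

Lemma side_slope (n d e t u v : rat) : 0 < n -> d < e * n -> v - e * u <= t -> u < t ->
  n * v - d * u < ((e + 1) * n - d) * t.
Proof.
move=> n0 dn vt ut.
have h1 : n * (v - e * u) <= n * t by rewrite ler_pM2l.
have h2 : (e * n - d) * u < (e * n - d) * t by rewrite ltr_pM2l // subr_gt0.
by move: h1 h2; lra.
Qed.

(** The disc shrinks around its centre. The coefficient [i] of [W], of low
    order, keeps [W] large, so that the Jacobian condition holds. At [M = 0] all
    coefficients of [F] are integral, which is absurd for a disc on which [W] has
    a pole. A disc on which [Z] catches up with [W^a] is excluded by
    [boundary_degree], given the invariant in the last hypothesis. When the
    invariant is lost at an event, the missing zeros of [Z] are found outside the
    centre by [nonzero_root], and [descent] applies there. In the applications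
    [W] is an approximate root of [F], without its constant term if [k0 = 1]. *)
Lemma walk s k0 n d X T lam N i kap M :
  (k0 <= 1)%N -> (n + d <= s)%N -> good n d X -> size (dW X) = N.+1 ->
  (dW X)`_N`_lam != 0 -> (dW X)`_i`_kap != 0 -> (k0 <= i)%N -> T <= 0 -> (0 < M)%N ->
  kap%:R - (w0 X)%:R + i%:R * M%:R < T -> (k0 = 1%N -> (dW X)`_0 = 0) ->
  (forall j h, (h + j * M < f0 X)%N -> (dF X)`_j`_h = 0) ->
  jac_walk k0 T (lam%:R - (w0 X)%:R) N (tau X) M ->
  (d < a.-1 * n + k0)%N \/ T - k0%:R * M%:R < vr X -> False.
Proof.
move=> k01; elim: s n d X T lam kap M => [|s IH] n d X T lam kap M snd gd szW neN nei ki T0 M0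
  kT W00 HF HJ inv; first by case: gd => _ _ _ _; move: snd; case: (n).
have [vd vtW vtZ gap n0] := gd.
pose cap : rat := ((oZ X)%:R - (a * oW X)%:R) / ((a * n)%:R - d%:R).
(* stop at the latest when [M] is used up *)
pose caps := M%:R :: (if (d < a * n)%N then [:: cap] else [::]).
have [|x [k [p [[k1 p0 ckp xk] nW nZ xcap xin]]]] := @next_event _ _ _ _ _ _ _ caps vtW vtZ isT.
  move=> y; rewrite inE => /orP[/eqP ->|]; first by rewrite ltr0n.
  case: ifP => // dA; rewrite inE => /eqP ->.
  by rewrite divr_gt0 // subr_gt0 ltr_nat // -[a]muln1.
have k1q : (0 : rat) < k%:R by rewrite ltr0n.
have pM : (p <= k * M)%N.
  have := xcap _ (mem_head _ _); rewrite -(ler_pM2r k1q) xk -natrM ler_nat.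
  by rewrite mulnC.
have le : (a * 1 * (k * oW X + p * n) <= k * oZ X + p * d)%N.
  rewrite muln1 mulnDr [(a * (k * _))%N]mulnCA [(a * (p * _))%N]mulnCA.
  have [dA|Ad] := ltnP d (a * n)%N.
    rewrite -(nat_slope _ _ dA k1 xk); apply: xcap.
    by rewrite /caps dA !inE eqxx orbT.
  apply: leq_add; last by rewrite leq_mul2l Ad orbT.
  by rewrite leq_mul2l -[a]muln1 (ltnW gap) orbT.
pose u := k%:R * vW X + p%:R * n%:R.
pose t := k%:R * T - k0%:R * (k * M - p)%:R.
have t0 : t <= 0.
  by rewrite subr_le0 (le_trans (y := 0)) ?pmulr_rle0 // -natrM ler0n.
have Mq : (k * M - p)%:R = k%:R * M%:R - p%:R :> rat by rewrite natrB // natrM.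
have ut : u < t.
  have h1 := nsl_vW nW nei.
  have h2 : k%:R * (kap%:R - (w0 X)%:R + i%:R * M%:R) < k%:R * T by rewrite ltr_pM2l.
  have h3 : k0%:R * (k * M - p)%:R <= i%:R * (k * M - p)%:R :> rat.
    by rewrite -!natrM ler_nat leq_mul2r ki orbT.
  apply: le_lt_trans h1 _; rewrite /t; move: h2 h3; rewrite Mq; lra.
have vd' : valid (rescale_disc b 1 k p n d X).
  have := rescale_disc_admissible a_gt1 b_gt0 cop (ltn0Sn 0) phi_lead1 gd k1 p0 nW nZ le. apply; first exact: lt_le_trans ut t0.
  exact: (jac_until_now (HJ k p k1 pM)) ut (nsl_vW nW neN).
set Y := rescale_disc b 1 k p n d X in vd'.
have HFY j h : (h + j * (k * M - p) < f0 Y)%N -> (dF Y)`_j`_h = 0.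
  move=> lt; apply/eqP; apply: contraLR lt => /(rescale_supp k1)[i' -> ne'].
  have : (f0 X <= i' + j * M)%N by rewrite leqNgt; apply: contra ne' => /HF ->.
  rewrite -leqNgt /= => h1; have : (k * f0 X <= k * (i' + j * M))%N by rewrite leq_mul2l h1 orbT.
  have e : (j * (k * M - p) + p * j = k * (j * M))%N.
    by rewrite [(p * j)%N]mulnC -mulnDr subnK // mulnCA.
  by rewrite mulnDr -e -addnA [(p * j + _)%N]addnC.
have [_ sW W0] := rescale_lf_top vtW k1 p0.
have [_ sZ Z0] := rescale_lf_top vtZ k1 p0.
have Ev : vr Y = k%:R * vr X + p%:R * (d%:R - a.-1%:R * n%:R).
  by rewrite /vr vW_rescale_disc vZ_rescale_disc; ring.
have tE : t = k%:R * (T - k0%:R * M%:R) + p%:R * k0%:R by rewrite /t Mq; ring.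
have [e|neq] := eqVneq (a * 1 * (k * oW X + p * n))%N (k * oZ X + p * d)%N.
  have dA : (d < a * 1 * n)%N.
    have h1 : (k * (a * 1 * oW X) < k * oZ X)%N by rewrite ltn_pmul2l.
    rewrite -(ltn_pmul2l p0).
    have : (a * 1 * (k * oW X + p * n) = k * (a * 1 * oW X) + p * (a * 1 * n))%N.
      by rewrite mulnDr [(_ * (k * _))%N]mulnCA [(_ * (p * _))%N]mulnCA.
    by rewrite e => e2; rewrite -(ltn_add2l (k * oZ X)) e2 ltn_add2r.
  have [L0 [h [h0 hE dE]]] := boundary_degree a_gt1 b_gt0 cop (ltn0Sn 0) phi_lead1 gd k1 p0 vd' e dA.
  have l0 := leadF_coef0 (j := 0) vd' L0 (fun h lt => HFY 0 h (etrans (congr1 (fun x => x < _)%N (addn0 h)) lt)).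
  (* for [k0 = 1] the root [h] of [boundary_degree] vanishes at the centre,
  as [W] and the leading form of [F] do, so that it is not constant *)
  have kd : (a.-1 * n + k0 <= d)%N.
    rewrite [X in (_ <= X)%N]dE mul1n addnC leq_add2r.
    have [->//|k0p] := posnP k0; apply: (leq_trans k01).
    have W00' : (dW X)`_0 = 0 by apply: W00; apply/eqP; rewrite eqn_leq k01.
    have h00 : h`_0 = 0.
      move: l0; rewrite hE expr1 -horner_coef0 horner_exp hornerD !horner_coef0.
      rewrite lfE coef_rescale W00' comp_poly0 mul0r coef0 add0r => /eqP.
      by rewrite expf_eq0 => /andP[_ /eqP].
    rewrite -subn1 subn_gt0 ltnNge; apply: contraNN h0 => /size1_polyC ->.
    by rewrite h00.
  case: inv => [|lt]; first by rewrite ltnNge kd.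
  have vu : vZ Y = a%:R * vW Y.
    have := congr1 (fun n => n%:R : rat) e; rewrite /vZ /vW /= !muln1 !natrM => <-.
    by ring.
  have vrY : vr Y = u.
    rewrite /vr vu vW_rescale_disc -/u -[in a%:R](prednK (ltnW a_gt1)) mulrSr; ring.
  have h1 : k%:R * (T - k0%:R * M%:R) < k%:R * vr X by rewrite ltr_pM2l.
  have h2 : p%:R * k0%:R <= p%:R * (d%:R - a.-1%:R * n%:R) :> rat.
    rewrite ler_wpM2l ?ler0n // lerBrDr -natrM -natrD ler_nat addnC; exact: kd.
  by move: ut; rewrite -vrY Ev tE; lra.
have gap' : (a * 1 * oW Y < oZ Y)%N by rewrite ltn_neqAle neq.
have LE : leadF a 1 Y = lf (oW Y) (dW Y) ^+ (a * 1) by rewrite /leadF (lf_lt (vd_Z vd')) ?addr0.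
have L0 : leadF a 1 Y != 0 by rewrite LE; exact: (expf_neq0 _ W0).
(* [M] is used up: [F] is integral on the disc *)
have [Mp|M1] := posnP (k * M - p).
  case/eqP: (L0); apply/polyP => j; rewrite coef0; apply: leadF_coef0 => // h lt.
  by apply: HFY; rewrite Mp muln0 addn0.
have W'00 : (lf (oW Y) (dW Y))`_0 = 0.
  have := leadF_coef0 (j := 0) vd' L0 (fun h lt => HFY 0 h (etrans (congr1 (fun x => x < _)%N (addn0 h)) lt)).
  by rewrite LE -!horner_coef0 horner_exp => /eqP; rewrite expf_eq0 => /andP[_ /eqP].
set n1 := mup 0 (lf (oW Y) (dW Y)); set d1 := mup 0 (lf (oZ Y) (dZ Y)).
(* the constant coefficient of [F] has no pole, so that [W] has a zero at
the centre *)
have n10 : (0 < n1)%N.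
  rewrite lt0n; apply/eqP => e; have := (mup0_coef W0).1.
  by rewrite -[mup 0 _]/n1 e [X in X != _]W'00 eqxx.
have gd1 : good n1 d1 Y.
  split=> //; first exact: mup_vtx (vd_W vd') (vd_W0 vd').
  exact: mup_vtx (vd_Z vd') Z0.
have nd1 : (n1 + d1 <= s)%N.
  rewrite -ltnS; apply: leq_trans snd.
  have n1n : (n1 <= n)%N := mup0_le sW.
  have d1d : (d1 <= d)%N := mup0_le sZ.
  move: xin; rewrite !mem_cat => /or3P[xW|xZ|].
  - have [j [i' [jn nz tie]]] := evs_tie xk xW.
    rewrite -addSn leq_add //; apply: mup0_lt sW jn _.
    by rewrite (rescale_lf_coef _ k1 tie).
  - have [j [i' [jn nz tie]]] := evs_tie xk xZ.
    rewrite -addnS leq_add //; apply: mup0_lt sZ jn _.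
    by rewrite (rescale_lf_coef _ k1 tie).
  rewrite inE => /orP[/eqP xM|].
    have : (p == k * M)%N by rewrite -(eqr_nat rat) -xk xM natrM mulrC.
    by move/eqP => pk; rewrite pk subnn in M1.
  case: ifP => // dA; rewrite inE => /eqP xc; case/eqP: neq.
  have := slope_tie dA xk xc.
  by rewrite muln1 mulnDr [(a * (k * _))%N]mulnCA [(a * (p * _))%N]mulnCA.
have ne_Y j h : (dW X)`_j`_h != 0 -> (dW Y)`_j`_(k * h + p * j) != 0.
  by move=> nz; rewrite /= rescale_coef.
have HJY : jac_walk k0 (k%:R * T) ((k * lam + p * N)%:R - (w0 Y)%:R) N (tau Y) (k * M - p).
  have := jac_walk_rescale k1 pM HJ; rewrite -(tau_rescale_disc b 1 k p n d).
  have -> : k%:R * (lam%:R - (w0 X)%:R) + p%:R * N%:R = (k * lam + p * N)%:R - (w0 Y)%:R :> rat.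
    by rewrite /= !(natrD, natrM); ring.
  exact.
have szY : size (dW Y) = N.+1 by rewrite /= size_rescale.
(* either the invariant survives, or some other root of [W] has few zeros
of [Z] *)
have [inv'|] := boolP ((d1 < a.-1 * n1 + k0)%N || (k%:R * T - k0%:R * (k * M - p)%:R < vr Y)).
  apply: (IH n1 d1 Y (k%:R * T) (k * lam + p * N)%N (k * kap + p * i)%N (k * M - p)%N) => //.
  - exact: ne_Y.
  - exact: ne_Y.
  - by rewrite pmulr_rle0.
  - have : k%:R * (kap%:R - (w0 X)%:R + i%:R * M%:R) < k%:R * T by rewrite ltr_pM2l.
    rewrite /= Mq !(natrD, natrM); lra.
  - by move=> /W00 W00'; rewrite /= coef_rescale W00' comp_poly0 mul0r.
  - exact/orP.
rewrite negb_or -leqNgt -leNgt => /andP[kd1 vrt].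
have kd : (d < a.-1 * n + k0)%N.
  case: inv => // lt.
  have h1 : k%:R * (T - k0%:R * M%:R) < k%:R * vr X by rewrite ltr_pM2l.
  rewrite ltnNge; apply/negP => kd.
  have h2 : p%:R * k0%:R <= p%:R * (d%:R - a.-1%:R * n%:R) :> rat.
    rewrite ler_wpM2l ?ler0n // lerBrDr -natrM -natrD ler_nat addnC; exact: kd.
  by move: vrt; rewrite Ev -/t tE; lra.
have [|y y0 dy] := @nonzero_root a.-1 _ _ W0 Z0.
  rewrite sW sZ -[mup 0 (lf (_ + p * n) _)]/n1 -[mup 0 _]/d1 /=; exact: ltn_shift kd kd1.
have ny0 : (0 < mup y (lf (oW Y) (dW Y)))%N.
  by rewrite lt0n; apply/eqP => e; move: dy; rewrite [X in (_ < _ * X)%N]e muln0.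
have gdy := translate_good vd' gap' Z0 ny0.
set ny := mup y (lf (oW Y) (dW Y)) in ny0 gdy dy.
set dy' := mup y _ in gdy dy.
have neY : (dW (translate_disc y Y))`_N`_(k * lam + p * N) != 0.
  have : lead_coef (translate y (dW Y)) = lead_coef (dW Y) by apply: lead_translate.
  by rewrite !lead_coefE size_translate szY /= => ->; rewrite rescale_coef.
apply: (descent a_gt1 b_gt0 cop (ltn0Sn 0) phi_lead1 (leqnn _) (leqnn _) gdy _ _ neY t0).
- by rewrite muln1.
- by rewrite /= size_translate.
- rewrite (_ : tau (translate_disc y Y) = k%:R * tau X + p%:R); last exact: tau_rescale_disc.
  rewrite (_ : _ - _ = k%:R * (lam%:R - (w0 X)%:R) + p%:R * N%:R); first exact: HJ.
  by rewrite /= !(natrD, natrM); ring.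
rewrite -[vZ _]/(vZ Y) -[vW _]/(vW Y) muln1 natrM -[in a%:R](prednK (ltnW a_gt1)) mulrSr.
apply: side_slope.
- by rewrite ltr0n.
- rewrite -natrM ltr_nat; exact: dy.
- exact: vrt.
- by rewrite vW_rescale_disc.
Qed.

End Walk.

(** * Discs around infinity *)

Section Homogenize.
Variable C : numClosedFieldType.
Notation BP := {poly {poly C}}.
Implicit Types P : BP.

(** [s^(M n) P(s, s^(-M) xi)], for [P] of degree at most [n]. *)
Definition homogenize M n P : BP := \poly_(j < n.+1) ('X^(M * (n - j)) * P`_j).

Lemma coef_homogenize M n P j : (size P <= n.+1)%N -> (homogenize M n P)`_j = 'X^(M * (n - j)) * P`_j.
Proof.
move=> sP; rewrite coef_poly; case: ltnP => // nj.
by rewrite [P`_j]nth_default ?mulr0 // (leq_trans sP).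
Qed.

Lemma homogenize_top M n P : (size P <= n.+1)%N -> (homogenize M n P)`_n = P`_n.
Proof. by move=> sP; rewrite coef_homogenize // subnn muln0 mul1r. Qed.

Lemma rescale_homogenize M n P : (size P <= n.+1)%N -> rescale 1 M (homogenize M n P) = ('X^(M * n))%:P * P.
Proof.
move=> sP; apply/polyP => j; rewrite coef_rescale coefCM coef_homogenize // expr1 comp_polyXr.
have [nj|jn] := ltnP n j; first by rewrite [P`_j]nth_default ?mulr0 ?mul0r // (leq_trans sP).
by rewrite mulrAC -exprD -mulnDr subnK.
Qed.

Lemma rescale1C M (c : {poly C}) : rescale 1 M c%:P = c%:P.
Proof. by rewrite rescaleC expr1 comp_polyXr. Qed.

Lemma rescale1_inj M (P Q : BP) : rescale 1 M P = rescale 1 M Q -> P = Q.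
Proof.
by move=> e; apply/eqP; rewrite -subr_eq0; apply/eqP/(@rescale_inj _ 1 M) => //; rewrite rescaleD rescaleN e subrr.
Qed.

Lemma size_homogenize M n P : size P = n.+1 -> size (homogenize M n P) = n.+1.
Proof.
move=> sP; rewrite size_poly_eq // subnn muln0 mul1r.
by have := lead_coef_eq0 P; rewrite lead_coefE sP /= => ->; rewrite -size_poly_eq0 sP.
Qed.

Lemma homogenize_coef_neq0 M n P j i : (size P <= n.+1)%N -> (homogenize M n P)`_j`_i != 0 ->
  exists2 i', i = (M * (n - j) + i')%N & P`_j`_i' != 0.
Proof.
move=> sP; rewrite coef_homogenize // coefXnM; case: ltnP => [|le]; first by rewrite eqxx.
by move=> nz; exists (i - M * (n - j))%N; rewrite ?subnKC.
Qed.

Lemma homogenize_coef M n P j i : (size P <= n.+1)%N -> (homogenize M n P)`_j`_(M * (n - j) + i) = P`_j`_i.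
Proof. by move=> sP; rewrite coef_homogenize // coefXnM ltnNge leq_addr /= addKn. Qed.

Lemma size_coef_lt P n j i : (size P <= n.+1)%N -> P`_j`_i != 0 -> (j <= n)%N.
Proof.
move=> sP nz; rewrite -ltnS; apply: leq_trans sP; rewrite ltnNge; apply: contra nz => le.
by rewrite (nth_default _ le) coef0.
Qed.

Lemma homogenize_vtx M n l P o : size P = l.+1 -> (l <= n)%N -> mup 0 P`_l = o -> (o < M)%N ->
  vtx (homogenize M n P) (o + M * (n - l)) l.
Proof.
move=> sP ln mo oM; have sPn : (size P <= n.+1)%N by rewrite sP ltnS.
have Pl : P`_l != 0.
  by have := lead_coef_eq0 P; rewrite lead_coefE sP /= => ->; rewrite -size_poly_eq0 sP.
have [nz lo] := mup0_coef Pl; rewrite mo in nz lo.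
split; first by rewrite addnC homogenize_coef.
move=> j i /(homogenize_coef_neq0 sPn)[i' -> nz'].
have jl : (j <= l)%N by apply: (size_coef_lt _ nz'); rewrite sP.
have [jl'|lj] := ltnP j l.
  have h : (M * (n - l) + M <= M * (n - j))%N by rewrite -mulnSr leq_mul2l; lia.
  split; first by rewrite addnC; lia.
  by move=> e; exfalso; lia.
have ej : j = l by lia.
subst j; rewrite addnC leq_add2l; split=> //.
by rewrite leqNgt; apply: contra nz' => /lo ->.
Qed.

(** The factors [s^f0] and [s^g0] are the ones that [Jf] is made to
    compensate. *)
Lemma Jf_scale f0 g0 (F G : BP) : Jf f0 g0 (('X^f0)%:P * F) (('X^g0)%:P * G) =
  ('X^(f0 + g0))%:P * Jf 0 0 F G.
Proof.
have h (n : nat) (P : BP) : sd (('X^n)%:P * P) - ('X^n)%:P * P *+ n = ('X^n)%:P * sd P.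
  apply/polyP => j; rewrite coefB coefMn coef_sd !coefCM coef_sd derivM derivXn.
  case: n => [|n]; first by rewrite !mulr0n expr0; ring.
  by rewrite [_.+1.-1]/= exprS; ring.
rewrite /Jf !h !mulr0n !subr0 !derivM !derivC !mul0r !add0r exprD polyCM; ring.
Qed.

End Homogenize.

Section Initial.
Variable C : numClosedFieldType.
Notation BP := {poly {poly C}}.
Variables (a b delta : nat) (phi : {poly C}).
Hypotheses (a_gt1 : (1 < a)%N) (b_gt0 : (0 < b)%N) (cop : coprime a b)
  (delta_gt0 : (0 < delta)%N).
Notation A := (a * delta)%N.
Notation B := (b * delta)%N.
Notation D := ((a + b) * delta)%N.
Notation valid := (valid_disc a b delta phi).
Notation good := (good a b delta phi).
Notation hom_ev := (homog_ev a delta phi).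

Variables (F G W Z : BP) (g : {poly C}) (e q l mu o : nat) (c : C).
Hypotheses (rel : ('X^(A * e) * g)%:P * F = hom_ev e W + Z) (g0 : g`_0 != 0)
  (br : Jf 0 0 F G = (c *: 'X)%:P)
  (q_gt0 : (0 < q)%N) (sW : size W = q.+1) (sZ : size Z = l.+1) (lq : (l < A * q)%N)
  (sF : (size F <= (A * q).+1)%N) (sG : size G = (B * q).+1)
  (mW : mup 0 W`_q = mu) (emu : (e <= mu)%N) (mZ : mup 0 Z`_l = o)
  (mG : mup 0 G`_(B * q) = (B * (mu - e))%N).

(** The disc of radius [- M] in the original coordinate [y = s^(-M) xi]. *)
Definition disc_at_infty M : disc C := Disc (homogenize M q W) (homogenize M (A * q) Z) (homogenize M (A * q) F)
  (homogenize M (B * q) G) g (e + M * q) (M * (A * q)) (M * (B * q)) (A * e)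
  (M * (A * q) + M * (B * q) + 1 - M) mu (o + M * (A * q - l)) (B * (mu - e)).

Lemma disc_at_infty_rel M : ('X^(A * e) * g)%:P * homogenize M (A * q) F =
  hom_ev (e + M * q) (homogenize M q W) + homogenize M (A * q) Z.
Proof.
apply: (@rescale1_inj _ M); rewrite rescaleM rescaleD rescale1C !rescale_homogenize //; last by rewrite sZ ltnW.
have -> : rescale 1 M (hom_ev (e + M * q) (homogenize M q W)) = ('X^(M * (A * q)))%:P * hom_ev e W.
  rewrite /homog_ev rescale_sum mulr_sumr; apply: eq_bigr => j _.
  rewrite rescaleM rescaleX rescale1C rescale_homogenize ?sW // exprMn -[_%:P ^+ j]rmorphXn /= -exprM.
  rewrite mulrA -polyCM mulrA -polyCM; congr (_%:P * _).
  rewrite -scalerAl -exprD -scalerAr -exprD; congr (_ *: 'X^_).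
  have jA : (j <= A)%N by rewrite -ltnS.
  have -> : (M * (A * q) = M * q * (A - j) + M * q * j)%N.
    by rewrite -mulnDr subnK //; ring.
  by ring.
by rewrite -mulrDr -rel mulrCA.
Qed.

Lemma disc_at_infty_J M : (M <= M * (A * q) + M * (B * q) + 1)%N ->
  Jf (M * (A * q)) (M * (B * q)) (homogenize M (A * q) F) (homogenize M (B * q) G) =
  (c *: 'X^(M * (A * q) + M * (B * q) + 1 - M))%:P.
Proof.
move=> le; have sG' : (size G <= (B * q).+1)%N by rewrite sG.
have := Jf_rescale M (M * (A * q)) (M * (B * q)) (homogenize M (A * q) F) (homogenize M (B * q) G) (ltn0Sn 0).
rewrite !mul1n !rescale_homogenize // Jf_scale br mulr1n -polyCM -scalerAr -exprSr -addn1.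
rewrite -{1}(subnK le) exprD scalerAr mulrC polyCM => E.
have X0 : ('X^M)%:P != 0 :> BP by rewrite polyC_eq0 expf_neq0 // polyX_eq0.
apply/esym/(@rescale1_inj _ M)/(mulfI X0); rewrite rescale1C -E.
by rewrite -!polyCM -scalerAl -scalerAr.
Qed.

(** For [M] large, the top monomial in [xi] dominates in each of [W], [Z] and
    [G]. *)
Lemma disc_at_infty_good M : (D * mu + o < M)%N -> good q l (disc_at_infty M).
Proof.
move=> hM.
have D2 : (2 <= D)%N.
  have := delta_gt0; rewrite -(leq_add2l 1) => d1.
  by rewrite (leq_trans (n := a + b)) ?leq_pmulr // (leq_trans a_gt1) ?leq_addr.
have DAB : D = (A + B)%N by rewrite mulnDl.
have muD : (2 * mu <= D * mu)%N by rewrite leq_mul2r D2 orbT.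
have Amu : (A * mu <= D * mu)%N by rewrite leq_mul2r DAB leq_addr orbT.
have Bmu : (B * (mu - e) <= D * mu)%N by rewrite leq_mul ?leq_subr // DAB leq_addl.
have Mq : (M <= M * q)%N by rewrite leq_pmulr.
have vW : vtx (homogenize M q W) mu q.
  have := @homogenize_vtx _ M q q W mu sW (leqnn q) mW; rewrite subnn muln0 addn0; apply; lia.
have vZ : vtx (homogenize M (A * q) Z) (o + M * (A * q - l)) l.
  by apply: homogenize_vtx => //; [exact: ltnW|lia].
have vG : vtx (homogenize M (B * q) G) (B * (mu - e)) (B * q).
  have := @homogenize_vtx _ M (B * q) (B * q) G _ sG (leqnn _) mG; rewrite subnn muln0 addn0; apply; lia.
have Ml : (M <= M * (A * q - l))%N by rewrite leq_pmulr // subn_gt0.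
have DMq : (2 * M <= D * (M * q))%N by rewrite leq_mul.
have e1 : (D * (M * q) = M * (A * q) + M * (B * q))%N by rewrite DAB; ring.
have Bm : (B * (mu - e) + B * e = B * mu)%N by rewrite -mulnDr subnK.
have Le : (M <= M * (A * q) + M * (B * q) + 1)%N by lia.
have r := disc_at_infty_rel M; have J := disc_at_infty_J Le.
split=> //; last by move=> /=; lia.
split=> //=.
- by rewrite mulnDr; congr (_ + _)%N; ring.
- by exists c.
- exact: vtx_ordge vW.
- exact: vtx_lf vW.
- exact: vtx_ordge vZ.
- exact: vtx_ordge vG.
- exact: vtx_lf vG.
- rewrite mulnDr addnA Bm addnC; congr (_ + _)%N; ring.
- by lia.
- by lia.
- by rewrite mulnDr e1; lia.
Qed.

Lemma disc_at_infty_vW M : vW (disc_at_infty M) = (mu%:R - e%:R) - M%:R * q%:R.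
Proof. by rewrite /vW /= natrD natrM; ring. Qed.

Lemma disc_at_infty_vZ M : vZ a delta (disc_at_infty M) = o%:R - A%:R * e%:R - M%:R * l%:R.
Proof.
rewrite /vZ /= natrD natrM natrB; last exact: ltnW.
by rewrite !(natrD, natrM); ring.
Qed.

Lemma disc_at_infty_tau M : (M <= M * (A * q) + M * (B * q) + 1)%N -> tau (disc_at_infty M) = 1 - M%:R.
Proof. by move=> le; rewrite /tau /= natrB // !natrD; ring. Qed.

End Initial.

(** * The order of the top coefficient at one root *)

Section Level.

(** While the order of [W] is below this level, its top term alone guarantees
    the Jacobian condition: see [jac_until_init]. *)
Definition tlev (D mu q : nat) : rat :=
  if (mu <= q)%N then 0 else - (mu%:R - q%:R) / (D%:R * q%:R - 1).

Lemma tlev_le0 D mu q : (1 < D * q)%N -> tlev D mu q <= 0.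
Proof.
move=> Dq; rewrite /tlev; case: leqP => // lt; rewrite mulNr oppr_le0 divr_ge0 // subr_ge0.
  by rewrite ler_nat ltnW.
by rewrite -natrM ler1n ltnW.
Qed.

Lemma tlev_bound D mu q : (1 < D * q)%N ->
  (D%:R * q%:R - 1) * (D%:R * tlev D mu q - 1) <= 1 - D%:R * mu%:R :> rat.
Proof.
move=> Dq; have Dq0 : D%:R * q%:R - 1 != 0 :> rat.
  by rewrite gt_eqF // subr_gt0 -natrM ltr1n.
rewrite /tlev; case: leqP => [le|lt].
  have : D%:R * mu%:R <= D%:R * q%:R :> rat by rewrite -!natrM ler_nat leq_mul2l le orbT.
  lra.
have -> : (D%:R * q%:R - 1) * (D%:R * (- (mu%:R - q%:R) / (D%:R * q%:R - 1)) - 1) =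
  1 - D%:R * mu%:R :> rat by field.
by [].
Qed.

(** Either [k + y] is at least [D k t], or [y] is so negative that the second
    bound on [w] suffices. *)
Lemma level_bound (D q t mu k y w : rat) : 0 < D -> 1 < D * q -> 0 < k ->
  (D * q - 1) * (D * t - 1) <= 1 - D * mu -> w < k * t -> w <= k * mu + q * y ->
  D * w < k + y.
Proof.
move=> D0 Dq k0 H h1 h2; have Dq0 : 0 < D * q - 1 by rewrite subr_gt0.
have {}h1 : D * w < D * (k * t) by rewrite ltr_pM2l.
have {}h2 : D * w <= D * (k * mu + q * y) by rewrite ler_pM2l.
have [le|lt] := leP (D * (k * t)) (k + y); first exact: lt_le_trans h1 le.
apply: le_lt_trans h2 _.
have lt' : (D * q - 1) * (k + y) < (D * q - 1) * (D * (k * t)) by rewrite ltr_pM2l.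
have H' : k * ((D * q - 1) * (D * t - 1)) <= k * (1 - D * mu) by rewrite ler_pM2l.
by move: lt' H'; lra.
Qed.

Lemma jac_until_init (a b delta M mu q : nat) (D := ((a + b) * delta)%N) : (1 < D * q)%N ->
  jac_until a b delta (tlev D mu q) (mu%:R - M%:R * q%:R) q (1 - M%:R).
Proof.
move=> Dq k p w k0 h1 h2; rewrite -/D.
have D0 : (0 < D)%N by case: (D) Dq.
have -> : k%:R * (1 - M%:R) + p%:R = k%:R + (p%:R - k%:R * M%:R) :> rat by ring.
apply: (level_bound _ _ _ (tlev_bound mu Dq) h1); rewrite ?ltr0n // -?natrM ?ltr1n //.
by move: h2; lra.
Qed.

End Level.

Section Local.
Variable C : numClosedFieldType.
Notation BP := {poly {poly C}}.
Variables (a b delta : nat) (phi : {poly C}).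
Hypotheses (a_gt1 : (1 < a)%N) (b_gt0 : (0 < b)%N) (cop : coprime a b)
  (delta_gt0 : (0 < delta)%N).
Notation A := (a * delta)%N.
Notation B := (b * delta)%N.
Notation D := ((a + b) * delta)%N.
Hypotheses (phi_lead : phi`_A = 1).

Lemma coef_top (P : BP) n : size P = n.+1 -> P`_n != 0.
Proof. by move=> sP; have := lead_coef_eq0 P; rewrite lead_coefE sP /= => ->; rewrite -size_poly_eq0 sP. Qed.

(** A violation is the last hypothesis of [descent] on a large disc around
    infinity. *)
Lemma local_bound (F G W Z : BP) q l (c : C) : F = homog_ev a delta phi 0 W + Z ->
  Jf 0 0 F G = (c *: 'X)%:P -> (0 < q)%N -> size W = q.+1 -> size Z = l.+1 ->
  (l < a.-1 * delta * q)%N -> (size F <= (A * q).+1)%N -> size G = (B * q).+1 ->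
  mup 0 G`_(B * q) = (B * mup 0 W`_q)%N ->
  l%:R * (mup 0 W`_q)%:R + ((A * q)%:R - l%:R) * tlev D (mup 0 W`_q) q
    <= q%:R * (mup 0 Z`_l)%:R.
Proof.
move=> rel br q0 sW sZ lq sF sG mG; rewrite leNgt; apply/negP => lt.
set mu := mup 0 W`_q in mG lt; set o := mup 0 Z`_l in lt.
have lA : (l < A * q)%N.
  by apply: leq_trans lq _; rewrite !leq_mul2r leq_pred !orbT.
have rel' : ('X^(A * 0) * 1)%:P * F = homog_ev a delta phi 0 W + Z.
  by rewrite muln0 expr0 mulr1 mul1r.
have g0 : (1 : {poly C})`_0 != 0 by rewrite coef1 oner_eq0.
pose M := (D * mu + o).+1.
have mG' : mup 0 G`_(B * q) = (B * (mu - 0))%N by rewrite subn0.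
have gd := disc_at_infty_good a_gt1 b_gt0 cop delta_gt0 rel' g0 br q0 sW sZ lA sF sG erefl (leq0n _) erefl mG' (leqnn M).
have D2 : (1 < D)%N.
  by rewrite (leq_trans a_gt1) // (leq_trans (leq_addr b a)) // leq_pmulr.
have Dq : (1 < D * q)%N by rewrite (leq_trans D2) // leq_pmulr.
have DAB : D = (A + B)%N by rewrite mulnDl.
have Le : (M <= M * (A * q) + M * (B * q) + 1)%N.
  by rewrite -mulnDr -mulnDl -DAB (leq_trans (leq_pmulr M (ltnW Dq))) ?leq_addr.
set X := disc_at_infty a b delta F G W Z 1 0 q l mu o M in gd *.
have t0 := tlev_le0 mu Dq.
apply: (descent a_gt1 b_gt0 cop delta_gt0 phi_lead (leqnn _) (leqnn _) gd lq _ _ t0).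
- exact: size_homogenize.
- rewrite /= homogenize_top ?sW //; exact: (mup0_coef (coef_top sW)).1.
- have -> : tau X = 1 - M%:R by apply: disc_at_infty_tau.
  rewrite (_ : _ - _ = mu%:R - M%:R * q%:R); first exact: jac_until_init.
  by rewrite /= add0n natrM.
rewrite disc_at_infty_vZ // disc_at_infty_vW subr0 mulr0 subr0; move: lt; lra.
Qed.

End Local.

Section LocalRoot.
Variable C : numClosedFieldType.
Notation BP := {poly {poly C}}.
Variables (a b : nat).
Hypotheses (a_gt1 : (1 < a)%N) (b_gt0 : (0 < b)%N) (cop : coprime a b).

Lemma homog_ev_Xa w (W : BP) : homog_ev a 1 'X^a w W = W ^+ a.
Proof.
rewrite /homog_ev muln1 big_ord_recr /= big1 ?add0r => [|j _]; last first.
  by rewrite coefXn ltn_eqF // scale0r mul0r.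
by rewrite coefXn eqxx subnn muln0 expr0 scale1r mul1r.
Qed.

Lemma jac_walk_init k0 M mu N : (k0 <= 1)%N -> (1 < (a + b) * N)%N ->
  jac_walk a b k0 (if k0 == 0%N then tlev (a + b) mu N else 0) (mu%:R - M%:R * N%:R) N
    (1 - M%:R) M.
Proof.
move=> k01 D1 k p k1 pM.
case: k0 k01 => [|[|//]] _ /=.
  rewrite mulr0n mul0r subr0; apply: jac_until_rescale => //.
  by have := @jac_until_init a b 1 M mu N; rewrite muln1; apply.
move=> k' p' w k'1; rewrite mulr0 sub0r mulr1n mul1r natrB // natrM muln1 => h _.
have k'0 : 0 < k'%:R :> rat by rewrite ltr0n.
have k0 : 0 < k%:R :> rat by rewrite ltr0n.
have kk : 0 < k'%:R * k%:R :> rat by rewrite mulr_gt0.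
have p'0 : 0 <= p'%:R :> rat by rewrite ler0n.
have kM : 0 <= k'%:R * (k%:R * M%:R - p%:R) :> rat.
  by rewrite mulr_ge0 ?ler0n // subr_ge0 -natrM ler_nat.
have w0 : w <= 0 by apply: ltW (lt_le_trans h _); rewrite mulrN oppr_le0.
have D1' : (1 : rat) <= (a + b)%:R by rewrite ler1n addn_gt0 b_gt0 orbT.
have : (a + b)%:R * w <= w by rewrite ler_neMl.
by move: h; lra.
Qed.

(** Apply [walk] to a large disc around infinity. When [T = 0] there is no disc
    to start from, but then [Q / g] is integral in [s] by a Gauss lemma. *)
Lemma local_walk (F G Q T : BP) (g : {poly C}) N k0 i mu (c : C) : g != 0 ->
  (g ^+ a)%:P * F = Q ^+ a + T -> Jf 0 0 F G = (c *: 'X)%:P -> (0 < N)%N ->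
  size Q = N.+1 -> (size T <= a.-1 * N + k0)%N -> (size F <= (a * N).+1)%N ->
  size G = (b * N).+1 -> mup 0 Q`_N = (mup 0 g + mu)%N -> mup 0 G`_(b * N) = (b * mu)%N ->
  (k0 <= 1)%N -> (k0 <= i)%N -> Q`_i != 0 -> (k0 = 1%N -> Q`_0 = 0) ->
  (mup 0 Q`_i)%:R - (mup 0 g)%:R < (if k0 == 0%N then tlev (a + b) mu N else 0) -> False.
Proof.
move=> g0 rel br N0 sQ sT sF sG mQ mG k01 ki Qi Q0 lt.
have D1 : (1 < (a + b) * N)%N.
  by rewrite (leq_trans a_gt1) // (leq_trans (leq_addr b a)) // leq_pmulr.
have thr0 : (if k0 == 0%N then tlev (a + b) mu N else 0) <= 0 by case: eqP => // _; apply: tlev_le0.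
have [u gu u0] := mup_split 0 g0; rewrite subr0 in gu.
set e := mup 0 g in mQ lt gu.
have rel' : ('X^(a * 1 * e) * u ^+ a)%:P * F = homog_ev a 1 'X^a e Q + T.
  by rewrite homog_ev_Xa -rel gu exprMn -exprM muln1 [(e * a)%N]mulnC.
have iN : (i <= N)%N by rewrite leqNgt; apply: contra Qi => lti; rewrite nth_default // sQ.
have [Qnz Qz] := mup0_coef Qi; set kap := mup 0 Q`_i in Qnz Qz lt.
(* Gauss lemma: [g] divides [Q] up to units of [C[[s]]] *)
have [T0|T0] := eqVneq T 0.
  have Qn0 : Q != 0 by rewrite -size_poly_gt0 sQ.
  have [r rQ lQ] := exists_ord Qn0.
  have o1 : ordge (Q ^+ a) (a * e).
    rewrite -[Q ^+ a]addr0 -T0 -(homog_ev_Xa e) -rel' muln1 polyCM -mulrA.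
    exact: factor_ordge.
  have er : (e <= r)%N.
    rewrite leqNgt; apply/negP => re.
    have := lf_lt o1 (_ : a * r < a * e)%N; rewrite ltn_pmul2l ?(ltnW a_gt1) // => /(_ re).
    by rewrite lfX // => /eqP; rewrite expf_eq0 (negPf lQ) andbF.
  have : (e <= kap)%N.
    rewrite leqNgt; apply: contra Qnz => ke; rewrite rQ //; exact: leq_trans ke er.
  rewrite -(ler_nat rat) -subr_ge0 => h; have := le_lt_trans h (lt_le_trans lt thr0).
  by rewrite ltxx.
have [l sT'] : exists l, size T = l.+1 by exists (size T).-1; rewrite prednK // size_poly_gt0.
have lN : (l < a.-1 * N + k0)%N by rewrite -sT'.
have lA : (l < a * 1 * N)%N.
  have k0N := leq_trans k01 N0.
  apply: leq_trans lN _; rewrite muln1 -[in (a * _)%N](prednK (ltnW a_gt1)) mulSn addnC.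
  by rewrite leq_add2r.
pose o := mup 0 T`_l; pose M := ((a + b) * 1 * (e + mu) + o).+1.
have u0' : (u ^+ a)`_0 != 0 by rewrite -horner_coef0 horner_exp expf_neq0.
have sF' : (size F <= (a * 1 * N).+1)%N by rewrite muln1.
have sG' : size G = (b * 1 * N).+1 by rewrite muln1.
have mG' : mup 0 G`_(b * 1 * N) = (b * 1 * (e + mu - e))%N by rewrite !muln1 addKn.
have gd := disc_at_infty_good a_gt1 b_gt0 cop (ltn0Sn 0) rel' u0' br N0 sQ sT' lA sF' sG' mQ
  (leq_addr _ _) erefl mG' (leqnn M).
set X := disc_at_infty a b 1 F G Q T (u ^+ a) e N l (e + mu) o M in gd.
have Le : (M <= M * (a * 1 * N) + M * (b * 1 * N) + 1)%N.
  by rewrite -mulnDr !muln1 -mulnDl (leq_trans (leq_pmulr M (ltnW D1))) ?leq_addr.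
apply: (walk a_gt1 b_gt0 cop k01 (leqnn _) gd (lam := (e + mu)%N) (N := N) (i := i)
  (kap := (M * (N - i) + kap)%N) (T := if k0 == 0%N then tlev (a + b) mu N else 0) (M := M)) => //.
- exact: size_homogenize.
- rewrite /= homogenize_top ?sQ //; have := mup0_coef (coef_top sQ); rewrite mQ; exact: proj1.
- by rewrite /= homogenize_coef ?sQ.
- rewrite /= !(natrD, natrM) natrB //; move: lt; lra.
- by move=> /Q0 Q00; rewrite /= coef_homogenize ?sQ // Q00 mulr0.
- move=> j h /= lth; apply/eqP; apply: contraLR lth => nz.
  have [i' -> nz'] := homogenize_coef_neq0 sF' nz; have jA := size_coef_lt sF' nz'.
  rewrite -leqNgt addnAC [(j * M)%N]mulnC -mulnDr subnK //; exact: leq_addr.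
- have -> : tau X = 1 - M%:R by apply: disc_at_infty_tau.
  rewrite (_ : _ - _ = mu%:R - M%:R * N%:R); first exact: jac_walk_init.
  by rewrite /= !(natrD, natrM); ring.
by left.
Qed.

End LocalRoot.

(** * Approximate roots *)

Section Degree.
Variable R : idomainType.
Implicit Types P Q : {poly R}.

Lemma size_mul_le P Q m n : (size P <= m.+1)%N -> (size Q <= n.+1)%N ->
  (size (P * Q)%R <= (m + n).+1)%N.
Proof.
move=> sP sQ; apply: leq_trans (size_polyMleq _ _) _.
by lia.
Qed.

Lemma size_exp_le P m k : (size P <= m.+1)%N -> (size (P ^+ k)%R <= (k * m).+1)%N.
Proof.
move=> sP; elim: k => [|k IH]; first by rewrite expr0 size_poly1.
by rewrite exprS mulSn size_mul_le.
Qed.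

Lemma coef_mul_top P Q m n : (size P <= m.+1)%N -> (size Q <= n.+1)%N ->
  (P * Q)`_(m + n) = P`_m * Q`_n.
Proof.
move=> sP sQ; have mlt : (m < (m + n).+1)%N by rewrite ltnS leq_addr.
rewrite coefM (bigD1 (Ordinal mlt)) //= addKn big1 ?addr0 // => i ne.
have [lt|le] := ltnP i m.
  by rewrite [Q`__]nth_default ?mulr0 // (leq_trans sQ) //; lia.
have mi : (m < i)%N.
  by rewrite ltn_neqAle le andbT; apply: contra ne => /eqP e; apply/eqP/val_inj.
by rewrite [P`__]nth_default ?mul0r // (leq_trans sP).
Qed.

Lemma coef_exp_top P m k : (size P <= m.+1)%N -> (P ^+ k)`_(k * m) = P`_m ^+ k.
Proof.
move=> sP; elim: k => [|k IH]; first by rewrite !expr0 coef1.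
by rewrite !exprS mulSn coef_mul_top ?IH // size_exp_le.
Qed.

End Degree.

Section ApproximateRoot.
Variable C : numClosedFieldType.
Notation BP := {poly {poly C}}.
Variable a : nat.
Hypothesis a_gt1 : (1 < a)%N.

(** The remaining terms of the binomial expansion contain [S^2]. *)
Lemma pow_add_size (P S : BP) N k : (size P <= N.+1)%N -> (size S <= k.+1)%N -> (k < N)%N ->
  (size ((P + S) ^+ a - P ^+ a - P ^+ a.-1 * S *+ a)%R <= a.-1 * N + k)%N.
Proof.
move=> sP sS kN; case: a a_gt1 => [|[|n]] // _.
have -> : (P + S) ^+ n.+2 - P ^+ n.+2 - P ^+ n.+2.-1 * S *+ n.+2 = \sum_(i < n.+1)
    P ^+ (n.+2 - (1 + (1 + i))) * S ^+ (1 + (1 + i)) *+ 'C(n.+2, 1 + (1 + i)).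
  rewrite exprDn 2!big_ord_recl /= /bump /= bin0 bin1 subn0 subn1 expr0 !expr1 /=.
  by move: (\sum_(i < n.+1) _) => U; ring.
apply: leq_trans (size_sum _ _ _) _; apply/bigmax_leqP => i _.
rewrite -scaler_nat (leq_trans (size_scale_leq _ _)) //.
have h := size_mul_le (size_exp_le (n.+2 - (1 + (1 + i))) sP) (size_exp_le (1 + (1 + i)) sS).
apply: leq_trans h _; have iN : (i <= n)%N by rewrite -ltnS.
move: (nat_of_ord i) iN => j jn; rewrite -{}(subnK kN) -{}(subnK jn) !add1n !subSS.
by rewrite addnK; move: (n - j)%N (N - k.+1)%N => u v; nia.
Qed.
Definition improve (r : {poly C}) E N k (Q T : BP) : BP :=
  (r ^+ (E.+1 * a.-1))%:P * Q + (a%:R^-1 *: T`_(a.-1 * N + k))%:P * 'X^k.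

Lemma coef_improve r E N k Q T j : (improve r E N k Q T)`_j =
  r ^+ (E.+1 * a.-1) * Q`_j + (if j == k then a%:R^-1 *: T`_(a.-1 * N + k) else 0).
Proof. by rewrite coefD !coefCM coefXn; case: eqP; rewrite ?mulr1 ?mulr0. Qed.

(** One Newton step: adding [T_top / (a Q_top^(a-1)) y^k] cancels the leading
    coefficient of [T]. Multiplying by a power of [r] clears this denominator. *)
Lemma approx_step (F Q T : BP) (r : {poly C}) E N k :
  (r ^+ (E * a))%:P * F = Q ^+ a + T -> (size Q <= N.+1)%N -> Q`_N = r ^+ E.+1 ->
  (size T <= (a.-1 * N + k).+1)%N -> (k < N)%N -> exists2 T',
    (r ^+ ((E.+1 * a.-1 + E) * a))%:P * F = improve r E N k Q T ^+ a + T' &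
    (size T' <= a.-1 * N + k)%N.
Proof.
move=> rel sQ QN sT kN; set e := (E.+1 * a.-1)%N.
pose P := (r ^+ e)%:P * Q; pose tau := T`_(a.-1 * N + k).
pose S : BP := (a%:R^-1 *: tau)%:P * 'X^k.
have a0 : a%:R != 0 :> C by rewrite pnatr_eq0 -lt0n ltnW.
have sP : (size P <= N.+1)%N by rewrite -[N]add0n size_mul_le ?size_polyC ?leq_b1.
have sS : (size S <= k.+1)%N by rewrite -[k]add0n size_mul_le ?size_polyC ?leq_b1 ?size_polyXn.
exists ((r ^+ (e * a))%:P * T + P ^+ a - (P + S) ^+ a).
  rewrite -/S -[improve _ _ _ _ _ _]/(P + S) addrC subrK /P exprMn -rmorphXn -exprM /=.
  by rewrite -mulrDr [T + _]addrC -rel mulrA -polyCM -exprD mulnDl.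
have h := pow_add_size sP sS kN.
have -> : (r ^+ (e * a))%:P * T + P ^+ a - (P + S) ^+ a =
  ((r ^+ (e * a))%:P * T - P ^+ a.-1 * S *+ a) -
  ((P + S) ^+ a - P ^+ a - P ^+ a.-1 * S *+ a) by ring.
rewrite (leq_trans (size_polyD _ _)) // geq_max size_polyN h andbT.
set V := _ - _; have sV : (size V <= (a.-1 * N + k).+1)%N.
  rewrite (leq_trans (size_polyD _ _)) // geq_max size_polyN.
  rewrite -{1}[(_ + k)%N]add0n size_mul_le ?size_polyC ?leq_b1 //=.
  by rewrite -scaler_nat (leq_trans (size_scale_leq _ _)) // size_mul_le ?size_exp_le.
suff V0 : V`_(a.-1 * N + k) = 0.
  apply/leq_sizeP => j; rewrite leq_eqVlt => /orP[/eqP <- //|lt].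
  by rewrite nth_default // (leq_trans sV).
rewrite coefB coefMn coefCM coef_mul_top ?size_exp_le // coef_exp_top // !coefCM QN coefXn eqxx mulr1.
rewrite -exprD -exprM -/tau -scalerAr scalerMnl -mulr_natr mulVf // scale1r.
apply/eqP; rewrite subr_eq0; apply/eqP; congr (r ^+ _ * _).
by rewrite mulnDl -/e -mulnSr prednK // ltnW.
Qed.

Lemma approx_down (F : BP) (r : {poly C}) N k0 k (Q T : BP) E : (k0 <= k)%N -> (k <= N)%N ->
  (r ^+ (E * a))%:P * F = Q ^+ a + T -> (size Q <= N.+1)%N -> Q`_N = r ^+ E.+1 ->
  (size T <= a.-1 * N + k)%N -> exists f Q1 T1, [/\
    (r ^+ ((f + E) * a))%:P * F = Q1 ^+ a + T1, (size Q1 <= N.+1)%N, Q1`_N = r ^+ (f + E).+1,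
    (size T1 <= a.-1 * N + k0)%N &
    forall j, (j < k0)%N || (k <= j)%N -> Q1`_j = r ^+ f * Q`_j].
Proof.
move=> k0k; rewrite -(subnK k0k); move: (k - k0)%N => d {k k0k}.
elim: d E Q T => [|d IH] E Q T kN rel sQ QN sT.
  by exists 0%N, Q, T; split=> // j _; rewrite mul1r.
rewrite addSn in kN sT; rewrite addnS in sT.
have [T' rel' sT'] := approx_step rel sQ QN sT kN.
set Q' := improve _ _ _ _ _ _ in rel'; set e := (E.+1 * a.-1)%N in rel'.
have sQ' : (size Q' <= N.+1)%N.
  rewrite (leq_trans (size_polyD _ _)) // geq_max.
  rewrite -{1}[N]add0n size_mul_le ?size_polyC ?leq_b1 //=.
  rewrite (leq_trans (n := (0 + (d + k0)).+1)) ?size_mul_le ?size_polyC ?leq_b1 ?size_polyXn //.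
  by rewrite ltnW.
have QN' : Q'`_N = r ^+ (e + E).+1.
  by rewrite coef_improve gtn_eqF // addr0 QN -exprD addnS.
have [f [Q1 [T1 [r1 r2 r3 r4 r5]]]] := IH _ _ _ (ltnW kN) rel' sQ' QN' sT'.
exists (f + e)%N, Q1, T1; rewrite -(addnA f e E); split=> // j hj.
rewrite r5; last by case/orP: hj => [->//|h]; rewrite (ltnW h) orbT.
rewrite coef_improve -/e [r ^+ (f + e)]exprD; case: eqP => [ej|_]; last by rewrite addr0 mulrA.
by move: hj; rewrite ej ltnNge leq_addl /= addSn ltnn.
Qed.

(** Only the first Newton step touches the coefficient of degree [i]. *)
Lemma approx_root (F Q T : BP) (r : {poly C}) N k0 i : F = Q ^+ a + T ->
  (size Q <= N.+1)%N -> Q`_N = r -> (size T <= (a.-1 * N + i).+1)%N -> (k0 <= i < N)%N ->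
  exists f Q1 T1, [/\
    ((r ^+ (f + a.-1)) ^+ a)%:P * F = Q1 ^+ a + T1, (size Q1 <= N.+1)%N,
    Q1`_N = r ^+ (f + a.-1) * r, (size T1 <= a.-1 * N + k0)%N &
    (forall j, (j < k0)%N -> Q1`_j = r ^+ (f + a.-1) * Q`_j) /\
    Q1`_i = r ^+ f * (r ^+ a.-1 * Q`_i + a%:R^-1 *: T`_(a.-1 * N + i))].
Proof.
move=> rel sQ QN sT /andP[k0i iN].
have rel0 : (r ^+ (0 * a))%:P * F = Q ^+ a + T by rewrite expr0 mul1r.
have [T' rel' sT'] := approx_step rel0 sQ QN sT iN.
set Q' := improve _ _ _ _ _ _ in rel'; rewrite mul1n addn0 in rel'.
have sQ' : (size Q' <= N.+1)%N.
  rewrite (leq_trans (size_polyD _ _)) // geq_max.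
  rewrite -{1}[N]add0n size_mul_le ?size_polyC ?leq_b1 //=.
  rewrite (leq_trans (n := (0 + i).+1)) ?size_mul_le ?size_polyC ?leq_b1 ?size_polyXn //.
  by rewrite ltnW.
have QN' : Q'`_N = r ^+ (a.-1).+1.
  by rewrite coef_improve gtn_eqF // addr0 QN mul1n exprSr.
have [f [Q1 [T1 [r1 r2 r3 r4 r5]]]] := approx_down k0i (ltnW iN) rel' sQ' QN' sT'.
exists f, Q1, T1; split=> //; first by rewrite -exprM.
  by rewrite r3 exprSr.
split=> [j jk|].
  rewrite r5 ?jk // coef_improve mul1n ltn_eqF ?addr0 ?mulrA -?exprD //.
  exact: leq_trans jk k0i.
by rewrite r5 ?leqnn ?orbT // coef_improve eqxx mul1n.
Qed.

End ApproximateRoot.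

(** * Shifting x, and the bracket *)

Section Shift.
Variable C : numClosedFieldType.
Notation BP := {poly {poly C}}.
Implicit Types (P Q F G W : BP) (f g : {poly C}).

Definition deriv_x P : BP := map_poly (@deriv C) P.
Definition jac F G : BP := deriv_x F * G^`() - F^`() * deriv_x G.
(** The coordinate [s = x - x0], which moves a root [x0] to the origin. *)
Definition shift_x (x : C) P : BP := map_poly (comp_poly ('X + x%:P)) P.
Definition cst (c : C) : BP := (c%:P)%:P.
Definition ev (f : {poly C}) W : BP := (map_poly cst f).[W].

HB.instance Definition _ x := GRing.RMorphism.copy (shift_x x) (map_poly (comp_poly ('X + x%:P))).
HB.instance Definition _ := GRing.RMorphism.copy cst (polyC \o polyC).

Lemma coef_shift_x x P j : (shift_x x P)`_j = P`_j \Po ('X + x%:P).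
Proof. by rewrite coef_map. Qed.

Lemma coef_deriv_x P j : (deriv_x P)`_j = (P`_j)^`().
Proof. by rewrite coef_map_id0 ?deriv0. Qed.

Lemma shift_x_eq0 x (p : {poly C}) : (p \Po ('X + x%:P) == 0) = (p == 0).
Proof. by rewrite comp_poly2_eq0 ?size_XaddC. Qed.

Lemma size_shift_x x P : size (shift_x x P) = size P.
Proof.
apply: size_map_inj_poly; last by rewrite comp_poly0.
move=> p q e; apply/eqP; rewrite -subr_eq0 -(shift_x_eq0 x) rmorphB /= e subrr //.
Qed.

Lemma mup_shift_x x P j : P`_j != 0 -> mup 0 (shift_x x P)`_j = mup x P`_j.
Proof. by move=> nz; rewrite coef_shift_x mup_shift. Qed.

Lemma shift_xC x (c : {poly C}) : shift_x x c%:P = (c \Po ('X + x%:P))%:P.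
Proof. by rewrite /shift_x map_polyC. Qed.

Lemma shift_x_cst x c : shift_x x (cst c) = cst c.
Proof. by rewrite shift_xC comp_polyC. Qed.

Lemma sd_deriv_x P : sd P = 'X%:P * deriv_x P.
Proof. by apply/polyP => j; rewrite coef_sd coefCM coef_deriv_x. Qed.

(** [s d/ds] differs from [d/dx] by the factor [s]. *)
Lemma Jf_shift_x x F G (c : C) : jac F G = cst c -> Jf 0 0 (shift_x x F) (shift_x x G) = (c *: 'X)%:P.
Proof.
have dsh P : deriv_x (shift_x x P) = shift_x x (deriv_x P).
  apply/polyP => j; rewrite coef_deriv_x !coef_shift_x deriv_comp coef_deriv_x derivD derivX derivC.
  by rewrite addr0 mulr1.
have ysh P : (shift_x x P)^`() = shift_x x P^`() by rewrite /shift_x deriv_map.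
move=> J; rewrite /Jf !mulr0n !subr0 !sd_deriv_x !dsh !ysh.
have -> : 'X%:P * shift_x x (deriv_x F) * shift_x x G^`() - shift_x x F^`() * ('X%:P * shift_x x (deriv_x G)) =
  'X%:P * shift_x x (jac F G) by rewrite rmorphB !rmorphM /=; ring.
by rewrite J shift_x_cst -polyCM mulrC mul_polyC.
Qed.

Lemma shift_x_ev x f W : shift_x x (ev f W) = ev f (shift_x x W).
Proof.
rewrite /ev -horner_map -map_poly_comp; congr (_.[_]).
by apply: eq_map_poly => c /=; rewrite shift_x_cst.
Qed.

Lemma ev_homog_ev a delta f W : (size f <= (a * delta).+1)%N -> ev f W = homog_ev a delta f 0 W.
Proof.
move=> sf; rewrite /ev (horner_coef_wide _ (n := (a * delta).+1)) ?(leq_trans (size_poly _ _)) //.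
apply: eq_bigr => j _; rewrite coef_map_id0 ?rmorph0 // expr0.
by rewrite /cst alg_polyC.
Qed.

Lemma ev_poly N (e : nat -> C) W : ev (\poly_(j < N) e j) W = \sum_(j < N) cst (e j) * W ^+ j.
Proof.
rewrite /ev (horner_coef_wide _ (n := N)); last first.
  by rewrite (leq_trans (size_poly _ _)) // size_poly.
by apply: eq_bigr => j _; rewrite coef_map_id0 ?rmorph0 // coef_poly ltn_ord.
Qed.

Lemma evD f g W : ev (f + g) W = ev f W + ev g W.
Proof. by rewrite /ev rmorphD /= hornerD. Qed.

Lemma evX f n W : ev (f ^+ n) W = ev f W ^+ n.
Proof. by rewrite /ev rmorphXn /= horner_exp. Qed.

Lemma size_ev f W q d : (size W <= q.+1)%N -> (size f <= d.+1)%N -> (size (ev f W) <= (d * q).+1)%N.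
Proof.
move=> sW sf; rewrite /ev (horner_coef_wide _ (n := d.+1)) ?(leq_trans (size_poly _ _)) //.
apply: leq_trans (size_sum _ _ _) _; apply/bigmax_leqP => j _.
apply: leq_trans (size_mul_le (m := 0) (n := j * q) _ (size_exp_le j sW)) _.
  by rewrite coef_map_id0 ?rmorph0 // size_polyC leq_b1.
by rewrite ltnS add0n leq_mul2r -ltnS ltn_ord orbT.
Qed.

Lemma ev_top f W q d : (0 < q)%N -> (size W <= q.+1)%N -> (size f <= d.+1)%N -> f`_d = 1 ->
  (ev f W)`_(d * q) = W`_q ^+ d.
Proof.
move=> q0 sW sf fd; rewrite /ev (horner_coef_wide _ (n := d.+1)) ?(leq_trans (size_poly _ _)) //.
rewrite big_ord_recr /= coefD coef_map_id0 ?rmorph0 // fd /cst !polyC1 mul1r.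
rewrite coef_exp_top // nth_default ?add0r //.
case: d sf fd => [|d] sf fd; first by rewrite big_ord0 size_poly0.
apply: leq_trans (size_sum _ _ _) _; apply/bigmax_leqP => j _.
apply: leq_trans (size_mul_le (m := 0) (n := j * q) _ (size_exp_le j sW)) _.
  by rewrite coef_map_id0 ?rmorph0 // size_polyC leq_b1.
by rewrite add0n ltn_mul2r q0 ltn_ord.
Qed.

(** The coefficient of highest degree in [y] of the bracket is
    [b k F_top' G_top - a k F_top G_top'], and the bracket is constant. *)
Lemma jac_top (a b k : nat) F G (c : C) : (0 < a)%N -> (0 < b)%N -> (0 < k)%N ->
  jac F G = cst c -> size F = (a * k).+1 -> size G = (b * k).+1 ->
  forall x, (a * mup x G`_(b * k) = b * mup x F`_(a * k))%N.
Proof.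
move=> a0 b0 k0 J sF sG.
have Fn := coef_top sF; have Gn := coef_top sG.
apply: wronskian_mup => //.
have n0 : (0 < a * k)%N by rewrite muln_gt0 a0.
have t0 : (0 < b * k)%N by rewrite muln_gt0 b0.
have sdx P n : (size P <= n)%N -> (size (deriv_x P) <= n)%N.
  by move=> h; apply: leq_trans (size_poly _ _) h.
have sder P n : (size P <= n.+2)%N -> (size P^`() <= n.+1)%N.
  by move=> h; apply/leq_sizeP => j nj; rewrite coef_deriv nth_default ?mul0rn // (leq_trans h).
have [n en] : exists n, (a * k = n.+1)%N by exists (a * k).-1; rewrite prednK.
have [t et] : exists t, (b * k = t.+1)%N by exists (b * k).-1; rewrite prednK.
have e1 := coef_mul_top (P := deriv_x F) (Q := G^`()) (m := n.+1) (n := t).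
rewrite sdx ?sF ?en // sder ?sG ?et // in e1.
have e2 := coef_mul_top (P := F^`()) (Q := deriv_x G) (m := n) (n := t.+1).
rewrite sdx ?sG ?et // sder ?sF ?en // in e2.
have := congr1 (fun P : BP => P`_(n + t.+1)) J.
rewrite /jac coefB e2 // -addSnnS e1 // coefC /= !coef_deriv_x !coef_deriv -et -en.
move=> /eqP; rewrite subr_eq0 => /eqP e.
apply: (mulIf (x := (k%:R : C)%:P)); first by rewrite polyC_eq0 pnatr_eq0 -lt0n.
have kE (p : {poly C}) m : p *+ (m * k) = p *+ m * (k%:R)%:P.
  by rewrite polyC_natr mulr_natr mulrnA.
by rewrite -!kE -mulrnAl -e mulrnAr.
Qed.

End Shift.

(** * The degree of the top coefficient *)

Section OneDirection.
Variable C : numClosedFieldType.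
Notation BP := {poly {poly C}}.

Lemma mup_add_dvd (x : C) k (u z : {poly C}) : z != 0 -> (mup x z < k)%N ->
  (('X - x%:P) ^+ k %| u)%R -> u + z != 0 /\ mup x (u + z) = mup x z.
Proof.
move=> z0 zk ku.
have d1 n : (n <= k)%N -> (('X - x%:P) ^+ n %| u + z) = (('X - x%:P) ^+ n %| z).
  by move=> nk; apply: dvdp_addr; apply: dvdp_trans ku; apply: dvdp_exp2l.
have e1 : ('X - x%:P) ^+ (mup x z) %| z by rewrite -mup_geq.
have e2 : ~~ (('X - x%:P) ^+ (mup x z).+1 %| z) by rewrite -mup_leq.
have nz : u + z != 0 by apply: contraNneq e2 => e; rewrite -d1 // e dvdp0.
split=> //; apply/eqP; rewrite eqn_leq mup_leq // mup_geq // !d1 ?e1 ?e2 //.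
exact: ltnW.
Qed.

Lemma deg_of_mup (e : nat) (r z : {poly C}) : r != 0 -> z != 0 ->
  (forall x, (e * mup x r <= mup x z)%N) -> (e * (size r).-1 <= (size z).-1)%N.
Proof.
move=> r0 z0 H; have [s [us _ <-]] := sum_mup_roots r0.
rewrite big_distrr /=; apply: leq_trans (sum_mup_le z0 us).
by apply: leq_sum => x _; apply: H.
Qed.

Lemma tlevE D mu q : tlev D mu q = - (mu - q)%:R / (D%:R * q%:R - 1).
Proof.
rewrite /tlev; case: leqP => [le|lt]; first by rewrite (eqP le) mulr0n oppr0 mul0r.
by rewrite natrB // ltnW.
Qed.

Lemma tlev_scale k d mu q : (0 < d)%N -> tlev k (d * mu) (d * q) = d%:R * tlev (k * d) mu q.
Proof.
by move=> d0; rewrite !tlevE -mulnBr !natrM !mulNr mulrN !mulrA.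
Qed.

(** Truncated subtraction is superadditive. *)
Lemma sum_excess (I : Type) (s : seq I) (f : I -> nat) q :
  (\sum_(x <- s) (f x - q) <= \sum_(x <- s) f x - q)%N.
Proof.
elim: s => [|x s IH]; first by rewrite !big_nil.
by rewrite !big_cons; move: (\sum_(y <- s) (f y - q))%N (\sum_(y <- s) f y)%N IH; lia.
Qed.

Variables (a b delta p q : nat).
Hypotheses (a_gt1 : (1 < a)%N) (b_gt0 : (0 < b)%N) (cop : coprime a b)
  (delta_gt0 : (0 < delta)%N) (q_gt0 : (0 < q)%N).
Notation A := (a * delta)%N.
Notation B := (b * delta)%N.
Notation D := ((a + b) * delta)%N.
Notation N := (delta * q)%N.

Variables (beta es : {poly C}) (F G W Z : BP) (c : C) (l : nat).
Notation Q := (ev beta W).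
Notation w := (W`_q).
Hypotheses (beta_size : size beta = delta.+1) (beta_lead : beta`_delta = 1)
  (es_size : (size es <= a.-1 * delta)%N)
  (W_size : size W = q.+1) (w_size : size w = p.+1)
  (relF : F = Q ^+ a + ev es W + Z)
  (corner : forall j i, (a.-1 * N <= j)%N -> (a.-1 * (delta * p) <= i)%N ->
     (F - Q ^+ a)`_j`_i = 0)
  (F_size : size F = (a * N).+1) (G_size : size G = (b * N).+1)
  (J : jac F G = cst c) (Z_size : size Z = l.+1).
Notation r := (w ^+ delta).
Notation zeta := (Z`_l).

Lemma N_gt0 : (0 < N)%N. Proof. by rewrite muln_gt0 delta_gt0. Qed.

Lemma Q_size : (size Q <= N.+1)%N.
Proof. by apply: size_ev; rewrite ?W_size ?beta_size. Qed.

Lemma Q_top : Q`_N = r.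
Proof. by apply: ev_top; rewrite ?W_size ?beta_size. Qed.

Lemma w_neq0 : w != 0. Proof. by rewrite -size_poly_gt0 w_size. Qed.

Lemma r_size : (size r).-1 = (delta * p)%N.
Proof. by rewrite size_exp w_size mulnC. Qed.

(** The corner condition only says that the difference [V] from [r^a] has
    small degree. By [jac_top] the left side is an [a]-th power, and then
    [pow_perturb] leaves no room for [V]. *)
Lemma F_top : F`_(a * N) = r ^+ a.
Proof.
set V := (F - Q ^+ a)`_(a * N).
have FV : F`_(a * N) = r ^+ a + V.
  by rewrite /V coefB (coef_exp_top _ Q_size) Q_top addrC subrK.
have [V0|V0] := eqVneq V 0; first by rewrite FV V0 addr0.
have sV : (size V <= a.-1 * (delta * p))%N.
  apply/leq_sizeP => i hi; apply: corner => //.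
  by rewrite leq_mul2r leq_pred orbT.
have Fn := coef_top F_size.
have [|h hE] := @pow_of_mup C a F`_(a * N) (ltnW a_gt1) Fn.
  move=> x; have e := jac_top (ltnW a_gt1) b_gt0 N_gt0 J F_size G_size x.
  by rewrite -(Gauss_dvdr _ cop) -e dvdn_mulr.
have r0 : r != 0 := expf_neq0 _ w_neq0.
have sV0 : (0 < size V)%N by rewrite size_poly_gt0.
have lt : ((size V).-1 < a * (size r).-1)%N.
  rewrite r_size prednK //; apply: leq_trans sV _.
  by rewrite leq_mul2r leq_pred orbT.
have [d [_ _ e]] := pow_perturb (ltnW a_gt1) r0 V0 lt (etrans (esym hE) FV).
by move: sV; rewrite -(prednK sV0) e r_size ltnNge leq_addl.
Qed.

Lemma G_mup x : mup x G`_(b * N) = (B * mup x w)%N.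
Proof.
have := jac_top (ltnW a_gt1) b_gt0 N_gt0 J F_size G_size x.
rewrite F_top mupX ?expf_neq0 ?w_neq0 // mupX ?w_neq0 // => e.
by apply/eqP; rewrite -(eqn_pmul2l (ltnW a_gt1)) e; apply/eqP; ring.
Qed.

Lemma es_ev_size : (size (ev es W) <= a.-1 * N)%N.
Proof.
have [->|es0] := eqVneq es 0; first by rewrite /ev rmorph0 horner0 size_poly0.
have s0 : (0 < size es)%N by rewrite size_poly_gt0.
have h := @size_ev C es W q (size es).-1; rewrite W_size prednK // in h.
apply: leq_trans (h (leqnn _) (leqnn _)) _.
rewrite mulnA; apply: leq_trans (_ : size es * q <= _)%N; last by rewrite leq_mul2r es_size orbT.
by rewrite ltn_mul2r q_gt0 prednK /=.
Qed.

Notation T := (F - Q ^+ a).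

Lemma T_eq : T = ev es W + Z.
Proof. by rewrite relF; ring. Qed.

Lemma l_lt : (l < a * N)%N.
Proof.
have sT : (size T <= a * N)%N.
  have s1 : (size T <= (a * N).+1)%N.
    rewrite (leq_trans (size_polyD _ _)) // geq_max F_size leqnn size_polyN.
    by rewrite size_exp_le ?Q_size.
  apply/leq_sizeP => j; rewrite leq_eqVlt => /orP[/eqP <-|lt].
    by rewrite coefB F_top (coef_exp_top _ Q_size) Q_top subrr.
  by rewrite nth_default // (leq_trans s1).
have ZE : Z = T - ev es W by rewrite T_eq addrC addKr.
rewrite -Z_size ZE (leq_trans (size_polyD _ _)) // geq_max sT size_polyN.
by rewrite (leq_trans es_ev_size) // leq_mul2r leq_pred orbT.
Qed.

Lemma zeta_neq0 : zeta != 0. Proof. exact: coef_top. Qed.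

(** Otherwise [r^(a-1)] would divide [zeta], whose top monomial would lie in
    the corner. *)
Lemma zeta_small : (a.-1 * N <= l)%N -> ~ (forall x, (a.-1 * mup x r <= mup x zeta)%N).
Proof.
move=> Nl H; have := deg_of_mup (expf_neq0 _ w_neq0) zeta_neq0 H; rewrite r_size => le.
have := corner Nl le; rewrite T_eq coefD [(ev _ _)`_l]nth_default ?add0r; last exact: leq_trans es_ev_size Nl.
by apply/eqP; rewrite -lead_coefE lead_coef_eq0 zeta_neq0.
Qed.

(** The approximate root has the coefficient
    [r^(a-1) Q_i + zeta / a] over [r^(a-1)] in degree [i]: if [zeta] has too low
    an order, so does this coefficient, and [local_walk] applies. *)
Lemma root_bound_high k0 i x : l = (a.-1 * N + i)%N -> (k0 <= 1)%N -> (k0 <= i)%N ->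
  (i <= k0 * i)%N ->
  a.-1%:R * (mup x r)%:R + (if k0 == 0%N then tlev (a + b) (mup x r) N else 0)
   <= (mup x zeta)%:R.
Proof.
move=> li k01 k0i ik0; rewrite leNgt; apply/negP => lt.
have iN : (i < N)%N.
  have := l_lt; rewrite li -[in (a * N)%N](prednK (ltnW a_gt1)) mulSnr ltn_add2l.
  exact.
have r0 : r != 0 := expf_neq0 _ w_neq0.
(* for [k0 = 1], drop the constant coefficient of [Q] *)
pose cc : {poly C} := if k0 == 0%N then 0 else Q`_0.
pose Q0 : BP := Q - cc%:P; pose T0 := F - Q0 ^+ a.
have sQ0 : (size Q0 <= N.+1)%N.
  rewrite (leq_trans (size_polyD _ _)) // geq_max Q_size size_polyN size_polyC.
  by rewrite (leq_trans (leq_b1 _)).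
have Q0N : Q0`_N = r by rewrite coefB Q_top coefC gtn_eqF ?N_gt0 // subr0.
have T0E : T0 = (ev es W + (Q ^+ a - Q0 ^+ a)) + Z.
  by rewrite /T0 -[Z](addKr (ev es W)) -T_eq; ring.
have small : (size (ev es W + (Q ^+ a - Q0 ^+ a))%R <= a.-1 * N + i)%N.
  rewrite (leq_trans (size_polyD _ _)) // geq_max (leq_trans es_ev_size) ?leq_addr //=.
  have -> : Q = Q0 + cc%:P by rewrite subrK.
  case: (posnP k0) => [k00|k0p].
    by rewrite /cc k00 eqxx polyC0 addr0 subrr size_poly0.
  have s0 : (size (cc%:P : BP) <= 1)%N by rewrite size_polyC leq_b1.
  have h := pow_add_size a_gt1 sQ0 s0 N_gt0; rewrite addn0 in h.
  have -> : (Q0 + cc%:P) ^+ a - Q0 ^+ a = ((Q0 + cc%:P) ^+ a - Q0 ^+ a - Q0 ^+ a.-1 * cc%:P *+ a)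
     + Q0 ^+ a.-1 * cc%:P *+ a by rewrite [RHS]subrK.
  rewrite (leq_trans (size_polyD _ _)) // geq_max (leq_trans h) ?leq_addr //=.
  rewrite -scaler_nat (leq_trans (size_scale_leq _ _)) //.
  apply: leq_trans (size_mul_le (n := 0) (size_exp_le a.-1 sQ0) s0) _.
  by rewrite addn0 -addn1 leq_add2l (leq_trans k0p).
have sT0 : (size T0 <= (a.-1 * N + i).+1)%N.
  rewrite T0E (leq_trans (size_polyD _ _)) // geq_max (leq_trans small) ?leqnSn //=.
  by rewrite Z_size li.
have T0i : T0`_(a.-1 * N + i) = zeta by rewrite T0E coefD nth_default // add0r li.
have rel0 : F = Q0 ^+ a + T0 by rewrite /T0 addrC subrK.
have [f [Q1 [T1 [rel1 sQ1 Q1N sT1 [Q1low Q1i]]]]] :=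
  approx_root a_gt1 rel0 sQ0 Q0N sT0 (introT andP (conj k0i iN)).
rewrite T0i in Q1i; set g := r ^+ (f + a.-1) in rel1 Q1N Q1low.
have g0 : g != 0 by apply: expf_neq0.
have mg : mup x g = ((f + a.-1) * mup x r)%N by rewrite mupX.
have thr0 : (if k0 == 0%N then tlev (a + b) (mup x r) N else 0) <= 0.
  case: eqP => // _; apply: tlev_le0.
  by rewrite (leq_trans a_gt1) // (leq_trans (leq_addr b a)) // leq_pmulr // N_gt0.
have mz : (mup x zeta < a.-1 * mup x r)%N.
  by rewrite -(ltr_nat rat) natrM (lt_le_trans lt) // gerDl.
have an0 : a%:R^-1 != 0 :> C by rewrite invr_eq0 pnatr_eq0 -lt0n ltnW.
have [] := @mup_add_dvd x (a.-1 * mup x r) (r ^+ a.-1 * Q0`_i) (a%:R^-1 *: zeta).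
- by rewrite scaler_eq0 negb_or an0 zeta_neq0.
- by rewrite mupZ.
- apply: dvdp_mulr; rewrite mulnC exprM dvdp_exp2r // -mup_geq //.
rewrite mupZ // => nz mi.
have Q1i0 : Q1`_i != 0 by rewrite Q1i; apply: mulf_neq0; [exact: expf_neq0|exact: nz].
have mQ1i : mup x Q1`_i = (f * mup x r + mup x zeta)%N.
  by rewrite Q1i mupM ?(expf_neq0 _ r0) // mi (mupX _ _ r0).
have Q1N0 : Q1`_N != 0 by rewrite Q1N mulf_neq0.
have sQ1' : size Q1 = N.+1.
  apply/eqP; rewrite eqn_leq sQ1 ltnNge; apply: contra Q1N0 => le.
  by rewrite nth_default.
have gs0 : g \Po ('X + x%:P) != 0 by rewrite shift_x_eq0.
have mgs : mup 0 (g \Po ('X + x%:P)) = mup x g by rewrite mup_shift.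
have srel : ((g \Po ('X + x%:P)) ^+ a)%:P * shift_x x F = shift_x x Q1 ^+ a + shift_x x T1.
  by rewrite -rmorphXn /= -shift_xC -rmorphM /= rel1 rmorphD rmorphXn.
have sm1 : mup 0 (shift_x x Q1)`_N = (mup 0 (g \Po ('X + x%:P)) + mup x r)%N.
  by rewrite mup_shift_x // Q1N mupM // mgs.
have sm2 : mup 0 (shift_x x G)`_(b * N) = (b * mup x r)%N.
  by rewrite mup_shift_x ?coef_top // G_mup mupX ?w_neq0 //; ring.
have si : (shift_x x Q1)`_i != 0 by rewrite coef_shift_x shift_x_eq0.
have s0 : k0 = 1%N -> (shift_x x Q1)`_0 = 0.
  by move=> k1; rewrite coef_shift_x Q1low ?k1 // /Q0 coefB coefC /= /cc k1 /= subrr mulr0 comp_poly0.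
apply: (local_walk a_gt1 b_gt0 cop gs0 srel (Jf_shift_x x J) N_gt0 _ _ _ _ sm1 sm2 k01 k0i si s0).
- by rewrite size_shift_x.
- by rewrite size_shift_x.
- by rewrite size_shift_x F_size.
- by rewrite size_shift_x.
rewrite mup_shift_x // mgs mg mQ1i; move: lt; rewrite !(natrD, natrM) /=; lra.
Qed.

Lemma l_le : (l <= a.-1 * N)%N.
Proof.
rewrite leqNgt; apply/negP => lt; have li := esym (subnKC (ltnW lt)).
apply: (zeta_small (ltnW lt)) => x.
have := @root_bound_high 1 (l - a.-1 * N) x li isT; rewrite subn_gt0 mul1n => /(_ lt (leqnn _)) /=.
by rewrite addr0 -natrM ler_nat.
Qed.

Lemma mup_w_le x : (mup x w <= p)%N.
Proof. by have := sum_mup_le w_neq0 (isT : uniq [:: x]); rewrite big_seq1 w_size. Qed.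

(** For [p <= q] all levels vanish, so that [root_bound_high] contradicts
    [zeta_small] even for [i = 0]. *)
Lemma l_strict : (p <= q)%N -> (l < a.-1 * N)%N.
Proof.
move=> pq; rewrite ltn_neqAle l_le andbT; apply/eqP => li.
apply: (zeta_small (eq_leq (esym li))) => x.
have := @root_bound_high 0 0 x (etrans li (esym (addn0 _))) isT isT isT.
rewrite /= /tlev mupX ?w_neq0 // leq_mul2l (leq_trans (mup_w_le x) pq) orbT addr0.
by rewrite -natrM ler_nat.
Qed.

(** The two regimes meet: at [l = (a - 1) N] the bound is the one of
    [root_bound_high], below that it is [local_bound]. *)
Lemma root_bound x : l%:R * (mup x w)%:R + ((A * q)%:R - l%:R) * tlev D (mup x w) q
  <= q%:R * (mup x zeta)%:R.
Proof.
have [li|lt] := eqVneq l (a.-1 * N)%N.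
  have := @root_bound_high 0 0 x (etrans li (esym (addn0 _))) isT isT isT.
  rewrite /= mupX ?w_neq0 // tlev_scale // => h.
  have : q%:R * (a.-1%:R * (delta * mup x w)%:R + delta%:R * tlev D (mup x w) q) <=
    q%:R * (mup x zeta)%:R by rewrite ler_pM2l // ltr0n.
  apply: le_trans; rewrite li -[in (A * q)%N](prednK (ltnW a_gt1)) mulSn !(natrD, natrM).
  by rewrite le_eqVlt; apply/orP; left; apply/eqP; ring.
have {}lt : (l < a.-1 * delta * q)%N by rewrite -mulnA ltn_neqAle lt l_le.
pose phi := beta ^+ a + es.
have esA : (size es <= A)%N by rewrite (leq_trans es_size) // leq_mul2r leq_pred orbT.
have bs : (size (beta ^+ a) <= A.+1)%N by rewrite size_exp_le ?beta_size.
have phi_lead : phi`_A = 1.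
  by rewrite coefD coef_exp_top ?beta_size // beta_lead expr1n nth_default ?addr0.
have phi_s : (size phi <= A.+1)%N.
  by rewrite (leq_trans (size_polyD _ _)) // geq_max bs (leq_trans esA).
have rel : shift_x x F = homog_ev a delta phi 0 (shift_x x W) + shift_x x Z.
  have -> : F = ev phi W + Z by rewrite /phi evD evX.
  by rewrite rmorphD /= shift_x_ev (ev_homog_ev _ phi_s).
have mG : mup 0 (shift_x x G)`_(B * q) = (B * mup 0 (shift_x x W)`_q)%N.
  by rewrite !mup_shift_x ?w_neq0 // -mulnA ?G_mup ?coef_top.
have := local_bound a_gt1 b_gt0 cop delta_gt0 phi_lead rel (Jf_shift_x x J) q_gt0 _ _ lt _ _ mG.
rewrite !size_shift_x -!mulnA !mup_shift_x ?w_neq0 ?zeta_neq0 // F_size; exact.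
Qed.

(** The sum of [root_bound] over the roots of [w]. *)
Lemma zeta_degree : l%:R * p%:R - ((A * q)%:R - l%:R) * ((p - q)%:R / (D%:R * q%:R - 1))
  <= q%:R * (size zeta).-1%:R :> rat.
Proof.
have [s [us _ sm]] := sum_mup_roots w_neq0; rewrite w_size /= in sm.
have Dq : 0 < D%:R * q%:R - 1 :> rat.
  rewrite subr_gt0 -natrM ltr1n (leq_trans a_gt1) // (leq_trans (leq_addr b a)) //.
  by rewrite -mulnA leq_pmulr // N_gt0.
have Al : 0 <= (A * q)%:R - l%:R :> rat.
  by rewrite subr_ge0 ler_nat -mulnA ltnW ?l_lt.
have h1 : \sum_(x <- s) (l%:R * (mup x w)%:R + ((A * q)%:R - l%:R) * tlev D (mup x w) q) <=
    \sum_(x <- s) q%:R * (mup x zeta)%:R :> rat.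
  by apply: ler_sum => x _; apply: root_bound.
apply: le_trans (le_trans h1 _); last first.
  rewrite -mulr_sumr -natr_sum ler_wpM2l ?ler0n // ler_nat.
  exact: sum_mup_le zeta_neq0 us.
rewrite big_split /= -!mulr_sumr -natr_sum sm lerD2l -mulrN; apply: ler_wpM2l => //.
rewrite (eq_bigr _ (fun x _ => tlevE D (mup x w) q)) -mulr_suml sumrN mulNr lerN2.
rewrite -natr_sum ler_pM2r ?invr_gt0 // ler_nat -sm; exact: sum_excess.
Qed.

End OneDirection.

(** * Comparing the two variables *)

Section TwoDirections.
Variable C : numClosedFieldType.
Notation BP := {poly {poly C}}.
Implicit Types P : BP.

Definition boxed m n P := P`_n`_m != 0 /\
  forall j i, P`_j`_i != 0 -> (j <= n)%N /\ (i <= m)%N.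

Lemma boxed_size m n P : boxed m n P -> size P = n.+1 /\ size P`_n = m.+1.
Proof.
move=> [top sup]; have n0 : P`_n != 0 by apply: contraNneq top => ->; rewrite coef0.
split; apply/eqP; rewrite eqn_leq; apply/andP; split.
- apply/leq_sizeP => j nj; apply/polyP => i; rewrite coef0; apply/eqP.
  by apply: contraTT nj => /sup[jn _]; rewrite -leqNgt.
- by rewrite ltnNge; apply: contra n0 => le; rewrite nth_default.
- apply/leq_sizeP => i mi; apply/eqP; apply: contraTT mi => /sup[_ im].
  by rewrite -leqNgt.
- by rewrite ltnNge; apply: contra top => le; rewrite nth_default.
Qed.

Lemma boxed_swap m n P : boxed m n P -> boxed n m (swapXY P).
Proof.
move=> [top sup]; split; first by rewrite coef_swapXY.
by move=> j i; rewrite coef_swapXY => /sup[].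
Qed.

Lemma swapM (P Q : BP) : swapXY (P * Q) = swapXY P * swapXY Q.
Proof. exact: rmorphM. Qed.

Lemma swapB (P Q : BP) : swapXY (P - Q) = swapXY P - swapXY Q.
Proof. exact: raddfB. Qed.

Lemma swapD (P Q : BP) : swapXY (P + Q) = swapXY P + swapXY Q.
Proof. exact: raddfD. Qed.

Lemma swapX (P : BP) k : swapXY (P ^+ k) = swapXY P ^+ k.
Proof. exact: rmorphXn. Qed.

Lemma boxed_subX (a m n : nat) (P Q : BP) j i : boxed (a * m) (a * n) P -> boxed m n Q ->
  (P - Q ^+ a)`_j`_i != 0 -> (j <= a * n)%N /\ (i <= a * m)%N.
Proof.
have bound (k l s t : nat) (U V : BP) : boxed (a * k) (a * l) U -> boxed k l V ->
    (U - V ^+ a)`_s`_t != 0 -> (s <= a * l)%N.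
  move=> /boxed_size[sU _] /boxed_size[sV _]; apply: size_coef_lt.
  by rewrite (leq_trans (size_polyD _ _)) // geq_max sU leqnn size_polyN size_exp_le ?sV.
move=> bP bQ nz; split; first exact: bound bP bQ nz.
apply: (bound _ _ i j _ _ (boxed_swap bP) (boxed_swap bQ)).
by rewrite -swapX -swapB coef_swapXY.
Qed.

Lemma swap_ev f (W : BP) : swapXY (ev f W) = ev f (swapXY W).
Proof.
rewrite /ev -horner_map -map_poly_comp; congr (_.[_]).
by apply: eq_map_poly => e /=; rewrite /cst swapXY_polyC map_polyC.
Qed.

(** Exchanging the variables changes the sign of the bracket. *)
Lemma jac_swap (F G : BP) (c : C) : jac F G = cst c ->
  jac (swapXY F) (swapXY G) = cst (- c).
Proof.
have dxs P : deriv_x (swapXY P) = swapXY P^`().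
  apply/polyP => j; apply/polyP => i.
  by rewrite coef_deriv_x coef_deriv !coef_swapXY coef_deriv coefMn.
have dys P : (swapXY P)^`() = swapXY (deriv_x P).
  apply/polyP => j; apply/polyP => i.
  by rewrite coef_deriv coefMn !coef_swapXY coef_deriv_x coef_deriv.
move=> J; have -> : jac (swapXY F) (swapXY G) = - swapXY (jac F G).
  by rewrite /jac !dxs !dys swapB !swapM opprB.
by rewrite J /cst swapXY_polyC map_polyC !rmorphN.
Qed.

(** Degrees are multiplied by [delta] under [beta]. *)
Lemma ev_shape delta (beta : {poly C}) W m n : size beta = delta.+1 -> beta`_delta = 1 ->
  (0 < n)%N -> size (ev beta W) = n.+1 -> size (ev beta W)`_n = m.+1 ->
  exists p q, [/\ (delta * p = m)%N, (delta * q = n)%N, size W = q.+1 & size W`_q = p.+1].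
Proof.
move=> sb lb n0 sn sm.
have nonconst : (1 < size W)%N.
  rewrite ltnNge; apply/negP => sW; have := size_ev sW (eq_leq sb).
  by rewrite sn muln0 ltnS leqNgt n0.
have [q sW] : exists q, size W = q.+1 by exists (size W).-1; rewrite prednK // ltnW.
have q0 : (0 < q)%N by rewrite sW in nonconst.
have sW' : (size W <= q.+1)%N by rewrite sW.
have sb' : (size beta <= delta.+1)%N by rewrite sb.
have top := ev_top q0 sW' sb' lb.
have w0 := coef_top sW.
have en : (delta * q = n)%N.
  apply/eqP; rewrite eqn_leq; apply/andP; split; last first.
    by have := size_ev sW' sb'; rewrite sn.
  rewrite leqNgt; apply/negP => lt; have : (ev beta W)`_(delta * q) != 0.
    by rewrite top expf_neq0.
  by rewrite nth_default ?eqxx // sn.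
exists (size W`_q).-1, q; split=> //; last by rewrite prednK // size_poly_gt0.
by rewrite -en top in sm; have := size_exp W`_q delta; rewrite sm /= mulnC.
Qed.

(** The two degree bounds describe a region of horizontal width less than
    one, since [(a + b) m - 1 >= a m]. *)
Lemma width_lt1 (a b m n k l i : nat) : (0 < a)%N -> (0 < b)%N -> (0 < m)%N -> (m <= n)%N ->
  (l * m <= n * i)%N -> (i < k)%N ->
  k%:R * n%:R - ((a * m)%:R - k%:R) * ((n - m)%:R / ((a + b)%:R * m%:R - 1)) <= m%:R * l%:R :> rat ->
  (k <= a * m)%N -> False.
Proof.
move=> a0 b0 m0 mn li ik H kam.
have am : (0 < a * m)%N by rewrite muln_gt0 a0.
have Dm : (a * m)%:R <= (a + b)%:R * m%:R - 1 :> rat.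
  by rewrite lerBrDr natr1 -natrM ler_nat mulnDl -addn1 leq_add2l muln_gt0 b0.
have Dm0 : 0 < (a + b)%:R * m%:R - 1 :> rat by apply: lt_le_trans Dm; rewrite ltr0n.
have h1 : m%:R * l%:R <= n%:R * (k%:R - 1) :> rat.
  rewrite -natrM mulnC; apply: le_trans (_ : n%:R * i%:R <= _); first by rewrite -natrM ler_nat.
  by rewrite ler_wpM2l ?ler0n // lerBrDr natr1 ler_nat.
have h2 : n%:R <= ((a * m)%:R - k%:R) * ((n - m)%:R / ((a + b)%:R * m%:R - 1)) :> rat.
  by move: (le_trans H h1); lra.
have : ((a * m)%:R - k%:R) * ((n - m)%:R / ((a + b)%:R * m%:R - 1)) <= (n - m)%:R :> rat.
  rewrite mulrA ler_pdivrMr // mulrC; apply: ler_wpM2l; first by rewrite ler0n.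
  by apply: le_trans Dm; rewrite gerBl ler0n.
move=> h3; have := le_trans h2 h3; rewrite ler_nat; lia.
Qed.

Variables (a b delta m n : nat).
Hypotheses (a_gt1 : (1 < a)%N) (b_gt0 : (0 < b)%N) (cop : coprime a b)
  (delta_gt0 : (0 < delta)%N) (m_gt0 : (0 < m)%N) (mn : (m <= n)%N).
Variables (beta es : {poly C}) (F G W Z : BP) (c : C).
Notation Q := (ev beta W).
Hypotheses (beta_size : size beta = delta.+1) (beta_lead : beta`_delta = 1)
  (es_size : (size es <= a.-1 * delta)%N)
  (relF : F = Q ^+ a + ev es W + Z)
  (corner : forall j i, (a.-1 * n <= j)%N -> (a.-1 * m <= i)%N -> (F - Q ^+ a)`_j`_i = 0)
  (boxQ : boxed m n Q) (boxF : boxed (a * m) (a * n) F) (boxG : boxed (b * m) (b * n) G)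
  (J : jac F G = cst c) (Z_neq0 : Z != 0).

(** The top vertices of [Z] for the two lexicographic orders coincide by
    [width_lt1], so that [Z] has a corner. *)
Lemma two_directions : exists k l, [/\ boxed k l Z, (l < a.-1 * n)%N, (l * m <= n * k)%N,
  k%:R * n%:R - ((a * m)%:R - k%:R) * ((n - m)%:R / ((a + b)%:R * m%:R - 1)) <= m%:R * l%:R :> rat &
  (k <= a * m)%N].
Proof.
have n_gt0 := leq_trans m_gt0 mn.
have [sQ sQm] := boxed_size boxQ.
have [p [q [em en sW sw]]] := ev_shape beta_size beta_lead n_gt0 sQ sQm.
have [sQ' sQm'] := boxed_size (boxed_swap boxQ).
rewrite swap_ev in sQ' sQm'.
have [q' [p' [en' em' sW' sw']]] := ev_shape beta_size beta_lead m_gt0 sQ' sQm'.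
have pp : p' = p by apply/eqP; rewrite -(eqn_pmul2l delta_gt0) em em'.
have qq : q' = q by apply/eqP; rewrite -(eqn_pmul2l delta_gt0) en en'.
subst p' q'.
have p0 : (0 < p)%N by move: m_gt0; rewrite -em muln_gt0 => /andP[].
have q0 : (0 < q)%N by move: n_gt0; rewrite -en muln_gt0 => /andP[].
have pq : (p <= q)%N by rewrite -(leq_pmul2l delta_gt0) em en.
have [sF sFm] := boxed_size boxF; have [sG _] := boxed_size boxG.
have [sF' _] := boxed_size (boxed_swap boxF); have [sG' _] := boxed_size (boxed_swap boxG).
have [l sZ] : exists l, size Z = l.+1 by exists (size Z).-1; rewrite prednK // size_poly_gt0.
have Z_neq0' : swapXY Z != 0 by rewrite swapXY_eq0.
have [k sZ'] : exists k, size (swapXY Z) = k.+1.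
  by exists (size (swapXY Z)).-1; rewrite prednK // size_poly_gt0.
have relF' : swapXY F = ev beta (swapXY W) ^+ a + ev es (swapXY W) + swapXY Z.
  by rewrite relF !swapD swapX !swap_ev.
have corner' j i : (a.-1 * m <= j)%N -> (a.-1 * n <= i)%N ->
    (swapXY F - ev beta (swapXY W) ^+ a)`_j`_i = 0.
  by move=> jm jn; rewrite -swap_ev -swapX -swapB coef_swapXY corner.
have corner0 := corner; rewrite -em -en in corner0 corner' sF sF' sG sG'.
have zd := zeta_degree a_gt1 b_gt0 cop delta_gt0 q0 beta_size beta_lead es_size sW sw relF
  corner0 sF sG J sZ.
have zd' := zeta_degree a_gt1 b_gt0 cop delta_gt0 p0 beta_size beta_lead es_size sW' sw' relF'
  corner' sF' sG' (jac_swap J) sZ'.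
have ls := l_strict a_gt1 b_gt0 cop delta_gt0 q0 beta_size beta_lead es_size sW sw relF
  corner0 sF sG J sZ pq.
have kl := l_le a_gt1 b_gt0 cop delta_gt0 p0 beta_size beta_lead es_size sW' sw' relF'
  corner' sF' sG' (jac_swap J) sZ'.
have size_sup (P : BP) d j i : size P = d.+1 -> P`_j`_i != 0 -> (j <= d)%N.
  by move=> sP; apply: size_coef_lt; rewrite sP.
have top j i : Z`_j`_i != 0 -> (j <= l)%N /\ (i <= k)%N.
  move=> nz; split; first exact: size_sup sZ nz.
  by move: nz; rewrite -coef_swapXY; apply: size_sup.
set i := (size Z`_l).-1 in zd; set j := (size (swapXY Z)`_k).-1 in zd'.
have ni : Z`_l`_i != 0 by rewrite -lead_coefE lead_coef_eq0 coef_top.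
have nj : Z`_j`_k != 0 by rewrite -coef_swapXY -lead_coefE lead_coef_eq0 coef_top.
have [_ ik] := top _ _ ni; have [jl _] := top _ _ nj.
have d0 : 0 < delta%:R :> rat by rewrite ltr0n.
have pq0 : (p - q = 0)%N by apply/eqP.
have li : (l * m <= n * i)%N.
  rewrite -em -en -(ler_nat rat) mulnCA -mulnA !natrM ler_pM2l // -natrM.
  by move: zd; rewrite pq0 mulr0n mul0r mulr0 subr0 natrM.
have kam : (k <= a * m)%N.
  by apply: leq_trans kl _; rewrite em leq_mul2r leq_pred orbT.
have kb : k%:R * n%:R - ((a * m)%:R - k%:R) * ((n - m)%:R / ((a + b)%:R * m%:R - 1)) <= m%:R * j%:R :> rat.
  rewrite -em -en -mulnBr !natrM; rewrite -(ler_pM2l d0) in zd'.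
  move: zd'; rewrite !natrM.
  have -> : (a + b)%:R * (delta%:R * p%:R) = (a + b)%:R * delta%:R * p%:R :> rat by rewrite mulrA.
  by move: (_^-1) => z; lra.
(* the point [(k, j)] cannot lie to the right of [(i, l)] *)
have {}ik : i = k.
  apply/eqP; rewrite eqn_leq ik leqNgt; apply/negP => lt.
  apply: (width_lt1 (ltnW a_gt1) b_gt0 m_gt0 mn li lt _ kam).
  by apply: le_trans kb _; rewrite ler_wpM2l ?ler0n ?ler_nat.
have {}jl : j = l.
  apply/eqP; rewrite eqn_leq jl /=; have nz : (swapXY Z)`_k`_l != 0 by rewrite coef_swapXY -ik.
  rewrite -ltnS prednK ?size_poly_gt0 ?coef_top //.
  by rewrite ltnNge; apply: contra nz => le; rewrite nth_default.
rewrite ik in ni li; rewrite jl in kb.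
exists k, l; split=> //; by rewrite -en.
Qed.

End TwoDirections.

(** * Polynomials in two variables and their Newton polygons *)

Section Bridge.
Variable R : realType.
Notation C := (R[i]).
Notation BP := {poly {poly C}}.
Implicit Types f g : bipoly R.

Definition iterpoly_var (i : 'I_2) : BP := if i == var_x then 'X%:P else 'X.
Definition iterpoly (f : bipoly R) : BP := mmap (@cst C) iterpoly_var f.
HB.instance Definition _ := GRing.RMorphism.copy iterpoly (mmap (@cst C) iterpoly_var).

Lemma xyE (mm : 'X_{1..2}) : mm = xy (mm var_x) (mm var_y).
Proof.
apply/mnmP => i; rewrite multinomE (tnth_nth 0%N).
case: i => [[|[|//]] lt] /=; by congr (mm _); apply: val_inj.
Qed.

Lemma xy_eq (mm : 'X_{1..2}) i j : (mm == xy i j) = (mm var_x == i) && (mm var_y == j).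
Proof.
apply/eqP/andP => [->|[/eqP <- /eqP <-]]; last exact: xyE.
by rewrite !multinomE !(tnth_nth 0%N).
Qed.

Lemma coef_iterpoly f i j : (iterpoly f)`_j`_i = f@_(xy i j).
Proof.
rewrite /iterpoly /mmap !coef_sum.
have E (mm : 'X_{1..2}) : (cst f@_mm * mmap1 iterpoly_var mm)`_j`_i = f@_mm * (mm == xy i j)%:R.
  rewrite /mmap1 big_ord_recl big_ord1 (_ : lift ord0 ord0 = var_y); last exact: val_inj.
  rewrite (_ : ord0 = var_x); last exact: val_inj.
  rewrite /iterpoly_var /= /cst -[_%:P ^+ _]rmorphXn mulrA -polyCM coefCM coefXn.
  rewrite xy_eq [j == _]eq_sym; case: (_ == j); last by rewrite mulr0 coef0 andbF mulr0.
  by rewrite andbT mulr1 coefCM coefXn eq_sym.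
rewrite (eq_bigr _ (fun mm _ => E mm)).
have [nz|z] := boolP (xy i j \in msupp f).
  rewrite (bigD1_seq (xy i j)) //= eqxx mulr1 big1 ?addr0 // => mm /negPf ->.
  by rewrite mulr0.
rewrite (memN_msupp_eq0 z) big_seq big1 // => mm ms; case: eqP => [e|_]; last by rewrite mulr0.
by rewrite -e ms in z.
Qed.

Lemma iterpoly_deriv_x f : iterpoly (f^`M(var_x)) = deriv_x (iterpoly f).
Proof.
apply/polyP => j; apply/polyP => i; rewrite coef_iterpoly coef_deriv_x coef_deriv coef_iterpoly mcoeff_deriv.
rewrite {2}/xy multinomE (tnth_nth 0%N) /=; congr (f@_ _ *+ _).
by rewrite [LHS]xyE; congr xy; rewrite mnmDE mnmE !multinomE !(tnth_nth 0%N) /= ?addn1 ?addn0.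
Qed.

Lemma iterpoly_dy f : iterpoly (f^`M(var_y)) = (iterpoly f)^`().
Proof.
apply/polyP => j; apply/polyP => i; rewrite coef_deriv coefMn !coef_iterpoly mcoeff_deriv.
rewrite {2}/xy multinomE (tnth_nth 0%N) /=; congr (f@_ _ *+ _).
by rewrite [LHS]xyE; congr xy; rewrite mnmDE mnmE !multinomE !(tnth_nth 0%N) /= ?addn1 ?addn0.
Qed.

Lemma iterpoly_C c : iterpoly c%:MP = cst c.
Proof. by rewrite /iterpoly mmapC. Qed.

Lemma iterpolyB f g : iterpoly (f - g) = iterpoly f - iterpoly g.
Proof. exact: raddfB. Qed.

Lemma iterpolyM f g : iterpoly (f * g) = iterpoly f * iterpoly g.
Proof. exact: rmorphM. Qed.

Lemma iterpoly_bracket f g : iterpoly (bracket f g) = jac (iterpoly f) (iterpoly g).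
Proof. by rewrite /bracket iterpolyB !iterpolyM !iterpoly_deriv_x !iterpoly_dy. Qed.

Lemma iterpolyZ c f : iterpoly (c *: f) = cst c * iterpoly f.
Proof. exact: mmapZ. Qed.

Lemma iterpolyX f k : iterpoly (f ^+ k) = iterpoly f ^+ k.
Proof. exact: rmorphXn. Qed.

Lemma iterpoly_alg e f : iterpoly (horner_alg f e) = ev e (iterpoly f).
Proof.
rewrite /horner_alg /horner_morph /ev -horner_map -map_poly_comp; congr (_.[_]).
apply: eq_map_poly => c /=.
by rewrite -mul_mpolyC mulr1 iterpoly_C.
Qed.

Lemma iterpoly_inj f : iterpoly f = 0 -> f = 0.
Proof. by move=> e; apply/mpolyP => mm; rewrite [mm]xyE -coef_iterpoly e !coef0 mcoeff0. Qed.

Lemma iterpoly_sum N (e : nat -> C) f :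
  iterpoly (\sum_(j < N) e j *: f ^+ j) = ev (\poly_(j < N) e j) (iterpoly f).
Proof.
rewrite ev_poly (raddf_sum iterpoly); apply: eq_bigr => j _.
by rewrite -[LHS]/(iterpoly (e j *: f ^+ j)) iterpolyZ iterpolyX.
Qed.

Lemma Rect_lattice m n i j : Rect R m n (lattice_pt R i j) <-> (i <= m)%N /\ (j <= n)%N.
Proof. by rewrite /Rect /= !in_itv /= !ler0n !ler_nat. Qed.

Lemma supp_lattice f i j : f@_(xy i j) != 0 -> supp f (lattice_pt R i j).
Proof. by move=> nz; exists i, j. Qed.

Lemma supp_N0 f : (supp f `<=` N0 f)%classic.
Proof. by move=> x fx; apply: sub_gen_smallest; left. Qed.

Lemma iterpoly_boxed m n f : (supp f `<=` Rect R m n)%classic -> f@_(xy m n) != 0 -> boxed m n (iterpoly f).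
Proof.
move=> sf top; split; first by rewrite coef_iterpoly.
by move=> j i; rewrite coef_iterpoly => /supp_lattice/sf/Rect_lattice[].
Qed.

Lemma Rect_convex m n : @convex_set R (plane R) (Rect R m n).
Proof.
have mix (u s t z : R) : 0 <= u <= 1 -> 0 <= s <= z -> 0 <= t <= z -> 0 <= u * s + (1 - u) * t <= z.
  by move=> /andP[u0 u1] /andP[s0 sz] /andP[t0 tz]; apply/andP; split; nra.
move=> x y t; rewrite !inE /Rect /= !in_itv /= => -[x1 x2] [y1 y2].
have t01 : 0 <= t%:num <= 1 by apply/andP.
by split; [exact: mix t01 x1 y1|exact: mix t01 x2 y2].
Qed.

Lemma boxed_Rbar k l f : boxed k l (iterpoly f) -> Rbar_ R k l f.
Proof.
move=> [top sup]; rewrite coef_iterpoly in top; split=> //.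
apply: smallest_sub; first exact: Rect_convex.
move=> x [[i [j [nz ->]]]|->]; apply/Rect_lattice; last by [].
by have := sup j i; rewrite coef_iterpoly => /(_ nz) [].
Qed.

End Bridge.

(** Without denominators the inequality can be moved from [rat] to a
    [realType]. *)
Lemma line_bound_nat (a b m n k l : nat) : (0 < a)%N -> (0 < b)%N -> (0 < m)%N -> (m <= n)%N ->
  (k <= a * m)%N ->
  k%:R * n%:R - ((a * m)%:R - k%:R) * ((n - m)%:R / ((a + b)%:R * m%:R - 1)) <= m%:R * l%:R :> rat ->
  (k * n * ((a + b) * m - 1) <= m * l * ((a + b) * m - 1) + (a * m - k) * (n - m))%N.
Proof.
move=> a0 b0 m0 mn km.
have D1 : (1 < (a + b) * m)%N.
  by rewrite (leq_trans (_ : 1 < a + b)%N) ?leq_pmulr // -(addn1 1) leq_add.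
have DE : ((a + b) * m - 1)%:R = (a + b)%:R * m%:R - 1 :> rat by rewrite natrB ?natrM // ltnW.
have D0 : 0 < ((a + b) * m - 1)%:R :> rat by rewrite ltr0n subn_gt0.
rewrite -DE -(ler_pM2r D0) mulrBl mulrA divfK ?gt_eqF // lerBlDr => h.
by move: h; rewrite -(ler_nat rat) natrD !natrM (natrB _ km) !natrM.
Qed.

(** The slope is [((a + b) n - 1) / ((a + b) m - 1)], because
    [a / (a + b)] divides out. *)
Lemma frakR_lattice (R : realType) (a b m n k l : nat) : (0 < a)%N -> (0 < b)%N -> (0 < m)%N ->
  (m <= n)%N -> (l < a.-1 * n)%N -> (l * m <= n * k)%N -> (k <= a * m)%N ->
  (k * n * ((a + b) * m - 1) <= m * l * ((a + b) * m - 1) + (a * m - k) * (n - m))%N ->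
  frakR R a b (a * m) (a * n) (lattice_pt R k l).
Proof.
move=> a0 b0 m0 mn la lm km line.
have n0 : (0 < n)%N := leq_trans m0 mn.
have D1 : (1 < (a + b) * m)%N.
  by rewrite (leq_trans (_ : 1 < a + b)%N) ?leq_pmulr // -(addn1 1) leq_add.
have aR : 0 < a%:R :> R by rewrite ltr0n.
have bR : 0 < b%:R :> R by rewrite ltr0n.
have mR : 0 < m%:R :> R by rewrite ltr0n.
have sR : 0 < a%:R + b%:R :> R by rewrite addr_gt0.
have D0 : 0 < (a%:R + b%:R) * m%:R - 1 :> R by rewrite subr_gt0 -natrD -natrM ltr1n.
split.
  rewrite ler0n /= natrM mulrA divfK ?gt_eqF //.
  by rewrite -[a%:R - 1](natrB _ a0) subn1 -natrM ltr_nat.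
apply/andP; split; last first.
  by rewrite !natrM -mulf_div divff ?gt_eqF // mul1r mulrAC ler_pdivlMr // -!natrM ler_nat.
have sE : slope R a b (a * m) (a * n) =
    ((a%:R + b%:R) * n%:R - 1) / ((a%:R + b%:R) * m%:R - 1).
  rewrite /slope !natrM; field.
  have -> : a%:R * m%:R * (a%:R + b%:R) - a%:R = a%:R * ((a%:R + b%:R) * m%:R - 1) :> R by ring.
  by rewrite mulf_neq0 !gt_eqF.
rewrite sE -(ler_pM2r D0) mulrDl mulrAC [X in X + _](_ : _ =
  ((a%:R + b%:R) * n%:R - 1) * (k%:R - a%:R / (a%:R + b%:R))); last first.
  by field; rewrite !gt_eqF.
have key : k%:R * n%:R * ((a%:R + b%:R) * m%:R - 1) <=
   m%:R * l%:R * ((a%:R + b%:R) * m%:R - 1) + (a%:R * m%:R - k%:R) * (n%:R - m%:R) :> R.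
  move: line; rewrite -(ler_nat R) natrD !natrM (natrB _ km) (natrB _ mn) (natrB _ (ltnW D1)).
  by rewrite !natrM natrD.
rewrite -(ler_pM2l mR).
have -> : ((a%:R + b%:R) * n%:R - 1) * (k%:R - a%:R / (a%:R + b%:R)) +
    a%:R / (a%:R + b%:R) * ((a%:R + b%:R) * m%:R - 1) =
    ((a%:R + b%:R) * n%:R - 1) * k%:R - a%:R * (n%:R - m%:R) :> R.
  by field; rewrite gt_eqF.
by move: key; lra.
Qed.

Lemma Ncorner_lattice (R : realType) (a m n i j : nat) : (0 < a)%N ->
  (a.-1 * m <= i <= a * m)%N -> (a.-1 * n <= j <= a * n)%N ->
  Ncorner a (a * m) (a * n) (lattice_pt R i j).
Proof.
move=> a0 im jn; rewrite /Ncorner /= !in_itv /=.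
have E k : (a%:R - 1) / a%:R * (a * k)%:R = (a.-1 * k)%:R :> R.
  by rewrite natrM mulrA divfK ?pnatr_eq0 -?lt0n // natrM -subn1 natrB.
by rewrite !E !ler_nat.
Qed.

Theorem theorem5p8 (R : realType) (a b m n : nat) (F G Z : bipoly R) :
  inQ a b m n -> (m <= n)%N ->
  R_ R m n F -> R_ R (b * m %/ a) (b * n %/ a) G ->
  (exists c : R[i], bracket F G = c%:MP) ->
  innermost a m n F Z ->
  Z = 0 \/
  exists m' n' : nat,
    [/\ (0 < m')%N /\ (0 < n')%N,
        Rbar_ R m' n' Z & frakR R a b m n (lattice_pt R m' n')].
Proof.
move=> [[a0 b0 m0 n0] am an cop /andP[a2 _]] mn [NF Fmn] [NG Gmn] [c brc].
move=> [Q [W [beta [e [[sQ Q1 cornerQ] [_ _ [beta_monic beta_size _] QE _] ZE Zvan]]]]].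
have [Z0|Z0] := eqVneq Z 0; [by left|right].
have [m1 mE] := dvdnP am; have [n1 nE] := dvdnP an.
rewrite mulnC in mE; rewrite mulnC in nE; subst m n.
rewrite !mulKn // in sQ Q1 Zvan; rewrite [(b * (a * m1))%N]mulnCA [(b * (a * n1))%N]mulnCA !mulKn // in NG Gmn.
have m10 : (0 < m1)%N by move: m0; rewrite muln_gt0 => /andP[].
have mn1 : (m1 <= n1)%N by move: mn; rewrite leq_pmul2l.
set delta := (size beta).-1 in ZE Zvan.
have beta_s : size beta = delta.+1 by rewrite prednK // ltnW.
have delta0 : (0 < delta)%N by rewrite -ltnS -beta_s.
have beta1 : beta`_delta = 1 by move/monicP: beta_monic; rewrite lead_coefE.
pose es : {poly R[i]} := \poly_(j < (a - 1) * delta) e j.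
have es_s : (size es <= a.-1 * delta)%N by rewrite -subn1 size_poly.
have tQ : iterpoly Q = ev beta (iterpoly W) by rewrite QE iterpoly_alg.
have boxF : boxed (a * m1) (a * n1) (iterpoly F).
  by apply: iterpoly_boxed; [rewrite -NF; apply: supp_N0|rewrite Fmn oner_eq0].
have boxG : boxed (b * m1) (b * n1) (iterpoly G).
  by apply: iterpoly_boxed; [rewrite -NG; apply: supp_N0|rewrite Gmn oner_eq0].
have boxQ : boxed m1 n1 (iterpoly Q) by apply: iterpoly_boxed; rewrite // Q1 oner_eq0.
have rel : iterpoly F = ev beta (iterpoly W) ^+ a + ev es (iterpoly W) + iterpoly Z.
  rewrite ZE !iterpolyB iterpolyX iterpoly_sum tQ -/es -[_ - _ - _]addrA -opprD.
  by rewrite [RHS]addrC subrK.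
have Jc : jac (iterpoly F) (iterpoly G) = cst c by rewrite -iterpoly_bracket brc iterpoly_C.
have Zn0 : iterpoly Z != 0 by apply: contra_neq Z0; apply: iterpoly_inj.
have corner j i : (a.-1 * n1 <= j)%N -> (a.-1 * m1 <= i)%N ->
    (iterpoly F - ev beta (iterpoly W) ^+ a)`_j`_i = 0.
  move=> jn im; rewrite -tQ -iterpolyX -iterpolyB coef_iterpoly.
  apply/eqP/negP => /negP nz.
  have [jn' im'] : (j <= a * n1)%N /\ (i <= a * m1)%N.
    by apply: (boxed_subX boxF boxQ); rewrite -iterpolyX -iterpolyB coef_iterpoly.
  have : (supp (F - Q ^+ a) `&` Ncorner a (a * m1) (a * n1))%classic (lattice_pt R i j).
    split; first exact: supp_lattice.
    by apply: Ncorner_lattice => //; apply/andP.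
  by rewrite cornerQ.
rewrite tQ in boxQ.
have [k [l [boxZ ln lk line km]]] := two_directions a2 b0 cop delta0 m10 mn1 beta_s beta1 es_s rel
  corner boxQ boxF boxG Jc Zn0.
(* if [l = 0] then [Z] is constant, but its constant coefficient is zero *)
have l0 : (0 < l)%N.
  rewrite lt0n; apply/eqP => l0; subst l.
  have k0 : k = 0%N.
    apply/eqP; rewrite -leqn0 leqNgt; apply/negP => k0.
    exact: (width_lt1 a0 b0 m10 mn1 _ k0 line km).
  subst k; have := boxZ.1; rewrite coef_iterpoly.
  have N0 : (0 < (a - 1) * delta)%N by rewrite muln_gt0 subn_gt0 a2.
  by have := Zvan 0%N N0; rewrite !mul0n => ->; rewrite eqxx.
have k0 : (0 < k)%N.
  rewrite lt0n; apply/eqP => k0; move: lk; rewrite k0 muln0 leqNgt muln_gt0 l0.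
  by rewrite m10.
exists k, l; split=> //; first exact: boxed_Rbar.
apply: frakR_lattice => //; exact: line_bound_nat.
Qed.
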